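(* Let $D$ be the open unit disc, let $D'\subset D$ be an open disc whose boundary circle $\partial D'$ is internally tangent to $\mathbb T=\partial D$ at the point $1$, and let $\Omega=D\setminus\overline{D'}$. Every function in $A^{\infty}(\Omega)$ can be written uniquely as the sum (on $\Omega$) of a function in $A^{\infty}(D)$ and a function in $A^{\infty}_0(\hat{\mathbb C}\setminus \overline{D'})$.
   Context: $\hat{\mathbb C}=\mathbb C\cup\{\infty\}$. The disc $D'$ is a proper subdisc of $D$, so $\partial D'\cap\mathbb T=\{1\}$. For a domain $G\subseteq\mathbb C$, $A^\infty(G)$ is the space of holomorphic functions $f$ on $G$ all of whose derivatives $f^{(l)}$, $l\ge0$, extend continuously to $\overline G$. $A^\infty_0(\hat{\mathbb C}\setminus\overline{D'})$ is the space of functions $f$ holomorphic on $\mathbb C\setminus\overline{D'}$ all of whose derivatives $f^{(l)}$, $l\ge0$, extend continuously to $\mathbb C\setminus D'$, with $\lim_{z\to\infty}f(z)=0$. *)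

(* Defs.v *)
From Stdlib Require Import Reals.
From Coquelicot Require Import Coquelicot.

Open Scope R_scope.

Definition disc (c : C) (r : R) : C -> Prop := fun z => Cmod (z - c)%C < r.
Definition circle (c : C) (r : R) : C -> Prop := fun z => Cmod (z - c)%C = r.

Definition unit_disc : C -> Prop := disc (RtoC 0) 1.
Definition unit_circle : C -> Prop := circle (RtoC 0) 1.

Definition closure (G : C -> Prop) : C -> Prop :=
  fun z => forall U : C -> Prop, locally z U -> exists w, U w /\ G w.

Definition internally_tangent_unit (c : C) (r : R) (p : C) : Prop :=
  (forall z, disc c r z -> unit_disc z) /\
  (forall z, circle c r z /\ unit_circle z <-> z = p).

(** Functions on a subset of the plane are total functions [C -> C] whose
    values outside that subset are irrelevant. *)
Definition holomorphic_on (G : C -> Prop) (f : C -> C) : Prop :=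
  forall z, G z -> ex_derive (K := C_AbsRing) (V := C_NormedModule) f z.

(** [C_derive] is a total operator; on an open set where [f] is holomorphic it
    returns the complex derivative, so [C_derive_n l f] is [f^(l)] there. *)
Fixpoint C_derive_n (l : nat) (f : C -> C) : C -> C :=
  match l with
  | O => f
  | S k => C_derive (C_derive_n k f)
  end.

Definition extends_continuously (G K : C -> Prop) (f : C -> C) : Prop :=
  exists F : C -> C,
    (forall z, G z -> F z = f z) /\
    (forall z, K z -> filterlim F (within K (locally z)) (locally (F z))).

(** Used only for open [G], so that the derivatives on [G] depend only on the
    values of [f] on [G]. *)
Definition Ainf (G : C -> Prop) (f : C -> C) : Prop :=
  holomorphic_on G f /\
  forall l : nat, extends_continuously G (closure G) (C_derive_n l f).

Definition C_infinity (P : C -> Prop) : Prop :=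
  exists M : R, forall z, M < Cmod z -> P z.

Definition disc_exterior (c : C) (r : R) : C -> Prop :=
  fun z => ~ closure (disc c r) z.

(** [A^infty_0] of the Riemann sphere minus the closed disc of centre [c] and
    radius [r]. *)
Definition Ainf0 (c : C) (r : R) (f : C -> C) : Prop :=
  holomorphic_on (disc_exterior c r) f /\
  (forall l : nat,
     extends_continuously (disc_exterior c r) (fun z => ~ disc c r z)
       (C_derive_n l f)) /\
  filterlim f C_infinity (locally (RtoC 0)).

Definition crescent (c : C) (r : R) : C -> Prop :=
  fun z => unit_disc z /\ disc_exterior c r z.

(* Main.v *)
Require Import Defs.
From Stdlib Require Import Reals Lra Lia ZArith ClassicalEpsilon.
From Coquelicot Require Import Coquelicot.
(* Stdlib's topology library also has a [closure] and a [disc]. *)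
Import Defs.

(** Cauchy's formula on the crescent splits [f] into an integral over the unit
    circle, which defines [g], and one over the inner circle, which defines
    [h]. The circles through [1] of centre [1 - s] and radius [s], for
    [r <= s <= 1], sweep out the closed crescent, and the contour integral of a
    holomorphic function over them does not depend on [s]; with
    [(f w - f z) / (w - z)] as integrand this is Cauchy's formula. Expanding the
    Cauchy kernels makes [g] a power series in [z] and [h] a power series in
    [r / (z - c)]; integration by parts along the same circles, using the
    boundary values of all derivatives of [f], shows that their coefficients
    decay rapidly, so both are smooth up to the boundary.

    Uniqueness: if [g = h] on the crescent, with [g] and [h] in the two spaces,
    split this common function by the same formula. The first term is [g] by
    Cauchy's formula in the disc and the second is [h] by Cauchy's formula in
    the exterior, so [g = g + h = 2 g] on the crescent and both vanish. *)

Local Open Scope C_scope.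

(** * Limits and derivatives of complex-valued functions *)

(** The obstacle is the boundary. All the tangent circles meet at the cusp [1], and there, as on the
    two boundary circles, [f] has continuous extensions but no known derivative. Three devices avoid
    differentiating at such points. The velocity of the family with respect to its radius is
    [expi t - 1], which vanishes exactly at the cusp. Identities are proved for [r < s < 1] and
    reach [s = r] and [s = 1] because the integrals depend continuously on [s]. Continuity of the
    integrands is always taken relative to the swept region. The hypotheses make every
    [C_derive_n l f] continuous inside, which is what differentiation under the integral sign
    requires. Continuity of [C_derive f] does not make it differentiable, however, so a local power
    series expansion has to supply this before the derivatives can be chained. The inner kernel is
    [1 / (1 - expi t * w) - 1] with [w = r / (z - c)]. Its expansion starts at degree one, hence [h]
    vanishes at infinity. Cauchy's formula in the exterior is the formula in the disc, transported
    by the inversion [v = r / (z - c)]. *)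

Lemma Cmod_minus_sym (a b : C) : Cmod (a - b) = Cmod (b - a).
Proof. rewrite <- Cmod_opp. f_equal. ring. Qed.

Lemma Cmod_le_Rabs (z : C) : (Cmod z <= Rabs (Re z) + Rabs (Im z))%R.
Proof.
  apply Rsqr_incr_0_var.
  2: { pose proof (Rabs_pos (Re z)); pose proof (Rabs_pos (Im z)); lra. }
  rewrite !Rsqr_pow2, Cmod2_alt.
  pose proof (Rabs_pos (Re z)); pose proof (Rabs_pos (Im z)).
  rewrite <- (pow2_abs (Re z)), <- (pow2_abs (Im z)). nra.
Qed.

Lemma im_le_Cmod (z : C) : (Rabs (Im z) <= Cmod z)%R.
Proof. eapply Rle_trans; [apply Rmax_r | apply Rmax_Cmod]. Qed.

Lemma filterlim_C_lt {T : Type} {F : (T -> Prop) -> Prop}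
    (f : T -> C) (l : C) (eps : R) :
  filterlim f F (locally l) -> (0 < eps)%R ->
  F (fun x => (Cmod (f x - l) < eps)%R).
Proof.
  intros H Heps. apply (H (fun y => Cmod (y - l) < eps)%R).
  apply (proj2 (locally_C l _)).
  exists (mkposreal eps Heps). intros y Hy. exact Hy.
Qed.

Lemma filterlim_C {T : Type} {F : (T -> Prop) -> Prop} {FF : Filter F}
    (f : T -> C) (l : C) :
  filterlim f F (locally l) <->
  (forall eps, (0 < eps)%R -> F (fun x => (Cmod (f x - l) < eps)%R)).
Proof.
  split.
  - intros H eps Heps. now apply filterlim_C_lt.
  - intros H P HP. unfold filtermap.
    apply (proj1 (locally_C l _)) in HP. destruct HP as [d Hd].
    eapply filter_imp; [| apply (H d (cond_pos d))].
    intros x Hx. apply Hd. exact Hx.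
Qed.

Lemma filterlim_C_eq {T : Type} {F : (T -> Prop) -> Prop} (a b : C) (f : T -> C) :
  a = b -> filterlim f F (locally a) -> filterlim f F (locally b).
Proof. now intros ->. Qed.

Lemma locally_Cmod (z : C) (P : C -> Prop) :
  locally z P <->
  exists d, (0 < d)%R /\ forall w, (Cmod (w - z) < d)%R -> P w.
Proof.
  split.
  - intros H. apply (proj1 (locally_C z _)) in H. destruct H as [d Hd].
    exists d; split; [apply cond_pos |]. intros w Hw. apply Hd. exact Hw.
  - intros [d [Hd H]]. apply (proj2 (locally_C z _)).
    exists (mkposreal d Hd). intros y Hy. apply H. exact Hy.
Qed.

Lemma filterlim_Re {T : Type} {F : (T -> Prop) -> Prop} {FF : Filter F}
    (f : T -> C) (l : C) :
  filterlim f F (locally l) -> filterlim (fun x => Re (f x)) F (locally (Re l)).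
Proof.
  intros H. apply filterlim_locally; intros eps.
  generalize (filterlim_C_lt _ _ _ H (cond_pos eps)).
  apply filter_imp. intros x Hx.
  eapply Rle_lt_trans; [| apply Hx].
  eapply Rle_trans; [| apply re_le_Cmod]. apply Rle_refl.
Qed.

Lemma filterlim_Im {T : Type} {F : (T -> Prop) -> Prop} {FF : Filter F}
    (f : T -> C) (l : C) :
  filterlim f F (locally l) -> filterlim (fun x => Im (f x)) F (locally (Im l)).
Proof.
  intros H. apply filterlim_locally; intros eps.
  generalize (filterlim_C_lt _ _ _ H (cond_pos eps)).
  apply filter_imp. intros x Hx.
  eapply Rle_lt_trans; [| apply Hx].
  eapply Rle_trans; [| apply im_le_Cmod]. apply Rle_refl.
Qed.

Lemma filterlim_Re_Im {T : Type} {F : (T -> Prop) -> Prop} {FF : Filter F}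
    (f : T -> C) (l : C) :
  filterlim (fun x => Re (f x)) F (locally (Re l)) ->
  filterlim (fun x => Im (f x)) F (locally (Im l)) ->
  filterlim f F (locally l).
Proof.
  intros H1 H2. apply filterlim_C. intros eps Heps.
  assert (He : (0 < eps / 2)%R) by lra.
  generalize (proj1 (filterlim_locally _ _) H1 (mkposreal _ He)).
  generalize (proj1 (filterlim_locally _ _) H2 (mkposreal _ He)).
  intros A B. generalize (filter_and _ _ A B). apply filter_imp.
  intros x [Hx Hy]. change (Rabs (Im (f x) - Im l) < eps / 2)%R in Hx.
  change (Rabs (Re (f x) - Re l) < eps / 2)%R in Hy.
  eapply Rle_lt_trans; [apply Cmod_le_Rabs |].
  change (Re (f x - l)) with (Re (f x) - Re l)%R.
  change (Im (f x - l)) with (Im (f x) - Im l)%R. lra.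
Qed.

Section Limits.
Context {T : Type} {F : (T -> Prop) -> Prop} {FF : Filter F}.

Lemma filterlim_Cplus (f g : T -> C) (a b : C) :
  filterlim f F (locally a) -> filterlim g F (locally b) ->
  filterlim (fun x => f x + g x) F (locally (a + b)).
Proof.
  intros Hf Hg. apply filterlim_C; intros eps Heps.
  generalize (filter_and (F := F) _ _ (filterlim_C_lt _ _ (eps / 2)%R Hf ltac:(lra))
    (filterlim_C_lt _ _ (eps / 2)%R Hg ltac:(lra))).
  apply filter_imp. intros x [H1 H2].
  replace (f x + g x - (a + b)) with ((f x - a) + (g x - b)) by ring.
  eapply Rle_lt_trans; [apply Cmod_triangle | lra].
Qed.

Lemma filterlim_Cmult (f g : T -> C) (a b : C) :
  filterlim f F (locally a) -> filterlim g F (locally b) ->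
  filterlim (fun x => f x * g x) F (locally (a * b)).
Proof.
  intros Hf Hg. apply filterlim_C; intros eps Heps.
  set (M := (1 + Cmod a + Cmod b)%R).
  assert (HM : (1 <= M)%R) by (unfold M; pose proof (Cmod_ge_0 a); pose proof (Cmod_ge_0 b); lra).
  assert (Hd : (0 < Rmin 1 (eps / (2 * M)))%R).
  { apply Rmin_glb_lt; [lra |]. apply Rdiv_lt_0_compat; lra. }
  generalize (filter_and (F := F) _ _ (filterlim_C_lt _ _ _ Hf Hd)
    (filterlim_C_lt _ _ _ Hg Hd)).
  apply filter_imp. intros x [H1 H2].
  replace (f x * g x - a * b) with ((f x - a) * (g x - b) + (f x - a) * b + a * (g x - b)) by ring.
  eapply Rle_lt_trans; [eapply Rle_trans; [apply Cmod_triangle | apply Rplus_le_compat_r, Cmod_triangle] |].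
  rewrite !Cmod_mult.
  pose proof (Cmod_ge_0 a); pose proof (Cmod_ge_0 b).
  pose proof (Cmod_ge_0 (f x - a)); pose proof (Cmod_ge_0 (g x - b)).
  set (d := Rmin 1 (eps / (2 * M))) in *.
  assert (Hd1 : (d <= 1)%R) by apply Rmin_l.
  assert (Hd2 : (d * M <= eps / 2)%R).
  { replace (eps / 2)%R with (eps / (2 * M) * M)%R by (field; lra).
    apply Rmult_le_compat_r; [lra | apply Rmin_r]. }
  apply Rle_lt_trans with (d * M)%R; [| lra].
  unfold M. nra.
Qed.

Lemma filterlim_Copp (f : T -> C) (a : C) :
  filterlim f F (locally a) -> filterlim (fun x => - f x) F (locally (- a)).
Proof.
  intros Hf. apply filterlim_C; intros eps Heps.
  generalize (filterlim_C_lt _ _ _ Hf Heps). apply filter_imp.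
  intros x Hx. replace (- f x - - a) with (- (f x - a)) by ring.
  now rewrite Cmod_opp.
Qed.

Lemma filterlim_Cminus (f g : T -> C) (a b : C) :
  filterlim f F (locally a) -> filterlim g F (locally b) ->
  filterlim (fun x => f x - g x) F (locally (a - b)).
Proof. intros Hf Hg. apply filterlim_Cplus; [exact Hf | now apply filterlim_Copp]. Qed.

Lemma filterlim_Cinv (f : T -> C) (a : C) :
  a <> 0 -> filterlim f F (locally a) ->
  filterlim (fun x => / f x) F (locally (/ a)).
Proof.
  intros Ha Hf. apply filterlim_C; intros eps Heps.
  assert (Hm : (0 < Cmod a)%R) by now apply Cmod_gt_0.
  assert (Hd : (0 < Rmin (Cmod a / 2) (eps * Cmod a * Cmod a / 2))%R).
  { apply Rmin_glb_lt; [lra |]. pose proof (Rmult_lt_0_compat _ _ Hm Hm). nra. }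
  generalize (filterlim_C_lt _ _ _ Hf Hd). apply filter_imp. intros x Hx.
  set (d := Rmin (Cmod a / 2) (eps * Cmod a * Cmod a / 2)) in *.
  assert (d <= Cmod a / 2)%R by apply Rmin_l.
  assert (d <= eps * Cmod a * Cmod a / 2)%R by apply Rmin_r.
  assert (Hlow : (Cmod a / 2 < Cmod (f x))%R).
  { assert (Cmod a <= Cmod (f x) + Cmod (a - f x))%R.
    { replace a with (f x + (a - f x)) at 1 by ring. apply Cmod_triangle. }
    rewrite (Cmod_minus_sym a) in H1. lra. }
  assert (Hfx : f x <> 0) by (apply Cmod_gt_0; lra).
  replace (/ f x - / a) with ((a - f x) * / (f x * a)) by (field; auto).
  rewrite Cmod_mult, Cmod_inv, Cmod_mult by now apply Cmult_neq_0.
  rewrite Cmod_minus_sym.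
  apply Rmult_lt_reg_r with (Cmod (f x) * Cmod a)%R; [nra |].
  rewrite Rmult_assoc, Rinv_l by nra. nra.
Qed.

Lemma filterlim_Cdiv (f g : T -> C) (a b : C) :
  b <> 0 -> filterlim f F (locally a) -> filterlim g F (locally b) ->
  filterlim (fun x => f x / g x) F (locally (a / b)).
Proof. intros Hb Hf Hg. apply filterlim_Cmult; [exact Hf | now apply filterlim_Cinv]. Qed.

Lemma filterlim_Cpow (f : T -> C) (a : C) (n : nat) :
  filterlim f F (locally a) ->
  filterlim (fun x => f x ^ n) F (locally (a ^ n)).
Proof.
  intros Hf. induction n as [| n IH]; [apply filterlim_const |].
  apply filterlim_ext with (fun x => f x * f x ^ n); [intros x; now rewrite Cpow_S |].
  rewrite Cpow_S. now apply filterlim_Cmult.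
Qed.
End Limits.

Lemma filterlim_RtoC (x : R) : filterlim RtoC (locally x) (locally (RtoC x)).
Proof.
  apply filterlim_Re_Im; cbn; [apply filterlim_id | apply filterlim_const].
Qed.

(** Carathéodory's form of differentiability: product, quotient and chain
    rules reduce to limit algebra. The embedding [j] of the domain is the
    identity of [C] for complex derivatives and [RtoC] for curves. *)
Definition has_deriv {T : UniformSpace} (j f : T -> C) (x : T) (v : C) : Prop :=
  exists psi : T -> C,
    psi x = v /\ filterlim psi (locally x) (locally v) /\
    locally x (fun y => f y - f x = (j y - j x) * psi y).

Notation cderiv := (has_deriv (T := C_UniformSpace) (fun z : C => z)).
Notation rderiv := (has_deriv (T := R_UniformSpace) RtoC).

Section DerivRules.
Context {T : UniformSpace} (j : T -> C).
Hypothesis j_cont : forall x, filterlim j (locally x) (locally (j x)).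

Lemma has_deriv_const (a : C) (x : T) : has_deriv j (fun _ => a) x 0.
Proof.
  exists (fun _ => 0). repeat split; [apply filterlim_const |].
  apply filter_forall. intros y. ring.
Qed.

Lemma has_deriv_id (x : T) : has_deriv j j x 1.
Proof.
  exists (fun _ => 1). repeat split; [apply filterlim_const |].
  apply filter_forall. intros y. ring.
Qed.

Lemma has_deriv_cont (f : T -> C) (x : T) (v : C) :
  has_deriv j f x v -> filterlim f (locally x) (locally (f x)).
Proof.
  intros [psi [_ [Hl He]]].
  apply filterlim_ext_loc with (fun y => f x + (j y - j x) * psi y).
  { revert He. apply filter_imp. intros y Hy. rewrite <- Hy. ring. }
  apply (filterlim_C_eq (f x + (j x - j x) * v)); [ring |].
  apply filterlim_Cplus; [apply filterlim_const |].
  apply filterlim_Cmult; [| exact Hl].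
  apply filterlim_Cminus; [apply j_cont | apply filterlim_const].
Qed.

Lemma has_deriv_plus (f g : T -> C) (x : T) (a b : C) :
  has_deriv j f x a -> has_deriv j g x b ->
  has_deriv j (fun y => f y + g y) x (a + b).
Proof.
  intros [p [Hp1 [Hp2 Hp3]]] [q [Hq1 [Hq2 Hq3]]].
  exists (fun y => p y + q y). repeat split.
  - now rewrite Hp1, Hq1.
  - now apply filterlim_Cplus.
  - eapply filter_imp; [| exact (filter_and _ _ Hp3 Hq3)].
    intros y [H1 H2].
    replace (f y + g y - (f x + g x)) with ((f y - f x) + (g y - g x)) by ring.
    rewrite H1, H2. ring.
Qed.

Lemma has_deriv_mult (f g : T -> C) (x : T) (a b : C) :
  has_deriv j f x a -> has_deriv j g x b ->
  has_deriv j (fun y => f y * g y) x (a * g x + f x * b).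
Proof.
  intros Hf Hg. assert (Cg := has_deriv_cont _ _ _ Hg).
  destruct Hf as [p [Hp1 [Hp2 Hp3]]]. destruct Hg as [q [Hq1 [Hq2 Hq3]]].
  exists (fun y => p y * g y + f x * q y). repeat split.
  - now rewrite Hp1, Hq1.
  - apply filterlim_Cplus; apply filterlim_Cmult; first [assumption | apply filterlim_const].
  - eapply filter_imp; [| exact (filter_and _ _ Hp3 Hq3)].
    intros y [H1 H2].
    replace (f y * g y - f x * g x) with ((f y - f x) * g y + f x * (g y - g x)) by ring.
    rewrite H1, H2. ring.
Qed.

Lemma has_deriv_inv (f : T -> C) (x : T) (a : C) :
  f x <> 0 -> has_deriv j f x a ->
  has_deriv j (fun y => / f y) x (- a / (f x * f x)).
Proof.
  intros Hx Hf. assert (Cf := has_deriv_cont _ _ _ Hf).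
  destruct Hf as [p [Hp1 [Hp2 Hp3]]].
  exists (fun y => - p y / (f y * f x)). repeat split.
  - now rewrite Hp1.
  - apply filterlim_Cdiv; [now apply Cmult_neq_0 | now apply filterlim_Copp |].
    apply filterlim_Cmult; first [assumption | apply filterlim_const].
  - assert (Hnz : locally x (fun y => f y <> 0)).
    { generalize (filterlim_C_lt _ _ _ Cf (proj1 (Cmod_gt_0 _) Hx)).
      apply filter_imp. intros y Hy E. rewrite E, Cmod_minus_sym in Hy.
      replace (f x - 0) with (f x) in Hy by ring. lra. }
    eapply filter_imp; [| exact (filter_and _ _ Hp3 Hnz)].
    intros y [H1 H2].
    replace (/ f y - / f x) with (- (f y - f x) / (f y * f x)) by (field; auto).
    rewrite H1. unfold Cdiv. ring.
Qed.

Lemma has_deriv_comp (f : C -> C) (g : T -> C) (x : T) (a b : C) :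
  cderiv f (g x) a -> has_deriv j g x b ->
  has_deriv j (fun y => f (g y)) x (a * b).
Proof.
  intros [p [Hp1 [Hp2 Hp3]]] Hg. assert (Cg := has_deriv_cont _ _ _ Hg).
  destruct Hg as [q [Hq1 [Hq2 Hq3]]].
  exists (fun y => p (g y) * q y). repeat split.
  - now rewrite Hp1, Hq1.
  - apply filterlim_Cmult; [| exact Hq2].
    eapply filterlim_comp; [exact Cg | exact Hp2].
  - assert (Hp4 : locally x (fun y => f (g y) - f (g x) = (g y - g x) * p (g y)))
      by exact (Cg _ Hp3).
    eapply filter_imp; [| exact (filter_and _ _ Hp4 Hq3)].
    intros y [H1 H2].
    rewrite H1, H2. ring.
Qed.

Lemma has_deriv_ext_loc (f g : T -> C) (x : T) (a : C) :
  locally x (fun y => f y = g y) -> has_deriv j f x a -> has_deriv j g x a.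
Proof.
  intros He [p [Hp1 [Hp2 Hp3]]]. exists p. repeat split; auto.
  assert (Hx := locally_singleton _ _ He).
  eapply filter_imp; [| exact (filter_and _ _ He Hp3)].
    intros y [H1 H2].
  now rewrite <- H1, <- Hx.
Qed.

Lemma has_deriv_eq (f : T -> C) (x : T) (a b : C) :
  a = b -> has_deriv j f x a -> has_deriv j f x b.
Proof. now intros ->. Qed.

(** At a zero of [g] the increment of [f * g] is [f y * (g y - g x)], so [f] need only be
    continuous. This is the product rule that applies at the base point of a tangent family. *)
Lemma has_deriv_mult_zero (f g : T -> C) (x : T) (b : C) :
  filterlim f (locally x) (locally (f x)) -> g x = 0 ->
  has_deriv j g x b -> has_deriv j (fun y => f y * g y) x (f x * b).
Proof.
  intros Hf Hg0 [q [Hq1 [Hq2 Hq3]]].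
  exists (fun y => f y * q y). repeat split.
  - now rewrite Hq1.
  - now apply filterlim_Cmult.
  - revert Hq3. apply filter_imp. intros y H.
    rewrite Hg0 in *. replace (g y) with (g y - 0) by ring. rewrite H. ring.
Qed.
End DerivRules.

Lemma id_C_cont (z : C) : filterlim (fun w : C => w) (locally z) (locally z).
Proof. apply filterlim_id. Qed.

(** The slope function is the difference quotient, filled in with the value [l] at [z]. *)
Lemma is_derive_cderiv (f : C -> C) (z l : C) :
  is_derive (K := C_AbsRing) (V := C_NormedModule) f z l <-> cderiv f z l.
Proof.
  split.
  - intros [_ H].
    exists (fun w : C => if Ceq_dec w z then l else (f w - f z) / (w - z)).
    repeat split.
    + now destruct (Ceq_dec z z).
    + apply filterlim_C. intros eps Heps.
      assert (He : (0 < eps / 2)%R) by lra.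
      specialize (H z (fun P HP => HP) (mkposreal _ He)).
      apply (proj2 (locally_C z _)).
      revert H. apply filter_imp. intros w Hw.
      destruct (Ceq_dec w z) as [-> | Hn].
      * replace (l - l) with (RtoC 0) by ring. rewrite Cmod_0. lra.
      * assert (Hz : w - z <> 0).
        { intros E. apply Hn. replace w with ((w - z) + z) by ring. rewrite E. ring. }
        change (Cmod (f w - f z - (w - z) * l) <= eps / 2 * Cmod (w - z))%R in Hw.
        replace ((f w - f z) / (w - z) - l) with ((f w - f z - (w - z) * l) / (w - z)) by (field; auto).
        rewrite Cmod_div by auto.
        assert (0 < Cmod (w - z))%R by now apply Cmod_gt_0.
        apply Rle_lt_trans with (eps / 2)%R; [| lra].
        apply Rmult_le_reg_r with (Cmod (w - z)); [auto |].
        unfold Rdiv at 1. rewrite Rmult_assoc, Rinv_l, Rmult_1_r; lra.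
    + apply filter_forall. intros w.
      destruct (Ceq_dec w z) as [-> | Hn]; [ring |].
      field. intros E. apply Hn. replace w with ((w - z) + z) by ring. rewrite E. ring.
  - intros [p [Hp1 [Hp2 Hp3]]]. split; [apply (is_linear_scal_l (K := C_AbsRing) (V := C_NormedModule)) |].
    intros x Hx eps.
    assert (x = z) as ->.
    { symmetry. exact (is_filter_lim_locally_unique (V := AbsRing_NormedModule C_AbsRing) z x Hx). }
    apply (proj1 (locally_C z _)).
    eapply filter_imp; [| exact (filter_and _ _ Hp3 (filterlim_C_lt _ _ _ Hp2 (cond_pos eps)))].
    intros w [H1 H2].
    change (Cmod (f w - f z - (w - z) * l) <= eps * Cmod (w - z))%R.
    rewrite H1. replace ((w - z) * p w - (w - z) * l) with ((p w - l) * (w - z)) by ring.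
    rewrite Cmod_mult. apply Rmult_le_compat_r; [apply Cmod_ge_0 | lra].
Qed.

Lemma rderiv_is_derive (f : R -> C) (x : R) (v : C) :
  rderiv f x v ->
  is_derive (fun t => Re (f t)) x (Re v) /\ is_derive (fun t => Im (f t)) x (Im v).
Proof.
  intros [p [Hp1 [Hp2 Hp3]]].
  (* Real and imaginary part are treated together as a real-linear map [pr] that does not increase
     the modulus. *)
  assert (key : forall (pr : C -> R), (forall (a : R) (z : C), pr (RtoC a * z) = (a * pr z)%R) ->
     (forall a b, pr (a - b) = (pr a - pr b)%R) -> (forall z, (Rabs (pr z) <= Cmod z)%R) ->
     is_derive (fun t => pr (f t)) x (pr v)).
  { intros pr H1 H2 H3. split; [apply (is_linear_scal_l (K := R_AbsRing)) |].
    intros x0 Hx eps.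
    assert (x0 = x) as ->.
    { symmetry. exact (is_filter_lim_locally_unique (V := AbsRing_NormedModule R_AbsRing) x x0 Hx). }
    eapply filter_imp; [| exact (filter_and _ _ Hp3 (filterlim_C_lt _ _ _ Hp2 (cond_pos eps)))].
    intros w [K1 K2].
    change (Rabs (pr (f w) - pr (f x) - (w - x) * pr v) <= eps * Rabs (w - x))%R.
    rewrite <- H2, K1, <- RtoC_minus, H1.
    replace ((w - x) * pr (p w) - (w - x) * pr v)%R with ((w - x) * (pr (p w - v)%C))%R
      by (rewrite H2; ring).
    rewrite Rabs_mult, Rmult_comm. apply Rmult_le_compat_r; [apply Rabs_pos |].
    eapply Rle_trans; [apply H3 | lra]. }
  split; apply key.
  - intros; unfold Re; cbn; ring.
  - intros; reflexivity.
  - apply re_le_Cmod.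
  - intros; unfold Im; cbn; ring.
  - intros; reflexivity.
  - apply im_le_Cmod.
Qed.

(** * Integrals over a period *)

Lemma is_derive_caratheodory (g : R -> R) (x l : R) :
  is_derive g x l ->
  exists psi : R -> R, psi x = l /\ filterlim psi (locally x) (locally l) /\
    forall y, (g y - g x = (y - x) * psi y)%R.
Proof.
  intros [_ H].
  exists (fun y => if Req_EM_T y x then l else ((g y - g x) / (y - x))%R).
  repeat split.
  - now destruct (Req_EM_T x x).
  - apply filterlim_locally. intros eps.
    assert (He : (0 < eps / 2)%R) by (pose proof (cond_pos eps); lra).
    specialize (H x (fun P HP => HP) (mkposreal _ He)).
    revert H. apply filter_imp. intros y Hy.
    change (Rabs (g y - g x - (y - x) * l) <= eps / 2 * Rabs (y - x))%R in Hy.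
    change (Rabs ((if Req_EM_T y x then l else ((g y - g x) / (y - x))%R) - l) < eps)%R.
    destruct (Req_EM_T y x) as [-> | Hn].
    + rewrite Rminus_diag, Rabs_R0. apply cond_pos.
    + replace ((g y - g x) / (y - x) - l)%R with ((g y - g x - (y - x) * l) / (y - x))%R
        by (field; lra).
      assert (0 < Rabs (y - x))%R by (apply Rabs_pos_lt; lra).
      rewrite Rabs_div by lra.
      apply Rle_lt_trans with (eps / 2)%R; [| lra].
      apply Rmult_le_reg_r with (Rabs (y - x)); [auto |].
      unfold Rdiv at 1. rewrite Rmult_assoc, Rinv_l, Rmult_1_r; lra.
  - intros y. destruct (Req_EM_T y x) as [-> | Hn]; [ring | field; lra].
Qed.

Lemma is_derive_rderiv (f : R -> C) (x : R) (v : C) :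
  is_derive (fun t => Re (f t)) x (Re v) -> is_derive (fun t => Im (f t)) x (Im v) ->
  rderiv f x v.
Proof.
  intros H1 H2.
  destruct (is_derive_caratheodory _ _ _ H1) as [p [P1 [P2 P3]]].
  destruct (is_derive_caratheodory _ _ _ H2) as [q [Q1 [Q2 Q3]]].
  exists (fun y => (p y, q y)). repeat split.
  - rewrite P1, Q1. now destruct v.
  - apply filterlim_Re_Im; assumption.
  - apply filter_forall. intros y. apply injective_projections; cbn.
    + change (Re (f y) + - Re (f x) = (y + - x) * p y - (0 + - 0) * q y)%R.
      pose proof (P3 y). nra.
    + change (Im (f y) + - Im (f x) = (y + - x) * q y + (0 + - 0) * p y)%R.
      pose proof (Q3 y). nra.
Qed.

(** * The exponential parametrisation of the unit circle *)

Definition expi (t : R) : C := (cos t, sin t).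

Lemma expi_0 : expi 0 = 1.
Proof. unfold expi. now rewrite cos_0, sin_0. Qed.

Lemma expi_2PI : expi (2 * PI) = 1.
Proof. unfold expi. now rewrite cos_2PI, sin_2PI. Qed.

Lemma Cmod_expi (t : R) : Cmod (expi t) = 1%R.
Proof.
  unfold Cmod, expi; cbn [fst snd].
  replace (cos t ^ 2 + sin t ^ 2)%R with 1%R; [apply sqrt_1 |].
  rewrite <- !Rsqr_pow2, Rplus_comm. symmetry; apply sin2_cos2.
Qed.

Lemma expi_neq_0 (t : R) : expi t <> 0.
Proof. apply Cmod_gt_0. rewrite Cmod_expi. lra. Qed.

Lemma expi_plus (a b : R) : expi (a + b) = expi a * expi b.
Proof.
  unfold expi, Cmult; cbn [fst snd]. rewrite cos_plus, sin_plus.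
  f_equal; ring.
Qed.

Lemma expi_opp (t : R) : expi (- t) = / expi t.
Proof.
  assert (H : expi t * expi (- t) = 1) by (rewrite <- expi_plus, Rplus_opp_r; apply expi_0).
  replace (/ expi t) with (/ expi t * (expi t * expi (- t))) by (rewrite H; ring).
  field. apply expi_neq_0.
Qed.

Lemma expi_period (k : Z) : expi (IZR k * (2 * PI)) = 1.
Proof.
  assert (H : forall n : nat, expi (INR n * (2 * PI)) = 1).
  { induction n as [| n IH]; [cbn; rewrite Rmult_0_l; apply expi_0 |].
    rewrite S_INR, Rmult_plus_distr_r, expi_plus, IH, Rmult_1_l, expi_2PI. ring. }
  destruct k as [| p | p].
  - rewrite Rmult_0_l. apply expi_0.
  - rewrite <- positive_nat_Z, <- INR_IZR_INZ. apply H.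
  - change (Z.neg p) with (- Z.pos p)%Z.
    rewrite opp_IZR, <- positive_nat_Z, <- INR_IZR_INZ, Ropp_mult_distr_l_reverse, expi_opp, H. field.
Qed.

Lemma rderiv_expi (t : R) : rderiv expi t (Ci * expi t).
Proof.
  apply is_derive_rderiv; unfold Re, Im, expi; cbn [fst snd Cmult Ci].
  - auto_derive; [easy | ring].
  - auto_derive; [easy | ring].
Qed.

Lemma rderiv_expi_scal (nu t : R) :
  rderiv (fun t => expi (nu * t)) t (Ci * RtoC nu * expi (nu * t)).
Proof.
  apply is_derive_rderiv; unfold Re, Im, expi; cbn [fst snd Cmult Ci RtoC].
  - auto_derive; [easy | ring].
  - auto_derive; [easy | ring].
Qed.

(** * Continuous curves and their integrals over [[0, 2 PI]] *)

Definition cts {T : UniformSpace} (f : T -> C) : Prop :=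
  forall x, filterlim f (locally x) (locally (f x)).

Lemma cts_expi : cts (T := R_UniformSpace) expi.
Proof. intros t. exact (has_deriv_cont RtoC filterlim_RtoC _ _ _ (rderiv_expi t)). Qed.

Lemma cts_expi_scal (nu : R) : cts (T := R_UniformSpace) (fun t => expi (nu * t)).
Proof. intros t. exact (has_deriv_cont RtoC filterlim_RtoC _ _ _ (rderiv_expi_scal nu t)). Qed.

Lemma cts_const {T : UniformSpace} (a : C) : cts (T := T) (fun _ => a).
Proof. intros x. apply filterlim_const. Qed.

Lemma cts_minus {T : UniformSpace} (f g : T -> C) :
  cts f -> cts g -> cts (fun x => f x - g x).
Proof. intros Hf Hg x. now apply filterlim_Cminus. Qed.

Lemma cts_mult {T : UniformSpace} (f g : T -> C) :
  cts f -> cts g -> cts (fun x => f x * g x).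
Proof. intros Hf Hg x. now apply filterlim_Cmult. Qed.

Lemma cts_div {T : UniformSpace} (f g : T -> C) :
  (forall x, g x <> 0) -> cts f -> cts g -> cts (fun x => f x / g x).
Proof. intros Hn Hf Hg x. now apply filterlim_Cdiv. Qed.

Lemma cts_pow {T : UniformSpace} (f : T -> C) (n : nat) : cts f -> cts (fun x => f x ^ n).
Proof. intros Hf x. now apply filterlim_Cpow. Qed.

(** Contour integrals over a circle of radius [s] are written with the weight [RtoC s * expi t],
    that is without the factor [Ci] of the velocity; nothing is divided by [2 PI], so this factor
    appears in every Cauchy formula below. *)
Definition Cint (phi : R -> C) : C :=
  (RInt (fun t => Re (phi t)) 0 (2 * PI), RInt (fun t => Im (phi t)) 0 (2 * PI)).

Notation rcts := (cts (T := R_UniformSpace)).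

Lemma ex_RInt_Re (phi : R -> C) (a b : R) : rcts phi -> ex_RInt (fun t => Re (phi t)) a b.
Proof. intros H. apply (ex_RInt_continuous (V := R_CompleteNormedModule)). intros t _. exact (filterlim_Re _ _ (H t)). Qed.

Lemma ex_RInt_Im (phi : R -> C) (a b : R) : rcts phi -> ex_RInt (fun t => Im (phi t)) a b.
Proof. intros H. apply (ex_RInt_continuous (V := R_CompleteNormedModule)). intros t _. exact (filterlim_Im _ _ (H t)). Qed.

Lemma Cint_ext (phi psi : R -> C) : (forall t, phi t = psi t) -> Cint phi = Cint psi.
Proof.
  intros H. unfold Cint. f_equal; apply RInt_ext; intros t _; now rewrite H.
Qed.

Lemma Cint_plus (phi psi : R -> C) :
  rcts phi -> rcts psi -> Cint (fun t => phi t + psi t) = Cint phi + Cint psi.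
Proof.
  intros H1 H2. unfold Cint, Cplus; cbn [fst snd]. f_equal.
  - exact (RInt_plus (V := R_CompleteNormedModule) _ _ _ _ (ex_RInt_Re _ _ _ H1) (ex_RInt_Re _ _ _ H2)).
  - exact (RInt_plus (V := R_CompleteNormedModule) _ _ _ _ (ex_RInt_Im _ _ _ H1) (ex_RInt_Im _ _ _ H2)).
Qed.

Lemma Cint_scal (a : C) (phi : R -> C) :
  rcts phi -> Cint (fun t => a * phi t) = a * Cint phi.
Proof.
  intros H. unfold Cint, Cmult; cbn [fst snd Re Im].
  assert (E1 := ex_RInt_Re phi 0 (2 * PI) H). assert (E2 := ex_RInt_Im phi 0 (2 * PI) H).
  f_equal; apply is_RInt_unique.
  - apply (is_RInt_minus (V := R_NormedModule)); apply (is_RInt_scal (V := R_NormedModule));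
      apply (RInt_correct (V := R_CompleteNormedModule)); assumption.
  - apply (is_RInt_plus (V := R_NormedModule)); apply (is_RInt_scal (V := R_NormedModule));
      apply (RInt_correct (V := R_CompleteNormedModule)); assumption.
Qed.

Lemma Cint_minus (phi psi : R -> C) :
  rcts phi -> rcts psi -> Cint (fun t => phi t - psi t) = Cint phi - Cint psi.
Proof.
  intros H1 H2.
  rewrite (Cint_ext _ (fun t => phi t + (- (1)) * psi t)) by (intros; ring).
  rewrite Cint_plus, Cint_scal; auto; [ring |].
  apply cts_mult; [apply cts_const | exact H2].
Qed.

Lemma Cint_const (a : C) : Cint (fun _ => a) = RtoC (2 * PI) * a.
Proof.
  unfold Cint. rewrite !RInt_const. unfold scal, Cmult, RtoC; cbn.
  unfold mult; cbn. apply injective_projections; cbn; unfold Re, Im; ring.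
Qed.

(** Real and imaginary part are bounded separately, which doubles the sharp constant [2 PI]. *)
Lemma Cint_bound (phi : R -> C) (M : R) :
  rcts phi -> (forall t, (0 <= t <= 2 * PI)%R -> (Cmod (phi t) <= M)%R) ->
  (Cmod (Cint phi) <= 4 * PI * M)%R.
Proof.
  intros Hc HM. pose proof PI_RGT_0.
  eapply Rle_trans; [apply Cmod_le_Rabs |].
  replace (4 * PI * M)%R with ((2 * PI - 0) * M + (2 * PI - 0) * M)%R by ring.
  apply Rplus_le_compat; apply abs_RInt_le_const.
  - lra.
  - exact (ex_RInt_Re phi _ _ Hc).
  - intros t Ht. eapply Rle_trans; [apply re_le_Cmod | now apply HM].
  - lra.
  - exact (ex_RInt_Im phi _ _ Hc).
  - intros t Ht. eapply Rle_trans; [apply im_le_Cmod | now apply HM].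
Qed.

Lemma rcts_bounded (phi : R -> C) (a b : R) :
  rcts phi -> exists M, forall t, (a <= t <= b)%R -> (Cmod (phi t) <= M)%R.
Proof.
  intros H.
  destruct (bounded_continuity (V := R_NormedModule) (fun t => Re (phi t)) a b) as [M1 H1].
  { intros t _. exact (filterlim_Re _ _ (H t)). }
  destruct (bounded_continuity (V := R_NormedModule) (fun t => Im (phi t)) a b) as [M2 H2].
  { intros t _. exact (filterlim_Im _ _ (H t)). }
  exists (M1 + M2)%R. intros t Ht. eapply Rle_trans; [apply Cmod_le_Rabs |].
  apply Rlt_le, Rplus_lt_compat; [now apply H1 | now apply H2].
Qed.

(** The parameters [0] and [2 PI] of a tangent circle sit at the cusp, so the primitive is
    differentiated only in between. The mean value theorem, applied to the difference of [g] and the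
    integral of [dg], asks for no more than that. *)
Lemma RInt_derive_open (g dg : R -> R) (a b : R) :
  (a <= b)%R -> (forall t, continuous g t) -> (forall t, continuous dg t) ->
  (forall t, (a < t < b)%R -> is_derive g t (dg t)) ->
  RInt dg a b = (g b - g a)%R.
Proof.
  intros Hab Hg Hdg Hd.
  assert (Hex : forall u v, ex_RInt dg u v).
  { intros u v. apply (ex_RInt_continuous (V := R_CompleteNormedModule)). auto. }
  assert (HI : forall t, is_derive (fun t => RInt dg a t) t (dg t)).
  { intros t. apply (is_derive_RInt (V := R_NormedModule) dg _ a).
    - apply filter_forall. intros u. apply (RInt_correct (V := R_CompleteNormedModule)), Hex.
    - apply Hdg. }
  destruct (MVT_gen (fun t => (g t - RInt dg a t)%R) a b (fun _ => 0%R)) as [x [_ Hx]].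
  - intros t. rewrite Rmin_left, Rmax_right by exact Hab. intros Ht.
    replace 0%R with (dg t - dg t)%R by ring.
    apply (is_derive_minus (V := R_NormedModule)); [now apply Hd | apply HI].
  - intros t _. apply continuity_pt_filterlim.
    apply (continuous_minus (V := R_NormedModule)); [apply Hg |].
    apply ex_derive_continuous. now exists (dg t).
  - assert (E : RInt dg a a = 0%R) by exact (RInt_point (V := R_CompleteNormedModule) a dg).
    rewrite E in Hx. lra.
Qed.

Lemma Cint_deriv (Phi phi : R -> C) :
  rcts Phi -> (forall t, (0 < t < 2 * PI)%R -> rderiv Phi t (phi t)) -> rcts phi ->
  Cint phi = Phi (2 * PI)%R - Phi 0%R.
Proof.
  intros HPhi Hd Hc. pose proof PI_RGT_0. unfold Cint.
  apply injective_projections; cbn [fst snd].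
  - apply (RInt_derive_open (fun t => Re (Phi t))); [lra | | |].
    + intros t. exact (filterlim_Re _ _ (HPhi t)).
    + intros t. exact (filterlim_Re _ _ (Hc t)).
    + intros t Ht. exact (proj1 (rderiv_is_derive _ _ _ (Hd t Ht))).
  - apply (RInt_derive_open (fun t => Im (Phi t))); [lra | | |].
    + intros t. exact (filterlim_Im _ _ (HPhi t)).
    + intros t. exact (filterlim_Im _ _ (Hc t)).
    + intros t Ht. exact (proj2 (rderiv_is_derive _ _ _ (Hd t Ht))).
Qed.

Lemma RInt_param_cont (f : R -> R -> R) (a b s : R) :
  (a <= b)%R ->
  (forall u, ex_RInt (f u) a b) ->
  (forall t, continuity_2d_pt f s t) ->
  continuous (fun u => RInt (f u) a b) s.
Proof.
  intros Hab Hex Hc. apply filterlim_locally. intros eps.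
  (* The added [1] keeps the denominator positive when [a = b]. *)
  assert (He : (0 < eps / (b - a + 1))%R)
    by (apply Rdiv_lt_0_compat; [apply cond_pos | lra]).
  destruct (uniform_continuity_2d_1d (fun t u => f u t) a b s) with (eps := mkposreal _ He)
    as [d Hd].
  { intros t _ e. destruct (Hc t e) as [d Hd]. exists d. intros u v Hu Hv. now apply Hd. }
  exists d. intros u Hu. change (Rabs (u - s) < d)%R in Hu.
  change (Rabs (RInt (f u) a b - RInt (f s) a b) < eps)%R.
  rewrite <- (RInt_minus (V := R_CompleteNormedModule)) by apply Hex.
  apply Rle_lt_trans with ((b - a) * (eps / (b - a + 1)))%R.
  - apply abs_RInt_le_const; [exact Hab | apply (ex_RInt_minus (V := R_NormedModule)); apply Hex |].
    intros t Ht. left.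
    pose proof (cond_pos d). apply Rabs_def2 in Hu.
    apply (Hd t s t u); try lra. rewrite Rminus_diag, Rabs_R0. apply cond_pos.
  - pose proof (cond_pos eps).
    apply Rmult_lt_reg_r with (b - a + 1)%R; [lra |].
    replace ((b - a) * (eps / (b - a + 1)) * (b - a + 1))%R with ((b - a) * eps)%R by (field; lra).
    nra.
Qed.

(** * Contour integrals over families of circles *)

Definition jcts (Phi : R -> R -> C) (s t : R) : Prop :=
  filterlim (fun x : R * R => Phi (fst x) (snd x)) (locally (s, t)) (locally (Phi s t)).

Lemma jcts_slice (Phi : R -> R -> C) (s : R) :
  (forall t, jcts Phi s t) -> rcts (Phi s).
Proof.
  intros H t. apply filterlim_comp with (f := fun u : R => (s, u)) (2 := H t).
  intros P [e He]. exists e. intros u Hu. apply He. split; [apply ball_center | exact Hu].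
Qed.

Lemma jcts_Re (Phi : R -> R -> C) (s t : R) :
  jcts Phi s t -> continuity_2d_pt (fun u v => Re (Phi u v)) s t.
Proof.
  intros H. apply continuity_2d_pt_filterlim.
  exact (filterlim_Re (fun x : R * R => Phi (fst x) (snd x)) _ H).
Qed.

Lemma jcts_Im (Phi : R -> R -> C) (s t : R) :
  jcts Phi s t -> continuity_2d_pt (fun u v => Im (Phi u v)) s t.
Proof.
  intros H. apply continuity_2d_pt_filterlim.
  exact (filterlim_Im (fun x : R * R => Phi (fst x) (snd x)) _ H).
Qed.

Lemma Cint_param_cont (Phi : R -> R -> C) (s : R) :
  (forall u, rcts (Phi u)) -> (forall t, jcts Phi s t) ->
  filterlim (fun u => Cint (Phi u)) (locally s) (locally (Cint (Phi s))).
Proof.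
  intros Hc Hj. pose proof PI_RGT_0.
  apply filterlim_Re_Im; unfold Cint; cbn [Re Im fst snd].
  - apply (RInt_param_cont (fun u t => Re (Phi u t))); [lra | |].
    + intros u. now apply ex_RInt_Re.
    + intros t. now apply jcts_Re.
  - apply (RInt_param_cont (fun u t => Im (Phi u t))); [lra | |].
    + intros u. now apply ex_RInt_Im.
    + intros t. now apply jcts_Im.
Qed.

Lemma RInt_param_deriv (f df : R -> R -> R) (a b s : R) :
  (forall u, ex_RInt (f u) a b) ->
  locally s (fun u => forall t, is_derive (fun v => f v t) u (df u t)) ->
  (forall t, continuity_2d_pt df s t) ->
  is_derive (fun u => RInt (f u) a b) s (RInt (df s) a b).
Proof.
  intros Hex Hd Hc.
  replace (RInt (df s) a b) with (RInt (fun t => Derive (fun u => f u t) s) a b).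
  2: { apply RInt_ext. intros t _. apply is_derive_unique.
       apply (locally_singleton _ _ Hd). }
  apply is_derive_RInt_param.
  - revert Hd. apply filter_imp. intros u Hu t _. now exists (df u t).
  - intros t _. apply continuity_2d_pt_ext_loc with df; [| apply Hc].
    destruct Hd as [d Hd]. exists d. intros u v Hu _. symmetry.
    apply is_derive_unique, Hd, Hu.
  - apply filter_forall. intros u. apply Hex.
Qed.

Lemma Cint_param_deriv (Phi D : R -> R -> C) (s : R) :
  (forall u, rcts (Phi u)) ->
  locally s (fun u => forall t, rderiv (fun v => Phi v t) u (D u t)) ->
  (forall t, jcts D s t) ->
  rderiv (fun u => Cint (Phi u)) s (Cint (D s)).
Proof.
  intros Hc Hd Hj. apply is_derive_rderiv; unfold Cint; cbn [Re Im fst snd].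
  - apply (RInt_param_deriv (fun u t => Re (Phi u t)) (fun u t => Re (D u t))).
    + intros u. now apply ex_RInt_Re.
    + revert Hd. apply filter_imp. intros u Hu t.
      exact (proj1 (rderiv_is_derive _ _ _ (Hu t))).
    + intros t. now apply jcts_Re.
  - apply (RInt_param_deriv (fun u t => Im (Phi u t)) (fun u t => Im (D u t))).
    + intros u. now apply ex_RInt_Im.
    + revert Hd. apply filter_imp. intros u Hu t.
      exact (proj2 (rderiv_is_derive _ _ _ (Hu t))).
    + intros t. now apply jcts_Im.
Qed.

Lemma rderiv_0_const (f : R -> C) (a b : R) :
  (a <= b)%R -> (forall x, (a <= x <= b)%R -> filterlim f (locally x) (locally (f x))) ->
  (forall x, (a < x < b)%R -> rderiv f x 0) -> f a = f b.
Proof.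
  intros Hab Hc Hd.
  assert (key : forall g : R -> R,
    (forall x, (a <= x <= b)%R -> continuous g x) ->
    (forall x, (a < x < b)%R -> is_derive g x 0%R) -> g a = g b).
  { intros g Gc Gd.
    destruct (MVT_gen g a b (fun _ => 0%R)) as [x [_ Hx]].
    - intros x. rewrite Rmin_left, Rmax_right by exact Hab. apply Gd.
    - intros x. rewrite Rmin_left, Rmax_right by exact Hab. intros Hx.
      apply continuity_pt_filterlim. now apply Gc.
    - lra. }
  apply injective_projections.
  - apply (key (fun x => Re (f x))).
    + intros x Hx. exact (filterlim_Re _ _ (Hc x Hx)).
    + intros x Hx. exact (proj1 (rderiv_is_derive _ _ _ (Hd x Hx))).
  - apply (key (fun x => Im (f x))).
    + intros x Hx. exact (filterlim_Im _ _ (Hc x Hx)).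
    + intros x Hx. exact (proj2 (rderiv_is_derive _ _ _ (Hd x Hx))).
Qed.

(** The exceptional [s0] will be the radius of the circle through the pole of a Cauchy kernel, where
    the integrand is merely continuous. Continuity of [f] glues the two sides. *)
Lemma rderiv_0_const_except (f : R -> C) (a b s0 : R) :
  (a <= b)%R -> (forall x, (a <= x <= b)%R -> filterlim f (locally x) (locally (f x))) ->
  (forall x, (a < x < b)%R -> x <> s0 -> rderiv f x 0) -> f a = f b.
Proof.
  intros Hab Hc Hd.
  destruct (Rle_dec a s0) as [H1 | H1]; [destruct (Rle_dec s0 b) as [H2 | H2] |].
  - transitivity (f s0); apply rderiv_0_const; try assumption; intros x Hx.
    + apply Hc; lra.
    + apply Hd; lra.
    + apply Hc; lra.
    + apply Hd; lra.
  - apply rderiv_0_const; try assumption; intros x Hx. apply Hd; lra.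
  - apply rderiv_0_const; try assumption; intros x Hx. apply Hd; lra.
Qed.

(** Freezing the radius outside [[a, b]] turns integrands known only on the swept region into
    functions of all real [s], so that two-sided limits in [s] make sense at the boundary circles
    too. *)
Definition clamp (a b s : R) : R := Rmax a (Rmin b s).

Lemma clamp_range (a b s : R) : (a <= b)%R -> (a <= clamp a b s <= b)%R.
Proof.
  intros H. unfold clamp, Rmin.
  repeat match goal with |- context [Rle_dec ?x ?y] => destruct (Rle_dec x y) end; unfold Rmax;
  repeat match goal with |- context [Rle_dec ?x ?y] => destruct (Rle_dec x y) end; lra.
Qed.

Lemma clamp_id (a b s : R) : (a <= s <= b)%R -> clamp a b s = s.
Proof.
  intros H. unfold clamp, Rmin.
  repeat match goal with |- context [Rle_dec ?x ?y] => destruct (Rle_dec x y) end; unfold Rmax;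
  repeat match goal with |- context [Rle_dec ?x ?y] => destruct (Rle_dec x y) end; lra.
Qed.

Lemma clamp_cont (a b s : R) : filterlim (clamp a b) (locally s) (locally (clamp a b s)).
Proof.
  apply filterlim_locally. intros eps. exists eps. intros u Hu.
  change (Rabs (u - s) < eps)%R in Hu. change (Rabs (clamp a b u - clamp a b s) < eps)%R.
  revert Hu. unfold clamp, Rmin.
  repeat match goal with |- context [Rle_dec ?x ?y] => destruct (Rle_dec x y) end; unfold Rmax;
  repeat match goal with |- context [Rle_dec ?x ?y] => destruct (Rle_dec x y) end;
    unfold Rabs; repeat destruct (Rcase_abs _); lra.
Qed.

(** [p = q = 1] gives the circles internally tangent to the unit circle at [1],
    [p = q = 0] the circles centred at the origin. *)
Definition circ (p q : C) (s t : R) : C := p + RtoC s * (expi t - q).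

(** For [p = q = 1], [a = r], [b = 1] this set lies in the closed crescent ([swept_bounds]), and
    each of its points is a limit of interior points ([swept_dense]). *)
Definition swept (p q : C) (a b : R) (z : C) : Prop :=
  exists s t, (a <= s <= b)%R /\ z = circ p q s t.

Lemma swept_circ (p q : C) (a b s t : R) : (a <= s <= b)%R -> swept p q a b (circ p q s t).
Proof. intros H. now exists s, t. Qed.

Lemma filterlim_fst_R (s t : R) :
  filterlim (fun x : R * R => fst x) (locally (s, t)) (locally s).
Proof. intros P [e He]. exists e. intros [u v] [Hu _]. now apply He. Qed.

Lemma filterlim_snd_R (s t : R) :
  filterlim (fun x : R * R => snd x) (locally (s, t)) (locally t).
Proof. intros P [e He]. exists e. intros [u v] [_ Hv]. now apply He. Qed.

Lemma jcts_expi (s t : R) : jcts (fun _ v => expi v) s t.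
Proof. exact (filterlim_comp _ _ _ _ _ _ _ _ (filterlim_snd_R s t) (cts_expi t)). Qed.

Lemma jcts_clamp (a b s t : R) : jcts (fun u _ => RtoC (clamp a b u)) s t.
Proof.
  apply (filterlim_comp _ _ _ (fun x : R * R => clamp a b (fst x)) RtoC) with (2 := filterlim_RtoC _).
  exact (filterlim_comp _ _ _ _ _ _ _ _ (filterlim_fst_R s t) (clamp_cont a b s)).
Qed.

Lemma jcts_const (c : C) (s t : R) : jcts (fun _ _ => c) s t.
Proof. exact (cts_const (T := prod_UniformSpace R_UniformSpace R_UniformSpace) c (s, t)). Qed.

Lemma jcts_plus (f g : R -> R -> C) (s t : R) :
  jcts f s t -> jcts g s t -> jcts (fun u v => f u v + g u v) s t.
Proof. intros Hf Hg. now apply filterlim_Cplus. Qed.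

Lemma jcts_minus (f g : R -> R -> C) (s t : R) :
  jcts f s t -> jcts g s t -> jcts (fun u v => f u v - g u v) s t.
Proof. intros Hf Hg. now apply filterlim_Cminus. Qed.

Lemma jcts_mult (f g : R -> R -> C) (s t : R) :
  jcts f s t -> jcts g s t -> jcts (fun u v => f u v * g u v) s t.
Proof. intros Hf Hg. now apply filterlim_Cmult. Qed.

Lemma jcts_circ (p q : C) (a b s t : R) :
  jcts (fun u v => circ p q (clamp a b u) v) s t.
Proof.
  apply jcts_plus; [apply jcts_const |].
  apply jcts_mult; [apply jcts_clamp |].
  apply jcts_minus; [apply jcts_expi | apply jcts_const].
Qed.

(** A clamped circle never leaves the swept region, so continuity relative to that region gives
    unrestricted joint continuity in radius and angle. *)
Lemma jcts_swept (p q : C) (a b s t : R) (F : C -> C) :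
  (a <= b)%R ->
  filterlim F (within (swept p q a b) (locally (circ p q (clamp a b s) t)))
    (locally (F (circ p q (clamp a b s) t))) ->
  jcts (fun u v => F (circ p q (clamp a b u) v)) s t.
Proof.
  intros Hab HF.
  apply (filterlim_comp _ _ _ (fun x : R * R => circ p q (clamp a b (fst x)) (snd x)) F) with (2 := HF).
  intros P HP. generalize (jcts_circ p q a b s t _ HP). unfold filtermap.
  apply filter_imp. intros x Hx. apply Hx, swept_circ. now apply clamp_range.
Qed.

Lemma rderiv_circ_t (p q : C) (s t : R) :
  rderiv (circ p q s) t (Ci * (RtoC s * expi t)).
Proof.
  unfold circ. apply (has_deriv_eq RtoC _ _ (0 + (0 * (expi t - q) + RtoC s * (Ci * expi t + - 0)))); [ring |].
  apply has_deriv_plus; [apply has_deriv_const |].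
  apply (has_deriv_mult RtoC filterlim_RtoC (fun _ => RtoC s)); [apply has_deriv_const |].
  apply has_deriv_plus; [apply rderiv_expi |].
  apply (has_deriv_eq RtoC _ _ 0); [ring | apply has_deriv_const].
Qed.

Lemma rderiv_circ_s (p q : C) (s t : R) :
  rderiv (fun u => circ p q u t) s (expi t - q).
Proof.
  unfold circ. apply (has_deriv_eq RtoC _ _ (0 + (1 * (expi t - q) + RtoC s * 0))); [ring |].
  apply has_deriv_plus; [apply has_deriv_const |].
  apply (has_deriv_mult RtoC filterlim_RtoC); [apply has_deriv_id | apply has_deriv_const].
Qed.

(** With [zeta = circ p q s t], the mixed identity
    [d/ds (F(zeta) d zeta/dt) = d/dt (F(zeta) d zeta/ds)] makes the contour
    integral independent of [s]. The radius [s0] is allowed to be singular, and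
    so is the base point [p] of a tangent family, where [d zeta/ds] vanishes. *)
Lemma circle_integral_invariance (p q : C) (a b s0 : R) (F F1 : C -> C) :
  (a <= b)%R ->
  (forall s t, (a <= s <= b)%R ->
     filterlim F (within (swept p q a b) (locally (circ p q s t))) (locally (F (circ p q s t)))) ->
  (forall s t, (a < s < b)%R -> s <> s0 -> expi t <> q ->
     cderiv F (circ p q s t) (F1 (circ p q s t))) ->
  (forall s t, (a < s < b)%R -> s <> s0 ->
     filterlim F1 (within (swept p q a b) (locally (circ p q s t))) (locally (F1 (circ p q s t)))) ->
  Cint (fun t => F (circ p q a t) * (RtoC a * expi t)) =
  Cint (fun t => F (circ p q b t) * (RtoC b * expi t)).
Proof.
  intros Hab HF Hd HF1.
  set (Phi := fun s t => F (circ p q (clamp a b s) t) * (RtoC (clamp a b s) * expi t)).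
  (* [D] is the partial derivative of [Phi] in [s] as long as the clamp is inactive. *)
  set (D := fun s t => (F1 (circ p q (clamp a b s) t) * (expi t - q) * RtoC (clamp a b s)
                        + F (circ p q (clamp a b s) t)) * expi t).
  assert (JP : forall s t, jcts Phi s t).
  { intros s t. apply jcts_mult.
    - apply jcts_swept; [exact Hab |]. apply HF. now apply clamp_range.
    - apply jcts_mult; [apply jcts_clamp | apply jcts_expi]. }
  assert (JD : forall s t, (a < s < b)%R -> s <> s0 -> jcts D s t).
  { intros s t Hs Hs0. apply jcts_mult; [| apply jcts_expi].
    apply jcts_plus.
    - apply jcts_mult; [| apply jcts_clamp]. apply jcts_mult.
      + apply jcts_swept; [exact Hab |]. rewrite clamp_id by lra. now apply HF1.
      + apply jcts_minus; [apply jcts_expi | apply jcts_const].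
    - apply jcts_swept; [exact Hab |]. apply HF. now apply clamp_range. }
  assert (RP : forall s, rcts (Phi s)) by (intros s; apply jcts_slice; auto).
  assert (E : Cint (Phi a) = Cint (Phi b)).
  { apply (rderiv_0_const_except (fun s => Cint (Phi s)) a b s0 Hab).
    - intros s _. apply Cint_param_cont; auto.
    - intros s Hs Hs0.
      assert (Hloc : locally s (fun u => (a < u < b)%R /\ u <> s0)).
      { apply filter_and; [apply filter_and |].
        - now apply (open_gt a).
        - now apply (open_lt b).
        - now apply (open_neq s0). }
      replace (RtoC 0) with (Cint (D s)).
      + apply Cint_param_deriv; [exact RP | | intros t; now apply JD].
        revert Hloc. apply filter_imp. intros u [Hu Hu0] t.
        assert (Hul : locally u (fun v => (a < v < b)%R)).
        { apply filter_and; [now apply (open_gt a) | now apply (open_lt b)]. }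
        apply (has_deriv_ext_loc RtoC (fun v => F (circ p q v t) * (RtoC v * expi t))).
        { revert Hul. apply filter_imp. intros v Hv. unfold Phi. rewrite clamp_id; [easy | lra]. }
        unfold D. rewrite clamp_id by lra.
        (* When [expi t = q] the point stays at [p] for every radius, so [Phi] is linear in [s] and
           no derivative of [F] is involved. *)
        destruct (Ceq_dec (expi t) q) as [Hq | Hq].
        * assert (Hp : forall v, circ p q v t = p) by (intros v; unfold circ; rewrite Hq; ring).
          apply (has_deriv_eq RtoC _ _ (0 * (RtoC u * expi t) + F p * (1 * expi t + RtoC u * 0))).
          { rewrite !Hp, Hq. ring. }
          apply (has_deriv_ext_loc RtoC (fun v => F p * (RtoC v * expi t))).
          { apply filter_forall. intros v. now rewrite Hp. }
          apply (has_deriv_mult RtoC filterlim_RtoC (fun _ => F p)); [apply has_deriv_const |].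
          apply (has_deriv_mult RtoC filterlim_RtoC RtoC (fun _ => expi t));
            [apply has_deriv_id | apply has_deriv_const].
        * apply (has_deriv_eq RtoC _ _ (F1 (circ p q u t) * (expi t - q) * (RtoC u * expi t) +
             F (circ p q u t) * (1 * expi t + RtoC u * 0))); [ring |].
          apply (has_deriv_mult RtoC filterlim_RtoC (fun v => F (circ p q v t))).
          -- apply (has_deriv_comp RtoC filterlim_RtoC F (fun v => circ p q v t));
               [now apply Hd | apply rderiv_circ_s].
          -- apply (has_deriv_mult RtoC filterlim_RtoC RtoC (fun _ => expi t));
               [apply has_deriv_id | apply has_deriv_const].
      + assert (Cs : rcts (fun t => F (circ p q s t))).
        { intros t. assert (J : jcts (fun u v => F (circ p q (clamp a b u) v)) s t).
          { apply jcts_swept; [exact Hab |]. apply HF. now apply clamp_range. }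
          assert (forall t, jcts (fun u v => F (circ p q (clamp a b u) v)) s t) as J'.
          { intros t'. apply jcts_swept; [exact Hab |]. apply HF. now apply clamp_range. }
          generalize (jcts_slice _ _ J' t). now rewrite clamp_id by lra. }
        (* [D s] has the periodic primitive [- Ci * F(zeta) * (expi t - q)] in [t], so its integral
           over a period is zero. *)
        rewrite (Cint_deriv (fun t => - Ci * (F (circ p q s t) * (expi t - q)))).
        * unfold circ. rewrite expi_0, expi_2PI. ring.
        * apply cts_mult; [apply cts_const |]. apply cts_mult; [exact Cs |].
          apply cts_minus; [apply cts_expi | apply cts_const].
        * intros t _. unfold D. rewrite clamp_id by lra.
          apply (has_deriv_eq RtoC _ _ (0 * (F (circ p q s t) * (expi t - q)) +
            - Ci * (F1 (circ p q s t) * (Ci * (RtoC s * expi t)) * (expi t - q)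
                   + F (circ p q s t) * (Ci * expi t + - 0)))).
          { transitivity (- (Ci * Ci) * ((F1 (circ p q s t) * (expi t - q) * s + F (circ p q s t)) * expi t)); [ring |].
            replace (Ci * Ci) with (RtoC (-1)); [ring_simplify; ring |].
            apply injective_projections; cbn; ring. }
          apply (has_deriv_mult RtoC filterlim_RtoC (fun _ => - Ci)); [apply has_deriv_const |].
          assert (De : rderiv (fun t => expi t - q) t (Ci * expi t + - 0)).
          { apply has_deriv_plus; [apply rderiv_expi |].
            apply (has_deriv_eq RtoC _ _ 0); [ring | apply has_deriv_const]. }
          destruct (Ceq_dec (expi t) q) as [Hq | Hq].
          (* At the base point [F] is only continuous, but its cofactor [expi t - q] vanishes
             there. *)
          -- apply (has_deriv_eq RtoC _ _ (F (circ p q s t) * (Ci * expi t + - 0))).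
             { rewrite Hq. ring. }
             apply (has_deriv_mult_zero RtoC (fun t => F (circ p q s t)));
               [apply Cs | rewrite Hq; ring | exact De].
          -- apply (has_deriv_mult RtoC filterlim_RtoC (fun t => F (circ p q s t))); [| exact De].
             apply (has_deriv_comp RtoC filterlim_RtoC F (circ p q s)); [now apply Hd | apply rderiv_circ_t].
        * apply jcts_slice. intros t. now apply JD. }
  unfold Phi in E. rewrite !clamp_id in E by lra. exact E.
Qed.

(** * Power series with rapidly decreasing coefficients *)

Notation is_Cseries := (is_series (K := C_AbsRing) (V := C_NormedModule)).

Definition Cseries (u : nat -> C) : C :=
  (Series (fun n => Re (u n)), Series (fun n => Im (u n))).

Lemma sum_n_Re (u : nat -> C) (n : nat) :
  Re (sum_n (G := C_AbelianGroup) u n) = sum_n (fun k => Re (u k)) n.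
Proof.
  induction n as [| n IH]; [now rewrite !sum_O |].
  rewrite !sum_Sn, <- IH. reflexivity.
Qed.

Lemma sum_n_Im (u : nat -> C) (n : nat) :
  Im (sum_n (G := C_AbelianGroup) u n) = sum_n (fun k => Im (u k)) n.
Proof.
  induction n as [| n IH]; [now rewrite !sum_O |].
  rewrite !sum_Sn, <- IH. reflexivity.
Qed.

Lemma Cseries_unique (u : nat -> C) (l : C) : is_Cseries u l -> Cseries u = l.
Proof.
  intros H. apply injective_projections; apply is_series_unique.
  - apply (filterlim_ext (fun n => Re (sum_n (G := C_AbelianGroup) u n))).
    + intros n. apply sum_n_Re.
    + exact (filterlim_Re _ _ H).
  - apply (filterlim_ext (fun n => Im (sum_n (G := C_AbelianGroup) u n))).
    + intros n. apply sum_n_Im.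
    + exact (filterlim_Im _ _ H).
Qed.

Lemma is_Cseries_abs (u : nat -> C) (v : nat -> R) :
  (forall n, (Cmod (u n) <= v n)%R) -> ex_series v -> is_Cseries u (Cseries u).
Proof.
  intros H Hv.
  destruct (ex_series_le (K := C_AbsRing) (V := C_CompleteNormedModule) u v H Hv) as [l Hl].
  rewrite (Cseries_unique u l Hl). exact Hl.
Qed.

Lemma is_Cseries_Cmod_le (u : nat -> C) (v : nat -> R) (l : C) (T : R) :
  (forall n, (Cmod (u n) <= v n)%R) -> is_Cseries u l -> is_series v T -> (Cmod l <= T)%R.
Proof.
  intros H Hu Hv. apply Rnot_lt_le. intros Hlt.
  assert (A := filterlim_C_lt _ _ ((Cmod l - T) / 2)%R Hu ltac:(lra)).
  assert (He : (0 < (Cmod l - T) / 2)%R) by lra.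
  assert (B := proj1 (filterlim_locally _ _) Hv (mkposreal _ He)).
  destruct (filter_and (F := eventually) _ _ A B) as [N HN].
  destruct (HN N (le_n N)) as [H1 H2].
  change (Rabs (sum_n v N - T) < (Cmod l - T) / 2)%R in H2.
  change (Cmod (sum_n (G := C_AbelianGroup) u N - l) < (Cmod l - T) / 2)%R in H1.
  assert (H3 : (Cmod (sum_n (G := C_AbelianGroup) u N) <= sum_n v N)%R).
  { clear -H. induction N as [| N IH]; [rewrite !sum_O; apply H |].
    rewrite !sum_Sn. eapply Rle_trans; [apply Cmod_triangle |].
    apply Rplus_le_compat; auto. }
  apply Rabs_def2 in H2.
  assert (H4 : (Cmod l <= Cmod (sum_n (G := C_AbelianGroup) u N) +
                Cmod (sum_n (G := C_AbelianGroup) u N - l))%R).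
  { rewrite Cmod_minus_sym.
    replace l with (sum_n (G := C_AbelianGroup) u N + (l - sum_n (G := C_AbelianGroup) u N)) at 1 by ring.
    apply Cmod_triangle. }
  lra.
Qed.

Lemma is_Cseries_ext (u v : nat -> C) (l : C) :
  (forall n, u n = v n) -> is_Cseries u l -> is_Cseries v l.
Proof. intros H. now apply is_series_ext. Qed.

Lemma is_Cseries_eq (u : nat -> C) (a b : C) : a = b -> is_Cseries u a -> is_Cseries u b.
Proof. now intros ->. Qed.

Lemma is_Cseries_minus (u v : nat -> C) (a b : C) :
  is_Cseries u a -> is_Cseries v b -> is_Cseries (fun n => u n - v n) (a - b).
Proof. intros Hu Hv. exact (is_series_minus _ _ _ _ Hu Hv). Qed.

Lemma is_Cseries_scal (c : C) (u : nat -> C) (a : C) :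
  is_Cseries u a -> is_Cseries (fun n => c * u n) (c * a).
Proof. intros Hu. exact (is_series_scal (K := C_AbsRing) (V := C_NormedModule) c _ _ Hu). Qed.

Lemma is_Cseries_unique (u : nat -> C) (a b : C) :
  is_Cseries u a -> is_Cseries u b -> a = b.
Proof. intros Ha Hb. rewrite <- (Cseries_unique _ _ Ha). now apply Cseries_unique. Qed.

(** Decay faster than any power of the index. The weight uses [S n] so that it is positive at
    [n = 0] as well. *)
Definition rapid (a : nat -> C) : Prop :=
  forall k, exists M, forall n, (INR (S n) ^ k * Cmod (a n) <= M)%R.

(** Comparison with a telescoping series: [1 / x ^ 2 <= 2 * (1 / x - 1 / (x + 1))] for [x >= 1]. *)
Lemma ex_series_inv_sqr : ex_series (fun n => / INR (S n) ^ 2)%R.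
Proof.
  apply (ex_series_le (K := R_AbsRing) (V := R_CompleteNormedModule)) with
    (b := fun n => (2 * (/ INR (S n) - / INR (S (S n))))%R).
  - intros n. pose proof (pos_INR n). rewrite !S_INR. set (x := INR n) in *.
    change (Rabs (/ (x + 1) ^ 2) <= 2 * (/ (x + 1) - / (x + 1 + 1)))%R.
    rewrite Rabs_pos_eq by (apply Rlt_le, Rinv_0_lt_compat; nra).
    replace (2 * (/ (x + 1) - / (x + 1 + 1)))%R with (2 / ((x + 1) * (x + 2)))%R by (field; lra).
    replace (/ (x + 1) ^ 2)%R with ((x + 2) / (x + 1) * / ((x + 1) * (x + 2)))%R by (field; lra).
    apply Rmult_le_compat_r; [apply Rlt_le, Rinv_0_lt_compat; nra |].
    apply Rmult_le_reg_r with (x + 1)%R; [lra |].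
    unfold Rdiv. rewrite Rmult_assoc, Rinv_l by lra. lra.
  - exists (2 * 1)%R. apply (is_series_scal (K := R_AbsRing) (V := R_NormedModule) 2%R).
    apply (filterlim_ext (fun n => (1 - / INR (S (S n)))%R)).
    + intros n. induction n as [| n IH].
      * rewrite sum_O. cbn. lra.
      * rewrite sum_Sn, <- IH. unfold plus; cbn [AbelianMonoid.plus]; cbn -[INR]. ring.
    + assert (L : is_lim_seq (fun n => (1 - / INR (S (S n)))%R) (1 - 0)%R).
      { apply is_lim_seq_minus'; [apply is_lim_seq_const |].
        apply (is_lim_seq_ext (fun n => / INR (n + 2))%R); [intros n; now rewrite Nat.add_comm |].
        apply (proj1 (is_lim_seq_incr_n (fun n => / INR n)%R 2 0)).
        change (Finite 0) with (Rbar_inv p_infty).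
        apply is_lim_seq_inv; [apply is_lim_seq_INR | discriminate]. }
      rewrite Rminus_0_r in L. exact L.
Qed.

(** The bound of order [k + 2] leaves a spare factor [1 / (n + 1) ^ 2], which is summable. *)
Lemma rapid_summable (a : nat -> C) (k : nat) :
  rapid a -> ex_series (fun n => INR (S n) ^ k * Cmod (a n))%R.
Proof.
  intros H. destruct (H (k + 2)%nat) as [M HM].
  apply (ex_series_le (K := R_AbsRing) (V := R_CompleteNormedModule)) with
    (b := fun n => (M * / INR (S n) ^ 2)%R).
  - intros n. specialize (HM n).
    assert (Hp : (0 < INR (S n))%R) by (apply lt_0_INR; lia).
    change (Rabs (INR (S n) ^ k * Cmod (a n)) <= M * / INR (S n) ^ 2)%R.
    pose proof (Cmod_ge_0 (a n)). pose proof (pow_lt _ k Hp). pose proof (pow_lt _ 2 Hp).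
    rewrite Rabs_pos_eq by (apply Rmult_le_pos; lra).
    apply Rmult_le_reg_r with (INR (S n) ^ 2)%R; [assumption |].
    replace (M * / INR (S n) ^ 2 * INR (S n) ^ 2)%R with M by (field; lra).
    rewrite pow_add in HM. nra.
  - apply (ex_series_scal (K := R_AbsRing) (V := R_NormedModule)). exact ex_series_inv_sqr.
Qed.

Lemma rapid_le (a b : nat -> C) (j : nat) (L : R) :
  rapid a -> (forall n, (Cmod (b n) <= L * INR (S n) ^ j * Cmod (a n))%R) -> rapid b.
Proof.
  intros Ha Hb k. destruct (Ha (k + j)%nat) as [M HM].
  exists (Rabs L * M)%R. intros n. specialize (HM n).
  assert (Hp : (0 < INR (S n))%R) by (apply lt_0_INR; lia).
  pose proof (pow_lt _ k Hp). pose proof (pow_lt _ j Hp). pose proof (Cmod_ge_0 (a n)).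
  rewrite pow_add in HM.
  apply Rle_trans with (INR (S n) ^ k * (Rabs L * INR (S n) ^ j * Cmod (a n)))%R.
  - apply Rmult_le_compat_l; [lra |]. eapply Rle_trans; [apply Hb |].
    rewrite !Rmult_assoc. apply Rmult_le_compat_r; [nra | apply Rle_abs].
  - pose proof (Rabs_pos L).
    replace (INR (S n) ^ k * (Rabs L * INR (S n) ^ j * Cmod (a n)))%R
      with (Rabs L * (INR (S n) ^ k * INR (S n) ^ j * Cmod (a n)))%R by ring.
    now apply Rmult_le_compat_l.
Qed.

Lemma rapid_shift (a : nat -> C) : rapid a -> rapid (fun n => a (S n)).
Proof.
  intros Ha k. destruct (Ha k) as [M HM]. exists M. intros n.
  eapply Rle_trans; [| apply (HM (S n))].
  apply Rmult_le_compat_r; [apply Cmod_ge_0 |].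
  apply pow_incr. split; [apply pos_INR |]. apply le_INR. lia.
Qed.

Lemma rapid_unshift (a : nat -> C) : rapid (fun n => a (S n)) -> rapid a.
Proof.
  intros Ha k. destruct (Ha k) as [M HM].
  exists (Rmax (Cmod (a O)) (2 ^ k * M))%R. intros [| n].
  - replace (INR 1 ^ k)%R with 1%R by (cbn; now rewrite pow1).
    rewrite Rmult_1_l. apply Rmax_l.
  - eapply Rle_trans; [| apply Rmax_r].
    apply Rle_trans with ((2 * INR (S n)) ^ k * Cmod (a (S n)))%R.
    + apply Rmult_le_compat_r; [apply Cmod_ge_0 |]. apply pow_incr. split; [apply pos_INR |].
      rewrite !S_INR. pose proof (pos_INR n). lra.
    + rewrite Rpow_mult_distr, Rmult_assoc. apply Rmult_le_compat_l; [apply pow_le; lra | apply HM].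
Qed.

Lemma rapid_geometric (a : nat -> C) (M q : R) :
  (0 < q < 1)%R -> (forall n, (Cmod (a n) <= M)%R) -> rapid (fun n => RtoC (q ^ n) * a n).
Proof.
  intros Hq Ha.
  assert (key : forall k q, (0 < q < 1)%R -> exists L, forall n, (INR (S n) ^ k * q ^ n <= L)%R).
  { clear. intros k. induction k as [| k IH]; intros q Hq.
    - exists 1%R. intros n. rewrite pow_O, Rmult_1_l.
      rewrite <- (pow1 n). apply pow_incr. lra.
    (* Write [q ^ n = s ^ n * s ^ n]. One factor absorbs a single power of [n + 1] by Bernoulli's
       inequality for [1 / s = 1 + x]; the other, with the remaining [k] powers, is left to the
       induction hypothesis. *)
    - set (s := sqrt q).
      assert (Hs : (0 < s)%R) by (apply sqrt_lt_R0; lra).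
      assert (Hs2 : (s * s = q)%R) by (apply sqrt_sqrt; lra).
      assert (Hs1 : (s < 1)%R) by nra.
      destruct (IH s (conj Hs Hs1)) as [L HL].
      set (x := (/ s - 1)%R).
      assert (Hx : (0 < x)%R).
      { unfold x. assert (/ 1 < / s)%R by (apply Rinv_lt_contravar; lra). rewrite Rinv_1 in H. lra. }
      assert (Hsx : (s * (1 + x) = 1)%R) by (unfold x; field; lra).
      assert (Hb : forall n, (INR (S n) * s ^ n <= 1 + / x)%R).
      { intros n. assert (Hpow : (s ^ n * (1 + x) ^ n = 1)%R)
          by (rewrite <- Rpow_mult_distr, Hsx; apply pow1).
        assert (Hbern := poly n x Hx). fold (INR n) in Hbern.
        assert (Hsn : (0 < s ^ n)%R) by now apply pow_lt.
        assert (Hix : (x * / x = 1)%R) by (apply Rinv_r; lra).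
        assert (0 < / x)%R by now apply Rinv_0_lt_compat.
        pose proof (pos_INR n). rewrite S_INR.
        apply Rle_trans with ((1 + / x) * (1 + INR n * x) * s ^ n)%R.
        - apply Rmult_le_compat_r; [lra |]. nra.
        - assert ((1 + INR n * x) * s ^ n <= 1)%R by nra. nra. }
      exists ((1 + / x) * L)%R. intros n.
      replace (INR (S n) ^ S k * q ^ n)%R with ((INR (S n) * s ^ n) * (INR (S n) ^ k * s ^ n))%R
        by (rewrite <- Hs2, Rpow_mult_distr; cbn [pow]; ring).
      apply Rmult_le_compat; auto.
      + apply Rmult_le_pos; [apply pos_INR | apply pow_le; lra].
      + apply Rmult_le_pos; apply pow_le; [apply pos_INR | lra]. }
  intros k. destruct (key k q Hq) as [L HL]. exists (L * M)%R. intros n.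
  rewrite Cmod_mult, Cmod_R, Rabs_pos_eq by (apply pow_le; lra).
  rewrite <- Rmult_assoc. apply Rmult_le_compat; auto using Cmod_ge_0.
  apply Rmult_le_pos; apply pow_le; [apply pos_INR | lra].
Qed.

Definition PS (a : nat -> C) (z : C) : C := Cseries (fun n => a n * z ^ n).

Definition dPS (a : nat -> C) (n : nat) : C := RtoC (INR (S n)) * a (S n).

Lemma rapid_dPS (a : nat -> C) : rapid a -> rapid (dPS a).
Proof.
  intros Ha. apply (rapid_le _ _ 1 1 (rapid_shift a Ha)). intros n. unfold dPS.
  rewrite Cmod_mult, Cmod_R, Rabs_pos_eq by apply pos_INR. lra.
Qed.

Lemma Cpow_Cmod_le1 (z : C) (n : nat) : (Cmod z <= 1)%R -> (Cmod (z ^ n) <= 1)%R.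
Proof.
  intros Hz. rewrite Cmod_pow, <- (pow1 n). apply pow_incr. split; [apply Cmod_ge_0 | exact Hz].
Qed.

Lemma is_Cseries_PS (a : nat -> C) (z : C) :
  rapid a -> (Cmod z <= 1)%R -> is_Cseries (fun n => a n * z ^ n) (PS a z).
Proof.
  intros Ha Hz. apply is_Cseries_abs with (2 := rapid_summable a 0 Ha).
  intros n. rewrite Cmod_mult, pow_O, Rmult_1_l.
  pose proof (Cpow_Cmod_le1 z n Hz). pose proof (Cmod_ge_0 (a n)). nra.
Qed.

Lemma Cpow_Lipschitz (z w : C) (n : nat) :
  (Cmod z <= 1)%R -> (Cmod w <= 1)%R -> (Cmod (z ^ n - w ^ n) <= INR n * Cmod (z - w))%R.
Proof.
  intros Hz Hw. induction n as [| n IH].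
  - cbn. replace (1 - 1) with (RtoC 0) by ring. rewrite Cmod_0. lra.
  - rewrite !Cpow_S, S_INR.
    replace (z * z ^ n - w * w ^ n) with (z * (z ^ n - w ^ n) + (z - w) * w ^ n) by ring.
    eapply Rle_trans; [apply Cmod_triangle |]. rewrite !Cmod_mult.
    pose proof (Cpow_Cmod_le1 w n Hw). pose proof (Cmod_ge_0 (z - w)).
    pose proof (Cmod_ge_0 (z ^ n - w ^ n)). nra.
Qed.

(** The second-order remainder of a monomial is bounded on the whole closed disc by a polynomial in
    [n]. Summed against rapidly decreasing coefficients it gives a quadratic remainder for the power
    series. *)
Lemma Cpow_Taylor1 (z w : C) (n : nat) :
  (Cmod z <= 1)%R -> (Cmod w <= 1)%R ->
  (Cmod (w ^ S n - z ^ S n - (w - z) * (RtoC (INR (S n)) * z ^ n))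
    <= INR (S n) ^ 2 * Cmod (w - z) ^ 2)%R.
Proof.
  intros Hz Hw. pose proof (Cmod_ge_0 (w - z)) as Hd. induction n as [| n IH].
  - replace (w ^ 1 - z ^ 1 - (w - z) * (RtoC (INR 1) * z ^ 0)) with (RtoC 0) by (cbn; ring).
    rewrite Cmod_0. apply Rmult_le_pos; apply pow_le; [apply pos_INR | exact Hd].
  - replace (w ^ S (S n) - z ^ S (S n) - (w - z) * (RtoC (INR (S (S n))) * z ^ S n))
      with (z * (w ^ S n - z ^ S n - (w - z) * (RtoC (INR (S n)) * z ^ n))
            + (w - z) * (w ^ S n - z ^ S n)).
    2: { rewrite (S_INR (S n)), RtoC_plus, (Cpow_S w (S n)), (Cpow_S z (S n)).
         rewrite (Cpow_S z n). ring. }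
    eapply Rle_trans; [apply Cmod_triangle |]. rewrite !Cmod_mult.
    pose proof (Cpow_Lipschitz w z (S n) Hw Hz) as HL.
    pose proof (Cmod_ge_0 (w ^ S n - z ^ S n - (w - z) * (RtoC (INR (S n)) * z ^ n))) as H1.
    rewrite (S_INR (S n)).
    pose proof (pos_INR (S n)).
    assert (Cmod (w - z) * Cmod (w ^ S n - z ^ S n) <= INR (S n) * Cmod (w - z) ^ 2)%R by nra.
    assert (0 <= Cmod (w - z) ^ 2)%R by now apply pow_le. nra.
Qed.

(** The constant is the sum of [(n + 1) * Cmod (a n)]. It does not degenerate at the unit circle, so
    the bound gives continuity up to the boundary and later the decay at infinity of the exterior
    part. *)
Lemma PS_Lipschitz (a : nat -> C) :
  rapid a -> exists L, forall z w, (Cmod z <= 1)%R -> (Cmod w <= 1)%R ->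
    (Cmod (PS a z - PS a w) <= L * Cmod (z - w))%R.
Proof.
  intros Ha. destruct (rapid_summable a 1 Ha) as [L HL]. exists L. intros z w Hz Hw.
  apply (is_Cseries_Cmod_le (fun n => a n * z ^ n - a n * w ^ n)
    (fun n => Cmod (z - w) * (INR (S n) ^ 1 * Cmod (a n)))%R).
  - intros n. replace (a n * z ^ n - a n * w ^ n) with (a n * (z ^ n - w ^ n)) by ring.
    rewrite Cmod_mult. pose proof (Cpow_Lipschitz z w n Hz Hw).
    pose proof (Cmod_ge_0 (a n)). pose proof (Cmod_ge_0 (z - w)). rewrite S_INR.
    pose proof (pos_INR n). pose proof (Rmult_le_pos _ _ H0 H1). nra.
  - apply is_Cseries_minus; now apply is_Cseries_PS.
  - rewrite Rmult_comm. exact (is_series_scal (K := R_AbsRing) (V := R_NormedModule) _ _ _ HL).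
Qed.

Lemma PS_cont (a : nat -> C) (z : C) :
  rapid a -> (Cmod z <= 1)%R ->
  filterlim (PS a) (within (fun w => (Cmod w <= 1)%R) (locally z)) (locally (PS a z)).
Proof.
  intros Ha Hz. destruct (PS_Lipschitz a Ha) as [L HL].
  apply filterlim_C. intros eps Heps. unfold within.
  apply locally_Cmod. exists (eps / (Rabs L + 1))%R. pose proof (Rabs_pos L).
  split; [apply Rdiv_lt_0_compat; lra |]. intros w Hw Hw1.
  eapply Rle_lt_trans; [now apply HL |].
  apply Rle_lt_trans with (Rabs L * Cmod (w - z))%R.
  - apply Rmult_le_compat_r; [apply Cmod_ge_0 | apply Rle_abs].
  - apply (Rmult_lt_compat_r (Rabs L + 1)) in Hw; [| lra].
    unfold Rdiv in Hw. rewrite Rmult_assoc, Rinv_l, Rmult_1_r in Hw by lra.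
    pose proof (Cmod_ge_0 (w - z)). nra.
Qed.

Lemma cderiv_quadratic (f : C -> C) (z l : C) (K d : R) :
  (0 < d)%R ->
  (forall w, (Cmod (w - z) < d)%R -> (Cmod (f w - f z - (w - z) * l) <= K * Cmod (w - z) ^ 2)%R) ->
  cderiv f z l.
Proof.
  intros Hd H.
  exists (fun w : C => if Ceq_dec w z then l else (f w - f z) / (w - z)). repeat split.
  - now destruct (Ceq_dec z z).
  - apply filterlim_C. intros eps Heps. apply locally_Cmod.
    pose proof (Rabs_pos K).
    assert (H1 : (0 < eps / (Rabs K + 1))%R) by (apply Rdiv_lt_0_compat; lra).
    exists (Rmin d (eps / (Rabs K + 1)))%R. split; [now apply Rmin_glb_lt |].
    intros w Hw.
    assert (W1 := Rlt_le_trans _ _ _ Hw (Rmin_l _ _)).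
    assert (W2 := Rlt_le_trans _ _ _ Hw (Rmin_r _ _)).
    cbv beta.
    destruct (Ceq_dec w z) as [-> | Hn].
    + replace (l - l) with (RtoC 0) by ring. rewrite Cmod_0. lra.
    + assert (Hz : w - z <> 0).
      { intros E. apply Hn. replace w with ((w - z) + z) by ring. rewrite E. ring. }
      assert (Hp : (0 < Cmod (w - z))%R) by now apply Cmod_gt_0.
      replace ((f w - f z) / (w - z) - l) with ((f w - f z - (w - z) * l) / (w - z)) by (field; auto).
      rewrite Cmod_div by auto. specialize (H w W1).
      apply Rmult_lt_reg_r with (Cmod (w - z)); [auto |].
      unfold Rdiv at 1. rewrite Rmult_assoc, Rinv_l, Rmult_1_r by lra.
      apply (Rmult_lt_compat_r (Rabs K + 1)) in W2; [| lra].
      unfold Rdiv in W2. rewrite Rmult_assoc, Rinv_l, Rmult_1_r in W2 by lra.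
      pose proof (Rle_abs K).
      assert (K * Cmod (w - z) <= Rabs K * Cmod (w - z))%R by (apply Rmult_le_compat_r; lra).
      nra.
  - apply filter_forall. intros w. destruct (Ceq_dec w z) as [-> | Hn]; [ring |].
    field. intros E. apply Hn. replace w with ((w - z) + z) by ring. rewrite E. ring.
Qed.

Lemma PS_deriv (a : nat -> C) (z : C) :
  rapid a -> (Cmod z < 1)%R -> cderiv (PS a) z (PS (dPS a) z).
Proof.
  intros Ha Hz. destruct (rapid_summable a 2 Ha) as [K HK].
  apply cderiv_quadratic with (K := K) (d := (1 - Cmod z)%R); [lra |].
  intros w Hw.
  assert (Hw1 : (Cmod w <= 1)%R).
  { replace w with ((w - z) + z) by ring. eapply Rle_trans; [apply Cmod_triangle |]. lra. }
  assert (Hz1 : (Cmod z <= 1)%R) by lra.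
  (* The derived series, shifted by one place so that its terms line up with those of
     [a n * w ^ n - a n * z ^ n]. *)
  set (c := fun n => match n with O => RtoC 0 | S m => dPS a m * z ^ m end).
  apply (is_Cseries_Cmod_le (fun n => a n * w ^ n - a n * z ^ n - (w - z) * c n)
    (fun n => Cmod (w - z) ^ 2 * (INR (S n) ^ 2 * Cmod (a n)))%R).
  - intros [| n].
    + replace (a O * w ^ 0 - a O * z ^ 0 - (w - z) * c O) with (RtoC 0) by (cbn; ring).
      rewrite Cmod_0. apply Rmult_le_pos; [apply pow2_ge_0 |].
      apply Rmult_le_pos; [apply pow2_ge_0 | apply Cmod_ge_0].
    + unfold c, dPS.
      replace (a (S n) * w ^ S n - a (S n) * z ^ S n - (w - z) * (RtoC (INR (S n)) * a (S n) * z ^ n))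
        with (a (S n) * (w ^ S n - z ^ S n - (w - z) * (RtoC (INR (S n)) * z ^ n))) by ring.
      rewrite Cmod_mult. pose proof (Cpow_Taylor1 z w n Hz1 Hw1) as HT.
      replace (Cmod (w - z) ^ 2 * (INR (S (S n)) ^ 2 * Cmod (a (S n))))%R
        with (Cmod (a (S n)) * (INR (S (S n)) ^ 2 * Cmod (w - z) ^ 2))%R by ring.
      apply Rmult_le_compat_l; [apply Cmod_ge_0 |]. eapply Rle_trans; [exact HT |].
      apply Rmult_le_compat_r; [apply pow2_ge_0 |]. apply pow_incr.
      split; [apply pos_INR | apply le_INR; lia].
  - apply is_Cseries_minus; [apply is_Cseries_minus; now apply is_Cseries_PS |].
    apply is_Cseries_scal.
    apply (is_series_decr_1 (K := C_AbsRing) (V := C_NormedModule) c).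
    apply (is_Cseries_eq _ (PS (dPS a) z)).
    { change (PS (dPS a) z = PS (dPS a) z + - (0)). ring. }
    apply is_Cseries_PS; [now apply rapid_dPS | exact Hz1].
  - rewrite Rmult_comm. exact (is_series_scal (K := R_AbsRing) (V := R_NormedModule) _ _ _ HK).
Qed.

Lemma PS_0 (a : nat -> C) : PS a 0 = a O.
Proof.
  apply Cseries_unique.
  apply filterlim_ext with (fun _ : nat => a O); [| apply filterlim_const].
  intros n. induction n as [| n IH].
  - rewrite sum_O. cbn. ring.
  - rewrite sum_Sn, <- IH. change (a O = a O + a (S n) * 0 ^ S n). rewrite Cpow_S. ring.
Qed.

(** * Cauchy's formula *)

Lemma expi_pow (x : R) (n : nat) : expi x ^ n = expi (INR n * x).
Proof.
  induction n as [| n IH].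
  - cbn [Cpow INR]. now rewrite Rmult_0_l, expi_0.
  - rewrite Cpow_S, IH, S_INR, <- expi_plus. f_equal. ring.
Qed.

Lemma Ci_neq_0 : Ci <> 0.
Proof. intros E. injection E. lra. Qed.

Lemma Cint_expi_scal (k : Z) : k <> 0%Z -> Cint (fun t => expi (IZR k * t)) = 0.
Proof.
  intros Hk.
  assert (Hk' : Ci * RtoC (IZR k) <> 0).
  { apply Cmult_neq_0; [apply Ci_neq_0 |]. intros E. apply Hk, eq_IZR. now injection E. }
  rewrite (Cint_deriv (fun t => / (Ci * RtoC (IZR k)) * expi (IZR k * t))).
  - rewrite Rmult_0_r, expi_0, expi_period. ring.
  - apply cts_mult; [apply cts_const | apply cts_expi_scal].
  - intros t _.
    apply (has_deriv_eq RtoC _ _ (0 * expi (IZR k * t) + / (Ci * RtoC (IZR k)) * (Ci * RtoC (IZR k) * expi (IZR k * t)))).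
    { field. split; intros E; apply Hk'; rewrite E; ring. }
    apply (has_deriv_mult RtoC filterlim_RtoC (fun _ => / (Ci * RtoC (IZR k)))
      (fun t => expi (IZR k * t))).
    + apply has_deriv_const.
    + apply rderiv_expi_scal.
  - apply cts_expi_scal.
Qed.

Lemma one_minus_neq_0 (u w : C) : (Cmod u <= 1)%R -> (Cmod w < 1)%R -> 1 - u * w <> 0.
Proof.
  intros Hu Hw E. assert (Cmod (u * w) = 1%R).
  { replace (u * w) with (1 - (1 - u * w)) by ring. rewrite E.
    replace (1 - 0) with (RtoC 1) by ring. apply Cmod_1. }
  rewrite Cmod_mult in H. pose proof (Cmod_ge_0 u). pose proof (Cmod_ge_0 w). nra.
Qed.

(** A finite geometric sum has an exact remainder, so the partial sums differ from the integral by a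
    single integral. The latter is at most a constant times [Cmod w ^ S N], since
    [Cmod (1 - u t * w) >= 1 - Cmod w]. *)
Lemma Cint_geometric (phi u : R -> C) (w : C) :
  rcts phi -> rcts u -> (forall t, (Cmod (u t) <= 1)%R) -> (Cmod w < 1)%R ->
  is_Cseries (fun n => Cint (fun t => phi t * u t ^ n) * w ^ n)
    (Cint (fun t => phi t / (1 - u t * w))).
Proof.
  intros Hphi Hu Hu1 Hw.
  assert (Hnz : forall t, 1 - u t * w <> 0) by (intros t; now apply one_minus_neq_0).
  assert (Hden : rcts (fun t => 1 - u t * w)).
  { apply cts_minus; [apply cts_const | apply cts_mult; [exact Hu | apply cts_const]]. }
  assert (Hpow : forall n, rcts (fun t => phi t * u t ^ n)).
  { intros n. apply cts_mult; [exact Hphi | now apply cts_pow]. }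
  assert (Hrem : forall n, rcts (fun t => w ^ n * (phi t * u t ^ n / (1 - u t * w)))).
  { intros n. apply cts_mult; [apply cts_const |]. now apply cts_div. }
  assert (Hsum : forall N, sum_n (G := C_AbelianGroup) (fun n => Cint (fun t => phi t * u t ^ n) * w ^ n) N =
     Cint (fun t => phi t / (1 - u t * w)) - Cint (fun t => w ^ S N * (phi t * u t ^ S N / (1 - u t * w)))).
  { intros N. induction N as [| N IH].
    - rewrite sum_O. rewrite <- Cint_minus by (auto; now apply cts_div).
      cbn [Cpow]. rewrite Cmult_1_r. apply Cint_ext. intros t. field. apply Hnz.
    - rewrite sum_Sn, IH.
      change (Cint (fun t => phi t / (1 - u t * w)) -
        Cint (fun t => w ^ S N * (phi t * u t ^ S N / (1 - u t * w))) +
        Cint (fun t => phi t * u t ^ S N) * w ^ S N =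
        Cint (fun t => phi t / (1 - u t * w)) -
        Cint (fun t => w ^ S (S N) * (phi t * u t ^ S (S N) / (1 - u t * w)))).
      rewrite (Cmult_comm (Cint _)), <- Cint_scal by auto.
      assert (E : Cint (fun t => w ^ S N * (phi t * u t ^ S N / (1 - u t * w))) =
        Cint (fun t => w ^ S N * (phi t * u t ^ S N)) +
        Cint (fun t => w ^ S (S N) * (phi t * u t ^ S (S N) / (1 - u t * w)))).
      { rewrite <- Cint_plus; auto.
        - apply Cint_ext. intros t. rewrite (Cpow_S w (S N)), (Cpow_S (u t) (S N)). field. apply Hnz.
        - apply cts_mult; [apply cts_const | apply Hpow]. }
      rewrite E. ring. }
  destruct (rcts_bounded phi 0 (2 * PI) Hphi) as [M HM].
  set (K := (4 * PI * (Rabs M / (1 - Cmod w)))%R).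
  assert (HK : (0 <= K)%R).
  { unfold K. pose proof PI_RGT_0. pose proof (Rabs_pos M).
    apply Rmult_le_pos; [lra |]. apply Rmult_le_pos; [lra |]. apply Rlt_le, Rinv_0_lt_compat. lra. }
  assert (Hbd : forall N, (Cmod (Cint (fun t => w ^ S N * (phi t * u t ^ S N / (1 - u t * w)))%C) <= K * Cmod w ^ S N)%R).
  { intros N. replace (K * Cmod w ^ S N)%R with (4 * PI * (Cmod w ^ S N * (Rabs M / (1 - Cmod w))))%R
      by (unfold K; ring).
    apply Cint_bound; [apply Hrem |]. intros t Ht.
    rewrite Cmod_mult, Cmod_pow. apply Rmult_le_compat_l; [apply pow_le, Cmod_ge_0 |].
    rewrite Cmod_div by apply Hnz. rewrite Cmod_mult.
    apply Rmult_le_compat.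
    - apply Rmult_le_pos; apply Cmod_ge_0.
    - apply Rlt_le, Rinv_0_lt_compat. now apply Cmod_gt_0.
    - pose proof (HM t Ht). pose proof (Rle_abs M). pose proof (Cpow_Cmod_le1 (u t) (S N) (Hu1 t)).
      pose proof (Cmod_ge_0 (phi t)). pose proof (Cmod_ge_0 (u t ^ S N)). nra.
    - apply Rinv_le_contravar; [lra |].
      assert (Cmod 1 <= Cmod (1 - u t * w) + Cmod (u t * w))%R.
      { replace (RtoC 1) with ((1 - u t * w) + u t * w) at 1 by ring. apply Cmod_triangle. }
      rewrite Cmod_1, Cmod_mult in H.
      pose proof (Hu1 t). pose proof (Cmod_ge_0 w). pose proof (Cmod_ge_0 (u t)). nra. }
  apply filterlim_C. intros eps Heps.
  assert (Hlim : is_lim_seq (fun N => (K * Cmod w ^ S N)%R) 0%R).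
  { replace (Finite 0) with (Rbar_mult K 0) by (cbn; now rewrite Rmult_0_r).
    apply is_lim_seq_scal_l. apply (is_lim_seq_incr_1 (fun n => Cmod w ^ n)%R).
    apply is_lim_seq_geom. rewrite Rabs_pos_eq by apply Cmod_ge_0. exact Hw. }
  generalize (proj1 (filterlim_locally _ _) Hlim (mkposreal _ Heps)).
  apply filter_imp. intros N HN.
  change (Rabs (K * Cmod w ^ S N - 0) < eps)%R in HN. apply Rabs_def2 in HN.
  change (Cmod (sum_n (G := C_AbelianGroup) (fun n => Cint (fun t => phi t * u t ^ n) * w ^ n) N
    - Cint (fun t => phi t / (1 - u t * w)))%C < eps)%R.
  rewrite Hsum, Cmod_minus_sym.
  match goal with |- (Cmod ?z < _)%R => replace z with
    (Cint (fun t => w ^ S N * (phi t * u t ^ S N / (1 - u t * w)))) by ring end.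
  eapply Rle_lt_trans; [apply Hbd | lra].
Qed.

(** In the geometric expansion every term of positive degree contains the integral of a nontrivial
    character, which vanishes; only the constant term remains. The cases [k = -1] and [k = 1] serve
    the outer and the inner circle. *)
Lemma Cint_kernel (k : Z) (w : C) :
  k <> 0%Z -> (Cmod w < 1)%R ->
  Cint (fun t => 1 / (1 - expi (IZR k * t) * w)) = RtoC (2 * PI).
Proof.
  intros Hk Hw.
  assert (H := Cint_geometric (fun _ => 1) (fun t => expi (IZR k * t)) w (cts_const 1)
    (cts_expi_scal (IZR k)) (fun t => Req_le _ _ (Cmod_expi _)) Hw).
  apply (is_Cseries_unique _ _ _ H).
  apply filterlim_ext with (fun _ : nat => RtoC (2 * PI)); [| apply filterlim_const].
  intros n. induction n as [| n IH].
  - rewrite sum_O. rewrite (Cint_ext _ (fun _ => 1)) by (intros; cbn; ring).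
    rewrite Cint_const. cbn. ring.
  - rewrite sum_Sn, <- IH.
    rewrite (Cint_ext _ (fun t => expi (IZR (k * Z.of_nat (S n)) * t))).
    + rewrite Cint_expi_scal by lia. change (RtoC (2 * PI) = RtoC (2 * PI) + 0 * w ^ S n). ring.
    + intros t. rewrite expi_pow, mult_IZR, <- INR_IZR_INZ, Cmult_1_l. f_equal. ring.
Qed.

Lemma filterlim_within_weaken {T : UniformSpace} (K : T -> Prop) (f : T -> C) (x : T) (l : C) :
  filterlim f (locally x) (locally l) -> filterlim f (within K (locally x)) (locally l).
Proof. apply filterlim_filter_le_1, filter_le_within. Qed.

Lemma filterlim_within_subset {T : UniformSpace} (K K' : T -> Prop) (f : T -> C) (x : T) (l : C) :
  (forall y, K' y -> K y) ->
  filterlim f (within K (locally x)) (locally l) -> filterlim f (within K' (locally x)) (locally l).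
Proof.
  intros H. apply filterlim_filter_le_1. intros P. unfold within.
  apply filter_imp. auto.
Qed.

Lemma locally_neq (w z : C) : w <> z -> locally w (fun v => v <> z).
Proof.
  intros H. apply locally_Cmod. exists (Cmod (w - z)).
  assert (Hz : w - z <> 0).
  { intros E. apply H. replace w with ((w - z) + z) by ring. rewrite E. ring. }
  split; [now apply Cmod_gt_0 |]. intros v Hv ->. rewrite Cmod_minus_sym in Hv. lra.
Qed.

Lemma minus_neq_0 (w z : C) : w <> z -> w - z <> 0.
Proof.
  intros H E. apply H. replace w with ((w - z) + z) by ring. rewrite E. ring.
Qed.

(** The quotient [(phi w - phi z) / (w - z)], completed by [l] at [z], is continuous at the pole,
    and only the circle of radius [s0] can meet that pole. Hence [circle_integral_invariance]
    applies with [s0] as the exceptional radius. *)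
Lemma circle_cauchy (p q : C) (a b s0 : R) (phi phi1 : C -> C) (z l : C) :
  (a <= b)%R ->
  (forall s t, (a <= s <= b)%R ->
     filterlim phi (within (swept p q a b) (locally (circ p q s t))) (locally (phi (circ p q s t)))) ->
  (forall s t, (a < s < b)%R -> expi t <> q -> cderiv phi (circ p q s t) (phi1 (circ p q s t))) ->
  (forall s t, (a < s < b)%R ->
     filterlim phi1 (within (swept p q a b) (locally (circ p q s t))) (locally (phi1 (circ p q s t)))) ->
  cderiv phi z l ->
  (forall s t, (a < s < b)%R -> circ p q s t = z -> s = s0) ->
  (forall t, circ p q a t <> z) -> (forall t, circ p q b t <> z) ->
  Cint (fun t => (phi (circ p q a t) - phi z) / (circ p q a t - z) * (RtoC a * expi t)) =
  Cint (fun t => (phi (circ p q b t) - phi z) / (circ p q b t - z) * (RtoC b * expi t)).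
Proof.
  intros Hab Hc Hd Hc1 Hz Hs0 Ha Hb.
  set (F := fun w : C => if Ceq_dec w z then l else (phi w - phi z) / (w - z)).
  set (F1 := fun w : C => phi1 w / (w - z) - (phi w - phi z) / ((w - z) * (w - z))).
  assert (HF : forall w, w <> z -> F w = (phi w - phi z) / (w - z)).
  { intros w Hw. unfold F. now destruct (Ceq_dec w z). }
  rewrite (Cint_ext _ (fun t => F (circ p q a t) * (RtoC a * expi t)))
    by (intros t; now rewrite HF).
  rewrite (Cint_ext (fun t => _ / (circ p q b t - z) * _) (fun t => F (circ p q b t) * (RtoC b * expi t)))
    by (intros t; now rewrite HF).
  assert (Lid : forall (K : C -> Prop) (w : C), filterlim (fun v : C => v - z) (within K (locally w)) (locally (w - z))).
  { intros K w. apply filterlim_within_weaken.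
    apply filterlim_Cminus; [apply filterlim_id | apply filterlim_const]. }
  assert (LF : forall (K : C -> Prop) (w : C), w <> z ->
    filterlim phi (within K (locally w)) (locally (phi w)) ->
    filterlim F (within K (locally w)) (locally (F w))).
  { intros K w Hw Hphi. rewrite HF by exact Hw.
    apply filterlim_ext_loc with (fun v => (phi v - phi z) / (v - z)).
    - apply (filter_le_within (F := locally w) K). generalize (locally_neq w z Hw).
      apply filter_imp. intros v Hv. symmetry. now apply HF.
    - apply filterlim_Cdiv; [now apply minus_neq_0 | | apply Lid].
      apply filterlim_Cminus; [exact Hphi | apply filterlim_const]. }
  apply (circle_integral_invariance p q a b s0 F F1 Hab).
  - intros s t Hs. destruct (Ceq_dec (circ p q s t) z) as [E | E].
    + rewrite E. apply filterlim_within_weaken.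
      destruct Hz as [psi [Hpz [Hpl Hpe]]].
      unfold F at 2. destruct (Ceq_dec z z) as [_ | n]; [| now contradiction n].
      apply filterlim_ext_loc with psi; [| exact Hpl].
      revert Hpe. apply filter_imp. intros v Hv. unfold F.
      destruct (Ceq_dec v z) as [-> | Hn]; [exact Hpz |].
      rewrite Hv. field. now apply minus_neq_0.
    + apply LF; [exact E |]. now apply Hc.
  - intros s t Hs Hn Hq.
    assert (E : circ p q s t <> z) by (intros E; now apply Hn, (Hs0 s t Hs)).
    set (w := circ p q s t) in *.
    assert (Hwz := minus_neq_0 _ _ E).
    apply (has_deriv_ext_loc _ (fun v : C => (phi v - phi z) * / (v - z))).
    { generalize (locally_neq w z E). apply filter_imp. intros v Hv. symmetry. now apply HF. }
    apply (has_deriv_eq _ _ _ ((phi1 w + - 0) * / (w - z) + (phi w - phi z) * (- (1 + - 0) / ((w - z) * (w - z))))).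
    { unfold F1. field. exact Hwz. }
    assert (Dc : forall c : C, cderiv (fun _ => - c) w (- 0)).
    { intros c. apply (has_deriv_eq _ _ _ 0); [ring | apply has_deriv_const]. }
    apply (has_deriv_mult (fun v : C => v) id_C_cont (fun v => phi v - phi z) (fun v => / (v - z))).
    + apply has_deriv_plus; [now apply Hd | apply Dc].
    + apply (has_deriv_inv (fun v : C => v) id_C_cont (fun v => v - z)); [exact Hwz |].
      apply has_deriv_plus; [apply has_deriv_id | apply Dc].
  - intros s t Hs Hn.
    assert (E : circ p q s t <> z) by (intros E; now apply Hn, (Hs0 s t Hs)).
    assert (Hwz := minus_neq_0 _ _ E).
    apply filterlim_Cminus; apply filterlim_Cdiv; auto.
    + now apply Cmult_neq_0.
    + apply filterlim_Cminus; [| apply filterlim_const]. apply Hc. lra.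
    + now apply filterlim_Cmult.
Qed.

Lemma circ_0 (s t : R) : circ 0 0 s t = RtoC s * expi t.
Proof. unfold circ. ring. Qed.

Lemma expi_neg_neq (t : R) (w : C) : (Cmod w < 1)%R -> 1 - expi (- t) * w <> 0.
Proof. intros Hw. apply one_minus_neq_0; [rewrite Cmod_expi; lra | exact Hw]. Qed.

Lemma cts_expi_opp : rcts (fun t => expi (- t)).
Proof.
  intros t. apply filterlim_ext with (fun t => expi (-1 * t)); [intros u; f_equal; ring |].
  replace (- t)%R with (-1 * t)%R by ring. exact (cts_expi_scal (-1) t).
Qed.

Lemma Cint_kernel_opp (w : C) :
  (Cmod w < 1)%R -> Cint (fun t => 1 / (1 - expi (- t) * w)) = RtoC (2 * PI).
Proof.
  intros Hw. rewrite <- (Cint_kernel (-1) w) by (easy || lia).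
  apply Cint_ext. intros t. do 4 f_equal. ring.
Qed.

Lemma Cint_kernel_id (w : C) :
  (Cmod w < 1)%R -> Cint (fun t => 1 / (1 - expi t * w)) = RtoC (2 * PI).
Proof.
  intros Hw. rewrite <- (Cint_kernel 1 w) by (easy || lia).
  apply Cint_ext. intros t. do 4 f_equal. ring.
Qed.

Lemma rcts_on_circle (K : C -> Prop) (G : C -> C) (gam : R -> C) :
  rcts gam -> (forall t, K (gam t)) ->
  (forall t, filterlim G (within K (locally (gam t))) (locally (G (gam t)))) ->
  rcts (fun t => G (gam t)).
Proof.
  intros Hg HK HG t.
  apply (filterlim_comp _ _ _ gam G) with (2 := HG t).
  intros P HP. generalize (Hg t _ HP). unfold filtermap. apply filter_imp.
  intros u Hu. now apply Hu.
Qed.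

(** The origin may be singular: the circles of radius [0] contribute nothing
    to the integral. *)
Lemma cauchy_disc (G G1 : C -> C) (w : C) :
  (forall v, (Cmod v <= 1)%R ->
     filterlim G (within (fun v => (Cmod v <= 1)%R) (locally v)) (locally (G v))) ->
  (forall v, (0 < Cmod v < 1)%R -> cderiv G v (G1 v)) ->
  (forall v, (0 < Cmod v < 1)%R -> filterlim G1 (locally v) (locally (G1 v))) ->
  (0 < Cmod w < 1)%R ->
  RtoC (2 * PI) * G w = Cint (fun t => G (expi t) / (1 - expi (- t) * w)).
Proof.
  intros Hc Hd Hc1 Hw.
  assert (Hmod : forall s t, (0 <= s)%R -> Cmod (circ 0 0 s t) = s).
  { intros s t Hs. rewrite circ_0, Cmod_mult, Cmod_expi, Cmod_R, Rabs_pos_eq; lra. }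
  assert (Hsw : forall v, swept 0 0 0 1 v -> (Cmod v <= 1)%R).
  { intros v [s [t [Hs ->]]]. rewrite Hmod; lra. }
  assert (HE : forall t, circ 0 0 1 t = expi t) by (intros t; rewrite circ_0; ring).
  assert (HG : rcts (fun t => G (expi t))).
  { apply (rcts_on_circle (fun v => (Cmod v <= 1)%R)); [exact cts_expi | |].
    - intros t. rewrite Cmod_expi. lra.
    - intros t. apply Hc. rewrite Cmod_expi. lra. }
  assert (Hden : rcts (fun t => 1 - expi (- t) * w)).
  { apply cts_minus; [apply cts_const |].
    apply cts_mult; [apply cts_expi_opp | apply cts_const]. }
  assert (Hnz : forall t, 1 - expi (- t) * w <> 0) by (intros t; apply expi_neg_neq; lra).
  assert (H : Cint (fun t => (G (circ 0 0 0 t) - G w) / (circ 0 0 0 t - w) * (RtoC 0 * expi t)) =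
    Cint (fun t => (G (circ 0 0 1 t) - G w) / (circ 0 0 1 t - w) * (RtoC 1 * expi t))).
  { apply (circle_cauchy 0 0 0 1 (Cmod w) G G1 w (G1 w)).
    - lra.
    - intros s t Hs. apply (filterlim_within_subset _ _ _ _ _ Hsw). apply Hc. rewrite Hmod; lra.
    - intros s t Hs _. apply Hd. rewrite Hmod; lra.
    - intros s t Hs. apply filterlim_within_weaken, Hc1. rewrite Hmod; lra.
    - now apply Hd.
    - intros s t Hs <-. rewrite Hmod; lra.
    (* The circle of radius [0] is the origin itself; it avoids [w] because [w] is nonzero. *)
    - intros t E. rewrite <- E, Hmod in Hw; lra.
    - intros t E. rewrite <- E, Hmod in Hw; lra. }
  rewrite (Cint_ext _ (fun _ => 0)) in H by (intros; ring).
  rewrite Cint_const, Cmult_0_r in H.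
  (* On the unit circle [zeta / (zeta - w) = 1 / (1 - w / zeta)] and [/ zeta = expi (- t)], so the
     integrand splits into the Cauchy kernel and a multiple of a kernel with integral [2 PI]. *)
  rewrite (Cint_ext _ (fun t => G (expi t) / (1 - expi (- t) * w) - G w * (1 / (1 - expi (- t) * w)))) in H.
  2: { intros t. rewrite HE. rewrite expi_opp. field.
       assert (Ht := Hnz t). rewrite expi_opp in Ht.
       split; [apply expi_neq_0 |]. intros E. apply Ht.
       replace (1 - / expi t * w) with (/ expi t * (expi t - w)) by (field; apply expi_neq_0).
       rewrite E. ring. }
  rewrite Cint_minus, Cint_scal, Cint_kernel_opp in H.
  - set (J := Cint _) in *. replace J with ((J - G w * RtoC (2 * PI)) + G w * RtoC (2 * PI)) by ring.
    rewrite <- H. ring.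
  - lra.
  - now apply cts_div; [| apply cts_const |].
  - now apply cts_div.
  - apply cts_mult; [apply cts_const |]. now apply cts_div; [| apply cts_const |].
Qed.

(** * Functions smooth up to the boundary *)

Lemma cderiv_unique (f : C -> C) (z a b : C) : cderiv f z a -> cderiv f z b -> a = b.
Proof.
  intros Ha Hb. apply is_derive_cderiv in Ha. apply is_derive_cderiv in Hb.
  rewrite <- (is_C_derive_unique f z a Ha). now apply is_C_derive_unique.
Qed.

Lemma cderiv_affine (k a z : C) : cderiv (fun x => k * (x - a)) z k.
Proof.
  apply (has_deriv_eq _ _ _ (0 * (z - a) + k * (1 + 0))); [ring |].
  apply (has_deriv_mult (fun v : C => v) id_C_cont (fun _ => k) (fun x => x - a)).
  - apply has_deriv_const.
  - apply has_deriv_plus; [apply has_deriv_id | apply has_deriv_const].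
Qed.

Lemma cderiv_affine' (a k z : C) : cderiv (fun x => a + k * x) z k.
Proof.
  apply (has_deriv_eq _ _ _ (0 + (0 * z + k * 1))); [ring |].
  apply has_deriv_plus; [apply has_deriv_const |].
  apply (has_deriv_mult (fun v : C => v) id_C_cont (fun _ => k) (fun x => x));
    [apply has_deriv_const | apply has_deriv_id].
Qed.

Lemma cderiv_scal (k : C) (f : C -> C) (z l : C) :
  cderiv f z l -> cderiv (fun x => k * f x) z (k * l).
Proof.
  intros H. apply (has_deriv_eq _ _ _ (0 * f z + k * l)); [ring |].
  apply (has_deriv_mult (fun v : C => v) id_C_cont (fun _ => k) f);
    [apply has_deriv_const | exact H].
Qed.

(** Expand around [z - rho/2], so that [z] stays away from the centre, where
    [cauchy_disc] says nothing. *)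
Lemma local_power_series (phi phi1 : C -> C) (z : C) (d : R) :
  (0 < d)%R ->
  (forall x, (Cmod (x - z) < d)%R -> cderiv phi x (phi1 x)) ->
  (forall x, (Cmod (x - z) < d)%R -> filterlim phi1 (locally x) (locally (phi1 x))) ->
  exists b k kap a, rapid b /\
    locally z (fun x => phi x = k * PS b (kap * (x - a)) /\ (Cmod (kap * (x - a)) < 1)%R).
Proof.
  intros Hd H1 H2.
  set (rho := (d / 2)%R). assert (Hrho : (0 < rho)%R) by (unfold rho; lra).
  assert (HrC : RtoC rho <> 0) by (intros E; injection E; lra).
  set (a := z - RtoC rho * RtoC (/ 2)).
  set (H := fun w => phi (a + RtoC rho * w)).
  assert (Hin : forall w, (Cmod w <= 1)%R -> (Cmod (a + RtoC rho * w - z) < d)%R).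
  { intros w Hw. unfold a.
    replace (z - RtoC rho * RtoC (/ 2) + RtoC rho * w - z) with (RtoC rho * (w + - RtoC (/ 2))) by ring.
    rewrite Cmod_mult, Cmod_R, Rabs_pos_eq by lra.
    pose proof (Cmod_triangle w (- RtoC (/ 2))) as HT.
    rewrite Cmod_opp, Cmod_R, Rabs_pos_eq in HT by lra.
    unfold rho in *. nra. }
  assert (HdH : forall w, (Cmod w <= 1)%R -> cderiv H w (phi1 (a + RtoC rho * w) * RtoC rho)).
  { intros w Hw. apply (has_deriv_comp (fun v : C => v) id_C_cont phi (fun w => a + RtoC rho * w)).
    - apply H1. now apply Hin.
    - apply cderiv_affine'. }
  assert (HcH : forall w, (Cmod w <= 1)%R -> filterlim H (locally w) (locally (H w))).
  { intros w Hw. exact (has_deriv_cont _ id_C_cont _ _ _ (HdH w Hw)). }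
  assert (HE : rcts (fun t => H (expi t))).
  { intros t. apply (filterlim_comp _ _ _ expi H) with (1 := cts_expi t).
    apply HcH. rewrite Cmod_expi. lra. }
  set (al := fun n => Cint (fun t => H (expi t) * expi (- t) ^ n)).
  (* The coefficients [al] are only bounded. Using the series for [Cmod w < 3 / 4] alone and
     rescaling the variable by [4 / 3] makes them decay geometrically. *)
  set (b := fun n => RtoC ((3 / 4) ^ n) * al n).
  assert (Hb : rapid b).
  { destruct (rcts_bounded _ 0 (2 * PI) HE) as [M HM].
    apply (rapid_geometric al (4 * PI * M) (3 / 4)); [lra |].
    intros n. apply Cint_bound.
    - apply cts_mult; [exact HE | apply cts_pow, cts_expi_opp].
    - intros t Ht. rewrite Cmod_mult, Cmod_pow, Cmod_expi, pow1, Rmult_1_r. now apply HM. }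
  assert (HPI : RtoC (2 * PI) <> 0).
  { intros E. injection E. pose proof PI_RGT_0. lra. }
  assert (Hser : forall w, (0 < Cmod w < 3 / 4)%R -> RtoC (2 * PI) * H w = PS b (RtoC (4 / 3) * w)).
  { intros w Hw. rewrite (cauchy_disc H (fun w => phi1 (a + RtoC rho * w) * RtoC rho) w).
    - assert (HS := Cint_geometric (fun t => H (expi t)) (fun t => expi (- t)) w HE cts_expi_opp
        (fun t => Req_le _ _ (Cmod_expi _)) ltac:(lra)).
      rewrite <- (Cseries_unique _ _ HS). symmetry. apply Cseries_unique.
      apply (is_Cseries_ext (fun n => al n * w ^ n)).
      + intros n. unfold b. rewrite Cpow_mult_l, <- !RtoC_pow.
        replace (RtoC ((3 / 4) ^ n) * al n * (RtoC ((4 / 3) ^ n) * w ^ n))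
          with (RtoC ((3 / 4) ^ n) * RtoC ((4 / 3) ^ n) * (al n * w ^ n)) by ring.
        rewrite <- RtoC_mult, <- Rpow_mult_distr.
        replace (3 / 4 * (4 / 3))%R with 1%R by field. rewrite pow1. ring.
      + rewrite (Cseries_unique _ _ HS). exact HS.
    - intros v Hv. apply filterlim_within_weaken. now apply HcH.
    - intros v Hv. apply HdH. lra.
    - intros v Hv. apply filterlim_Cmult; [| apply filterlim_const].
      apply (filterlim_comp _ _ _ (fun v => a + RtoC rho * v) phi1) with (locally (a + RtoC rho * v)).
      + exact (has_deriv_cont _ id_C_cont _ _ _ (cderiv_affine' a (RtoC rho) v)).
      + apply H2, Hin. lra.
    - lra. }
  exists b, (/ RtoC (2 * PI)), (RtoC (4 / (3 * rho))), a. split; [exact Hb |].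
  (* The point [z] has coordinate [w = 1 / 2]; moving by less than [rho / 4] keeps [Cmod w] strictly
     between [1 / 4] and [3 / 4]. *)
  apply locally_Cmod. exists (rho / 4)%R. split; [lra |]. intros x Hx.
  set (w := (x - a) / RtoC rho).
  assert (Ew : RtoC (4 / (3 * rho)) * (x - a) = RtoC (4 / 3) * w).
  { unfold w. replace (4 / (3 * rho))%R with (4 / 3 * / rho)%R by (field; lra).
    rewrite RtoC_mult, RtoC_inv by lra. field. exact HrC. }
  assert (Hw2 : (Cmod (w - RtoC (/ 2)) < 1 / 4)%R).
  { replace (w - RtoC (/ 2)) with ((x - z) / RtoC rho) by (unfold w, a; field; exact HrC).
    rewrite Cmod_div, Cmod_R, Rabs_pos_eq by (auto; lra).
    apply Rmult_lt_reg_r with rho; [lra |]. unfold Rdiv at 1.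
    rewrite Rmult_assoc, Rinv_l by lra. lra. }
  assert (Hw : (0 < Cmod w < 3 / 4)%R).
  { pose proof (Cmod_triangle (w - RtoC (/ 2)) (RtoC (/ 2))) as T1.
    replace (w - RtoC (/ 2) + RtoC (/ 2)) with w in T1 by ring.
    pose proof (Cmod_triangle w (- (w - RtoC (/ 2)))) as T2.
    replace (w + - (w - RtoC (/ 2))) with (RtoC (/ 2)) in T2 by ring.
    rewrite Cmod_opp in T2. rewrite Cmod_R, Rabs_pos_eq in T1, T2 by lra. lra. }
  rewrite Ew, <- Hser by exact Hw. split.
  - unfold H, w. replace (a + RtoC rho * ((x - a) / RtoC rho)) with x by (field; exact HrC).
    field. exact HPI.
  - rewrite Cmod_mult, Cmod_R, Rabs_pos_eq; lra.
Qed.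

(** Near [z] the function [phi] is a rescaled power series, so [phi1] is its derived series by
    uniqueness of derivatives, and that series is differentiable again. *)
Lemma cderiv_of_deriv (G : C -> Prop) (phi phi1 : C -> C) (z : C) :
  locally z G ->
  (forall x, G x -> cderiv phi x (phi1 x)) ->
  (forall x, G x -> filterlim phi1 (locally x) (locally (phi1 x))) ->
  exists l, cderiv phi1 z l.
Proof.
  intros HG H1 H2. apply locally_Cmod in HG. destruct HG as [d [Hd HG]].
  destruct (local_power_series phi phi1 z d Hd) as [b [k [kap [a [Hb Hl]]]]]; auto.
  (* To differentiate the representation at a nearby [x], it must hold on a neighbourhood of [x],
     not only at [x]. *)
  assert (Hd2 : locally z (fun x => G x /\ locally x (fun x => phi x = k * PS b (kap * (x - a)) /\ (Cmod (kap * (x - a)) < 1)%R))).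
  { apply filter_and; [| now apply locally_locally].
    apply locally_Cmod. now exists d. }
  exists (k * (PS (dPS (dPS b)) (kap * (z - a)) * kap * kap)).
  apply (has_deriv_ext_loc _ (fun x => k * (PS (dPS b) (kap * (x - a)) * kap))).
  - revert Hd2. apply filter_imp. intros x [HGx Hx].
    apply (cderiv_unique phi x); [| now apply H1].
    apply (has_deriv_ext_loc _ (fun x => k * PS b (kap * (x - a)))).
    { revert Hx. apply filter_imp. intros y [Hy _]. now symmetry. }
    apply cderiv_scal. apply (has_deriv_comp _ id_C_cont (PS b) (fun x => kap * (x - a))).
    + apply PS_deriv; [exact Hb |]. exact (proj2 (locally_singleton _ _ Hx)).
    + apply cderiv_affine.
  - apply cderiv_scal.
    apply (has_deriv_eq _ _ _ (PS (dPS (dPS b)) (kap * (z - a)) * kap * kap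
             + PS (dPS b) (kap * (z - a)) * 0)); [ring |].
    apply (has_deriv_mult (fun v : C => v) id_C_cont (fun x => PS (dPS b) (kap * (x - a))) (fun _ => kap));
      [| apply has_deriv_const].
    apply (has_deriv_comp _ id_C_cont (PS (dPS b)) (fun x => kap * (x - a))).
    + apply PS_deriv; [now apply rapid_dPS |]. exact (proj2 (locally_singleton _ _ Hl)).
    + apply cderiv_affine.
Qed.

(** [F1] is the derivative on [G] and at the same time carries boundary values on [K]. Such pairs
    are the input of the Cauchy formulas. *)
Definition C1_up_to (G K : C -> Prop) (F F1 : C -> C) : Prop :=
  (forall z, K z -> filterlim F (within K (locally z)) (locally (F z))) /\
  (forall z, G z -> cderiv F z (F1 z)) /\
  (forall z, K z -> filterlim F1 (within K (locally z)) (locally (F1 z))).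

Lemma C1_up_to_subset (G K G' K' : C -> Prop) (F F1 : C -> C) :
  (forall z, G' z -> G z) -> (forall z, K' z -> K z) ->
  C1_up_to G K F F1 -> C1_up_to G' K' F F1.
Proof.
  intros HG HK [H1 [H2 H3]]. split; [| split].
  - intros z Hz. apply (filterlim_within_subset K K' _ _ _ HK). auto.
  - auto.
  - intros z Hz. apply (filterlim_within_subset K K' _ _ _ HK). auto.
Qed.

Lemma C1_up_to_minus (G K : C -> Prop) (F F1 H H1 : C -> C) :
  C1_up_to G K F F1 -> C1_up_to G K H H1 ->
  C1_up_to G K (fun z => F z - H z) (fun z => F1 z - H1 z).
Proof.
  intros [A1 [A2 A3]] [B1 [B2 B3]]. split; [| split].
  - intros z Hz. apply filterlim_Cminus; auto.
  - intros z Hz. apply (has_deriv_ext_loc _ (fun z => F z + (- (1)) * H z)).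
    { apply filter_forall. intros y. ring. }
    apply (has_deriv_eq _ _ _ (F1 z + (- (1)) * H1 z)); [ring |].
    apply has_deriv_plus; [now apply A2 | now apply cderiv_scal, B2].
  - intros z Hz. apply filterlim_Cminus; auto.
Qed.

Lemma filterlim_within_interior (K : C -> Prop) (f : C -> C) (z l : C) :
  locally z K -> filterlim f (within K (locally z)) (locally l) ->
  filterlim f (locally z) (locally l).
Proof.
  intros HK H P HP. generalize (filter_and _ _ HK (H P HP)). unfold filtermap.
  apply filter_imp. intros x [H1 H2]. now apply H2.
Qed.

(** Choice picks one extension for each order. On [G] they agree with the [C_derive_n l f], which
    are therefore continuous; by induction [cderiv_of_deriv] makes each of them differentiable, so
    consecutive extensions are linked by differentiation. *)
Lemma smooth_extension (G K : C -> Prop) (f : C -> C) :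
  (forall z, G z -> locally z G) -> (forall z, G z -> K z) ->
  holomorphic_on G f ->
  (forall l, extends_continuously G K (C_derive_n l f)) ->
  exists F : nat -> C -> C,
    (forall l, C1_up_to G K (F l) (F (S l))) /\ (forall z, G z -> F 0%nat z = f z).
Proof.
  intros HG HGK Hf He.
  set (F := fun l => proj1_sig (constructive_indefinite_description _ (He l))).
  assert (HF : forall l, (forall z, G z -> F l z = C_derive_n l f z) /\
     (forall z, K z -> filterlim (F l) (within K (locally z)) (locally (F l z)))).
  { intros l. exact (proj2_sig (constructive_indefinite_description _ (He l))). }
  assert (Hcont : forall l z, G z -> filterlim (C_derive_n l f) (locally z) (locally (C_derive_n l f z))).
  { intros l z Hz. destruct (HF l) as [E Hc]. rewrite <- (E z Hz).
    apply filterlim_ext_loc with (F l).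
    - generalize (HG z Hz). apply filter_imp. exact E.
    - apply (filterlim_within_interior K); [| now apply Hc, HGK].
      generalize (HG z Hz). apply filter_imp. exact HGK. }
  assert (Hder : forall l z, G z -> cderiv (C_derive_n l f) z (C_derive_n (S l) f z)).
  { assert (Hex : forall g z, ex_derive (K := C_AbsRing) (V := C_NormedModule) g z -> cderiv g z (C_derive g z)).
    { intros g z Hg. apply is_derive_cderiv. now apply C_derive_correct. }
    intros l. induction l as [| l IH]; intros z Hz.
    - apply Hex, Hf, Hz.
    - destruct (cderiv_of_deriv G (C_derive_n l f) (C_derive_n (S l) f) z (HG z Hz) IH (Hcont (S l))) as [v Hv].
      apply Hex. exists v. now apply is_derive_cderiv. }
  exists F. split; [| apply (HF 0%nat)].
  intros l. split; [apply HF |]. split; [| apply HF].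
  intros z Hz. rewrite (proj1 (HF (S l)) z Hz).
  apply (has_deriv_ext_loc _ (C_derive_n l f)); [| now apply Hder].
  generalize (HG z Hz). apply filter_imp. intros y Hy. symmetry. now apply HF.
Qed.

(** Uniqueness of derivatives, used inductively on the open set [G], identifies the candidates [F l]
    with the iterated [C_derive]. *)
Lemma smooth_extension_intro (G K : C -> Prop) (f : C -> C) (F : nat -> C -> C) :
  (forall z, G z -> locally z G) ->
  (forall l z, K z -> filterlim (F l) (within K (locally z)) (locally (F l z))) ->
  (forall l z, G z -> cderiv (F l) z (F (S l) z)) ->
  (forall z, G z -> F 0%nat z = f z) ->
  holomorphic_on G f /\ (forall l, extends_continuously G K (C_derive_n l f)).
Proof.
  intros HG HK Hd H0.
  assert (E : forall l z, G z -> F l z = C_derive_n l f z).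
  { intros l. induction l as [| l IH]; intros z Hz; [now apply H0 |].
    symmetry. apply is_C_derive_unique, is_derive_cderiv.
    apply (has_deriv_ext_loc _ (F l)); [| now apply Hd].
    generalize (HG z Hz). apply filter_imp. exact IH. }
  split.
  - intros z Hz. exists (F 1%nat z). apply is_derive_cderiv.
    apply (has_deriv_ext_loc _ (F 0%nat)); [| now apply Hd].
    generalize (HG z Hz). apply filter_imp. exact H0.
  - intros l. exists (F l). split; [apply E | apply HK].
Qed.

(** * The crescent *)

Lemma closure_disc (c : C) (r : R) (z : C) :
  (0 < r)%R -> (closure (disc c r) z <-> (Cmod (z - c) <= r)%R).
Proof.
  intros Hr. split.
  - intros H. apply Rnot_lt_le. intros Hlt.
    destruct (H (fun w => (Cmod (w - z) < Cmod (z - c) - r)%R)) as [w [H1 H2]].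
    + apply locally_Cmod. exists (Cmod (z - c) - r)%R. split; [lra | auto].
    + unfold disc in H2. pose proof (Cmod_triangle (z - w) (w - c)) as T.
      replace (z - w + (w - c)) with (z - c) in T by ring.
      rewrite (Cmod_minus_sym z w) in T. lra.
  - intros H U HU. apply locally_Cmod in HU. destruct HU as [d [Hd HU]].
    (* Pulling [z] towards the centre by the factor [1 - e] moves it by at most [e * r <= d / 2]. *)
    set (e := Rmin (1 / 2) (d / (2 * r))).
    assert (He0 : (0 < e)%R) by (apply Rmin_glb_lt; [lra | apply Rdiv_lt_0_compat; lra]).
    assert (He1 : (e <= 1 / 2)%R) by apply Rmin_l.
    assert (He2 : (e * r <= d / 2)%R).
    { replace (d / 2)%R with (d / (2 * r) * r)%R by (field; lra).
      apply Rmult_le_compat_r; [lra | apply Rmin_r]. }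
    pose proof (Cmod_ge_0 (z - c)).
    exists (c + RtoC (1 - e) * (z - c)). split.
    + apply HU. replace (c + RtoC (1 - e) * (z - c) - z) with (- (RtoC e * (z - c)))
        by (rewrite RtoC_minus; ring).
      rewrite Cmod_opp, Cmod_mult, Cmod_R, Rabs_pos_eq by lra. nra.
    + unfold disc. replace (c + RtoC (1 - e) * (z - c) - c) with (RtoC (1 - e) * (z - c)) by ring.
      rewrite Cmod_mult, Cmod_R, Rabs_pos_eq by lra. nra.
Qed.

Lemma disc_exterior_iff (c : C) (r : R) (z : C) :
  (0 < r)%R -> (disc_exterior c r z <-> (r < Cmod (z - c))%R).
Proof.
  intros Hr. unfold disc_exterior. rewrite closure_disc by exact Hr.
  split; [apply Rnot_le_lt | lra].
Qed.

Lemma unit_disc_iff (z : C) : unit_disc z <-> (Cmod z < 1)%R.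
Proof. unfold unit_disc, disc. now replace (z - 0) with z by ring. Qed.

Lemma open_unit_disc (z : C) : (Cmod z < 1)%R -> locally z (fun w => (Cmod w < 1)%R).
Proof.
  intros H. apply locally_Cmod. exists (1 - Cmod z)%R. split; [lra |].
  intros w Hw. pose proof (Cmod_triangle (w - z) z) as T.
  replace (w - z + z) with w in T by ring. lra.
Qed.

Lemma open_exterior (c : C) (r : R) (z : C) :
  (r < Cmod (z - c))%R -> locally z (fun w => (r < Cmod (w - c))%R).
Proof.
  intros H. apply locally_Cmod. exists (Cmod (z - c) - r)%R. split; [lra |].
  intros w Hw. pose proof (Cmod_triangle (z - w) (w - c)) as T.
  replace (z - w + (w - c)) with (z - c) in T by ring.
  rewrite (Cmod_minus_sym z w) in T. lra.
Qed.

(** Inclusion of the discs gives [Cmod c + r <= 1], while the common point [1] gives the reverse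
    inequality. Then [Cmod c = 1 - r] and [Cmod (1 - c) = r], and these two circles of centres [0]
    and [1] touch only at [1 - r]. *)
Lemma tangent_center (c : C) (r : R) :
  (0 < r)%R -> internally_tangent_unit c r (RtoC 1) -> c = RtoC (1 - r) /\ (r < 1)%R.
Proof.
  intros Hr [Hsub Htan].
  destruct (proj2 (Htan (RtoC 1)) eq_refl) as [H1 _]. unfold circle in H1.
  (* For [c = 0] the two circles would coincide, and [-1] would be a second common point. *)
  assert (Hc0 : c <> 0).
  { intros ->. assert (Hr1 : r = 1%R).
    { rewrite <- H1. replace (1 - 0) with (RtoC 1) by ring. apply Cmod_1. }
    assert (E : RtoC (-1) = RtoC 1).
    { apply Htan. unfold unit_circle, circle.
      replace (RtoC (-1) - 0) with (RtoC (-1)) by ring.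
      rewrite Cmod_R, Rabs_left by lra. lra. }
    injection E. lra. }
  assert (Hcm : (0 < Cmod c)%R) by now apply Cmod_gt_0.
  assert (Hle : (Cmod c + r <= 1)%R).
  { apply Rnot_lt_le. intros Hlt.
    (* If [Cmod c + r > 1], the point at distance [rho < r] beyond [c] on the ray from the origin
       lies in the inner disc but has modulus [Cmod c + rho >= 1]. *)
    set (rho := Rmax (1 - Cmod c) 0).
    assert (Hrho : (0 <= rho < r)%R) by (split; [apply Rmax_r | apply Rmax_lub_lt; lra]).
    assert (Hrho1 : (1 - Cmod c <= rho)%R) by apply Rmax_l.
    assert (Hm : RtoC (Cmod c) <> 0) by (intros E; injection E; lra).
    assert (HD : unit_disc (c + RtoC (rho / Cmod c) * c)).
    { apply Hsub. unfold disc.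
      replace (c + RtoC (rho / Cmod c) * c - c) with (RtoC (rho / Cmod c) * c) by ring.
      rewrite Cmod_mult, Cmod_R, Rabs_pos_eq by (apply Rmult_le_pos; [lra | apply Rlt_le, Rinv_0_lt_compat; lra]).
      replace (rho / Cmod c * Cmod c)%R with rho by (field; lra). lra. }
    apply (proj1 (unit_disc_iff _)) in HD.
    assert (0 <= rho / Cmod c)%R by (apply Rmult_le_pos; [lra | apply Rlt_le, Rinv_0_lt_compat; lra]).
    assert (E : Cmod (c + RtoC (rho / Cmod c) * c) = (Cmod c + rho)%R).
    { replace (c + RtoC (rho / Cmod c) * c) with (RtoC (1 + rho / Cmod c) * c)
        by (rewrite RtoC_plus; ring).
      rewrite Cmod_mult, Cmod_R, Rabs_pos_eq by lra. field. lra. }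
    lra. }
  assert (Hge : (1 <= Cmod c + r)%R).
  { pose proof (Cmod_triangle c (1 - c)) as T.
    replace (c + (1 - c)) with (RtoC 1) in T by ring. rewrite Cmod_1, H1 in T. exact T. }
  assert (Hc : Cmod c = (1 - r)%R) by lra.
  assert (E1 := Cmod2_alt c). assert (E2 := Cmod2_alt (1 - c)).
  rewrite Hc in E1. rewrite H1 in E2.
  change (Re (1 - c)) with (1 - Re c)%R in E2. change (Im (1 - c)) with (0 - Im c)%R in E2.
  assert (Hre : Re c = (1 - r)%R) by nra.
  assert (Him : Im c = 0%R) by (rewrite Hre in E1; nra).
  split; [| lra]. apply injective_projections; [exact Hre | exact Him].
Qed.

Notation tcirc := (circ 1 1).

(** The factored form shows the position relative to the circle of radius [r] through the sign of
    [s - r], with equality at the cusp. For [r = 1] it measures the distance to the origin. *)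
Lemma Cmod2_tcirc (r s t : R) :
  (Cmod (tcirc s t - RtoC (1 - r)) ^ 2 = r ^ 2 + 2 * s * (s - r) * (1 - cos t))%R.
Proof.
  rewrite Cmod2_alt. unfold circ, expi, Re, Im; cbn [fst snd Cplus Cmult Cminus Copp RtoC].
  pose proof (sin2_cos2 t) as H. unfold Rsqr in H.
  transitivity ((r - s + s * cos t) ^ 2 + s * s * (sin t * sin t))%R; [ring |].
  replace (sin t * sin t)%R with (1 - cos t * cos t)%R by lra. ring.
Qed.

Lemma Cmod2_tcirc_0 (s t : R) :
  (Cmod (tcirc s t) ^ 2 = 1 - 2 * s * (1 - s) * (1 - cos t))%R.
Proof.
  replace (tcirc s t) with (tcirc s t - RtoC (1 - 1)) by (rewrite Rminus_diag; ring).
  rewrite Cmod2_tcirc. ring.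
Qed.

Lemma one_minus_cos_pos (t : R) : expi t <> 1 -> (0 < 1 - cos t)%R.
Proof.
  intros H. pose proof (COS_bound t) as [_ Hb]. destruct Hb as [Hb | Hb]; [lra |].
  exfalso. apply H. apply injective_projections; [exact Hb | cbn].
  pose proof (sin2_cos2 t) as Hs. rewrite Hb, Rsqr_1 in Hs.
  apply Rsqr_0_uniq. lra.
Qed.

Lemma swept_bounds (r : R) (z : C) :
  (0 < r < 1)%R -> swept 1 1 r 1 z -> (Cmod z <= 1 /\ r <= Cmod (z - RtoC (1 - r)))%R.
Proof.
  intros Hr [s [t [Hs ->]]]. pose proof (COS_bound t).
  pose proof (Cmod2_tcirc r s t) as E1. pose proof (Cmod2_tcirc_0 s t) as E2.
  pose proof (Cmod_ge_0 (tcirc s t)). pose proof (Cmod_ge_0 (tcirc s t - RtoC (1 - r))).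
  split; apply Rnot_lt_le; intros Hlt.
  - assert (0 <= s * (1 - s) * (1 - cos t))%R by (apply Rmult_le_pos; [apply Rmult_le_pos |]; lra).
    assert (1 * 1 < Cmod (tcirc s t) ^ 2)%R by nra. lra.
  - assert (0 <= s * (s - r) * (1 - cos t))%R by (apply Rmult_le_pos; [apply Rmult_le_pos |]; lra).
    assert (Cmod (tcirc s t - RtoC (1 - r)) ^ 2 < r ^ 2)%R by nra. lra.
Qed.

Lemma tcirc_interior (r s t : R) :
  (0 < r)%R -> (r < s < 1)%R -> expi t <> 1 ->
  (Cmod (tcirc s t) < 1 /\ r < Cmod (tcirc s t - RtoC (1 - r)))%R.
Proof.
  intros Hr Hs Ht. pose proof (one_minus_cos_pos t Ht).
  pose proof (Cmod2_tcirc r s t) as E1. pose proof (Cmod2_tcirc_0 s t) as E2.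
  pose proof (Cmod_ge_0 (tcirc s t)). pose proof (Cmod_ge_0 (tcirc s t - RtoC (1 - r))).
  split; apply Rnot_le_lt; intros Hle.
  - assert (0 < s * (1 - s) * (1 - cos t))%R
      by (apply Rmult_lt_0_compat; [apply Rmult_lt_0_compat |]; lra).
    assert (1 * 1 <= Cmod (tcirc s t) ^ 2)%R by nra. lra.
  - assert (0 < s * (s - r) * (1 - cos t))%R
      by (apply Rmult_lt_0_compat; [apply Rmult_lt_0_compat |]; lra).
    assert (Cmod (tcirc s t - RtoC (1 - r)) ^ 2 <= r ^ 2)%R by nra. lra.
Qed.

(** The interior points are chosen off the real axis so that they also avoid
    the origin, where [cauchy_disc] does not apply. *)
Lemma swept_dense (r : R) (z : C) (U : C -> Prop) :
  (0 < r < 1)%R -> swept 1 1 r 1 z -> locally z U ->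
  exists w, U w /\ (Cmod w < 1)%R /\ (r < Cmod (w - RtoC (1 - r)))%R /\ w <> 0.
Proof.
  intros Hr [s [t [Hs ->]]] HU.
  rewrite <- (clamp_id r 1 s Hs) in HU.
  destruct (jcts_circ 1 1 r 1 s t U HU) as [d Hd].
  pose proof (cond_pos d) as Hd0.
  (* The radius is moved slightly towards the midpoint [(1 + r) / 2]. *)
  assert (Hs' : exists s', (r < s' < 1)%R /\ (Rabs (s' - s) < d)%R).
  { set (e := Rmin (1 / 2) (d / 2)).
    assert (0 < e)%R by (apply Rmin_glb_lt; lra).
    assert (e <= 1 / 2)%R by apply Rmin_l. assert (e <= d / 2)%R by apply Rmin_r.
    exists (s + e * ((1 + r) / 2 - s))%R. split; [nra |].
    replace (s + e * ((1 + r) / 2 - s) - s)%R with (e * ((1 + r) / 2 - s))%R by ring.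
    apply Rabs_def1; nra. }
  (* A nonzero sine excludes both the cusp and the real axis. *)
  assert (Ht' : exists t', sin t' <> 0%R /\ (Rabs (t' - t) < d)%R).
  { destruct (Req_dec (sin t) 0) as [E | E].
    - set (e := Rmin 1 (d / 2)).
      assert (He : (0 < e)%R) by (apply Rmin_glb_lt; lra).
      assert (He1 : (e <= 1)%R) by apply Rmin_l. assert (He2 : (e <= d / 2)%R) by apply Rmin_r.
      exists (t + e)%R. split.
      + rewrite sin_plus, E, Rmult_0_l, Rplus_0_l.
        assert (0 < sin e)%R by (apply sin_gt_0; [lra |]; pose proof PI2_1; lra).
        apply Rmult_integral_contrapositive_currified; [| lra].
        intros Ec. pose proof (sin2_cos2 t) as H1. rewrite E, Ec in H1. unfold Rsqr in H1. lra.
      + replace (t + e - t)%R with e by ring. rewrite Rabs_pos_eq; lra.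
    - exists t. split; [exact E |]. rewrite Rminus_diag, Rabs_R0. exact Hd0. }
  destruct Hs' as [s' [Hs1 Hs2]]. destruct Ht' as [t' [Ht1 Ht2]].
  exists (tcirc s' t').
  assert (Hne : expi t' <> 1) by (intros E; apply Ht1; now injection E).
  destruct (tcirc_interior r s' t' (proj1 Hr) Hs1 Hne) as [I1 I2].
  repeat split; auto.
  - assert (Hu := Hd (s', t') (conj Hs2 Ht2)). cbn [fst snd] in Hu.
    rewrite clamp_id in Hu by lra. exact Hu.
  - intros E. apply (f_equal Im) in E.
    unfold circ, expi, Im in E; cbn in E.
    apply (Rmult_integral_contrapositive_currified s' (sin t')); lra.
Qed.

(** * Rapid decay of the Fourier coefficients on the tangent circles *)

(** Carries an identity from the circles inside the crescent to the two boundary circles, where the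
    integrand cannot be differentiated. *)
Lemma Cint_param_eq_limit (Phi : R -> R -> C) (a b : R) :
  (a < b)%R -> (forall s t, jcts Phi s t) ->
  (forall s, (a < s < b)%R -> Cint (Phi s) = 0) ->
  Cint (Phi a) = 0 /\ Cint (Phi b) = 0.
Proof.
  intros Hab HJ H0.
  assert (HR : forall s, rcts (Phi s)) by (intros s; now apply jcts_slice).
  assert (Hc : forall s, filterlim (fun s => Cint (Phi s)) (locally s) (locally (Cint (Phi s))))
    by (intros s; now apply Cint_param_cont).
  assert (Hd : forall s, (a < s < b)%R -> rderiv (fun s => Cint (Phi s)) s 0).
  { intros s Hs. apply (has_deriv_ext_loc RtoC (fun _ => 0)); [| apply has_deriv_const].
    assert (L : locally s (fun u => (a < u < b)%R))
      by (apply filter_and; [now apply (open_gt a) | now apply (open_lt b)]).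
    revert L. apply filter_imp. intros u Hu. symmetry. now apply H0. }
  set (m := ((a + b) / 2)%R). assert (Hm : Cint (Phi m) = 0) by (apply H0; unfold m; lra).
  split.
  - rewrite <- Hm. apply (rderiv_0_const (fun s => Cint (Phi s)) a m); [unfold m; lra | auto |].
    intros x Hx. apply Hd. unfold m in Hx. lra.
  - rewrite <- Hm. symmetry. apply (rderiv_0_const (fun s => Cint (Phi s)) m b); [unfold m; lra | auto |].
    intros x Hx. apply Hd. unfold m in Hx. lra.
Qed.

(** This is [2 PI] times the Fourier coefficient of index [- n] of [F] along a tangent circle. Thus
    [g] will use the indices [- n] on the outer circle, and [h] the indices [n] on the inner one. *)
Definition coef (F : C -> C) (s : R) (n : Z) : C :=
  Cint (fun t => F (tcirc s t) * expi (IZR n * t)).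

Section Coefficients.
Variables (r : R) (F : nat -> C -> C).
Hypothesis Hr : (0 < r < 1)%R.
Hypothesis HF : forall l,
  C1_up_to (fun z => (Cmod z < 1)%R /\ (r < Cmod (z - RtoC (1 - r)))%R) (swept 1 1 r 1) (F l) (F (S l)).

Lemma jcts_coef (l : nat) (n : Z) (s t : R) :
  jcts (fun s t => F l (tcirc (clamp r 1 s) t) * expi (IZR n * t)) s t.
Proof.
  apply jcts_mult.
  - apply jcts_swept; [lra |]. apply (proj1 (HF l)), swept_circ, clamp_range. lra.
  - exact (filterlim_comp _ _ _ _ (fun t => expi (IZR n * t)) _ _ _ (filterlim_snd_R s t) (cts_expi_scal (IZR n) t)).
Qed.

(** For [r < s < 1] the left-hand side is the integral of the [t]-derivative of the periodic
    function [- Ci * F l(zeta) * expi (n * t)]. The shift to [n + 1] comes from the factor [expi t]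
    in the velocity of the circle. *)
Lemma coef_step (l : nat) (n : Z) (s : R) :
  (r <= s <= 1)%R -> RtoC (IZR n) * coef (F l) s n + RtoC s * coef (F (S l)) s (n + 1) = 0.
Proof.
  set (Phi := fun s t => RtoC (IZR n) * (F l (tcirc (clamp r 1 s) t) * expi (IZR n * t))
     + RtoC (clamp r 1 s) * (F (S l) (tcirc (clamp r 1 s) t) * expi (IZR (n + 1) * t))).
  assert (HJ : forall s t, jcts Phi s t).
  { intros u t. apply jcts_plus; apply jcts_mult.
    - apply jcts_const.
    - apply (jcts_coef l n).
    - apply jcts_clamp.
    - apply (jcts_coef (S l) (n + 1)). }
  assert (HRl : forall s l n, rcts (fun t => F l (tcirc (clamp r 1 s) t) * expi (IZR n * t))).
  { intros u l' n'. apply (jcts_slice (fun s t => F l' (tcirc (clamp r 1 s) t) * expi (IZR n' * t)) u).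
    intros t. apply jcts_coef. }
  assert (EPhi : forall s, (r <= s <= 1)%R ->
    Cint (Phi s) = RtoC (IZR n) * coef (F l) s n + RtoC s * coef (F (S l)) s (n + 1)).
  { intros u Hu. unfold Phi, coef. rewrite Cint_plus, !Cint_scal; auto.
    - now rewrite clamp_id by exact Hu.
    - apply cts_mult; [apply cts_const | apply HRl].
    - apply cts_mult; [apply cts_const | apply HRl]. }
  assert (Hin : forall s, (r < s < 1)%R -> Cint (Phi s) = 0).
  { intros u Hu.
    rewrite (Cint_deriv (fun t => - Ci * (F l (tcirc (clamp r 1 u) t) * expi (IZR n * t)))).
    - rewrite Rmult_0_r, expi_0, expi_period. unfold circ. rewrite expi_0, expi_2PI. ring.
    - apply cts_mult; [apply cts_const | apply HRl].
    - intros t Ht. unfold Phi. rewrite clamp_id by lra.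
      (* Strictly between [0] and [2 PI] the circle avoids the cusp, since [cos t = 1] would force
         [sin (t / 2) = 0]. *)
      assert (Hne : expi t <> 1).
      { intros E. assert (Hc : cos t = 1%R) by now injection E.
        assert (Hs2 : sin (t / 2) = 0%R).
        { replace t with (2 * (t / 2))%R in Hc by field. rewrite cos_2a_sin in Hc. nra. }
        assert (0 < sin (t / 2))%R by (apply sin_gt_0; lra). lra. }
      apply (has_deriv_eq RtoC _ _ (- Ci * (F (S l) (tcirc u t) * (Ci * (RtoC u * expi t)) * expi (IZR n * t)
         + F l (tcirc u t) * (Ci * RtoC (IZR n) * expi (IZR n * t))))).
      { rewrite plus_IZR, Rmult_plus_distr_r, Rmult_1_l, expi_plus.
        transitivity (- (Ci * Ci) * (RtoC (IZR n) * (F l (tcirc u t) * expi (IZR n * t)) +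
           RtoC u * (F (S l) (tcirc u t) * (expi (IZR n * t) * expi t)))); [ring |].
        replace (Ci * Ci) with (RtoC (-1)); [ring_simplify; ring |].
        apply injective_projections; cbn; ring. }
      apply (has_deriv_eq RtoC _ _ (0 * (F l (tcirc u t) * expi (IZR n * t)) + - Ci * (F (S l) (tcirc u t) * (Ci * (RtoC u * expi t)) * expi (IZR n * t)
         + F l (tcirc u t) * (Ci * RtoC (IZR n) * expi (IZR n * t))))); [ring |].
      apply (has_deriv_mult RtoC filterlim_RtoC (fun _ => - Ci)); [apply has_deriv_const |].
      apply (has_deriv_mult RtoC filterlim_RtoC (fun t => F l (tcirc u t)) (fun t => expi (IZR n * t))); [| apply rderiv_expi_scal].
      apply (has_deriv_comp RtoC filterlim_RtoC (F l) (tcirc u)); [| apply rderiv_circ_t].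
      apply (HF l). now apply tcirc_interior.
    - apply jcts_slice. auto. }
  intros Hs. rewrite <- EPhi by exact Hs.
  destruct (Cint_param_eq_limit Phi r 1 (proj2 Hr) HJ Hin) as [E1 E2].
  destruct (Req_dec s r) as [-> | H1]; [exact E1 |].
  destruct (Req_dec s 1) as [-> | H2]; [exact E2 |].
  apply Hin. lra.
Qed.

(** Each application of [coef_step] gains a factor [n] at the price of one more derivative, so the
    induction on [k] runs over all orders [l] at once. *)
Lemma coef_decay (s : R) (k l : nat) :
  (r <= s <= 1)%R ->
  exists M, forall n, ((1 + Rabs (IZR n)) ^ k * Cmod (coef (F l) s n) <= M)%R.
Proof.
  intros Hs. revert l. induction k as [| k IH]; intros l.
  - assert (HR : rcts (fun t => F l (tcirc s t))).
    { assert (J : rcts (fun t => F l (tcirc (clamp r 1 s) t))).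
      { apply (jcts_slice (fun s t => F l (tcirc (clamp r 1 s) t))).
        intros t. apply jcts_swept; [lra |]. apply (proj1 (HF l)), swept_circ, clamp_range. lra. }
      now rewrite clamp_id in J by exact Hs. }
    destruct (rcts_bounded _ 0 (2 * PI) HR) as [M HM].
    exists (4 * PI * M)%R. intros n. rewrite pow_O, Rmult_1_l. apply Cint_bound.
    + apply cts_mult; [exact HR | apply cts_expi_scal].
    + intros t Ht. rewrite Cmod_mult, Cmod_expi, Rmult_1_r. now apply HM.
  - destruct (IH l) as [M1 H1]. destruct (IH (S l)) as [M2 H2].
    exists (M1 + 2 ^ k * M2)%R. intros n.
    specialize (H1 n). specialize (H2 (n + 1)%Z).
    assert (Hstep : (Rabs (IZR n) * Cmod (coef (F l) s n) <= Cmod (coef (F (S l)) s (n + 1)))%R).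
    { rewrite <- Cmod_R, <- Cmod_mult.
      replace (RtoC (IZR n) * coef (F l) s n) with (- (RtoC s * coef (F (S l)) s (n + 1))).
      2: { pose proof (coef_step l n s Hs) as E.
           replace (RtoC (IZR n) * coef (F l) s n) with
             ((RtoC (IZR n) * coef (F l) s n + RtoC s * coef (F (S l)) s (n + 1))
              - RtoC s * coef (F (S l)) s (n + 1)) by ring.
           rewrite E. ring. }
      rewrite Cmod_opp, Cmod_mult, Cmod_R, Rabs_pos_eq by lra.
      pose proof (Cmod_ge_0 (coef (F (S l)) s (n + 1))). nra. }
    set (x := Rabs (IZR n)) in *. assert (Hx : (0 <= x)%R) by apply Rabs_pos.
    (* The index shift costs [2 ^ k], because [1 + Rabs n <= 2 * (1 + Rabs (n + 1))]. *)
    assert (Hcmp : ((1 + x) ^ k <= 2 ^ k * (1 + Rabs (IZR (n + 1))) ^ k)%R).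
    { rewrite <- Rpow_mult_distr. apply pow_incr. split; [lra |].
      rewrite plus_IZR. pose proof (Rabs_triang (IZR n + 1) (-1)) as T.
      replace (IZR n + 1 + -1)%R with (IZR n) in T by ring.
      rewrite (Rabs_left (-1)) in T by lra. pose proof (Rabs_pos (IZR n + 1)). unfold x. lra. }
    assert (Hp : (0 <= (1 + x) ^ k)%R) by (apply pow_le; lra).
    assert (Hp2 : (0 < 2 ^ k)%R) by (apply pow_lt; lra).
    pose proof (Cmod_ge_0 (coef (F (S l)) s (n + 1))).
    cbn [pow].
    replace ((1 + x) * (1 + x) ^ k * Cmod (coef (F l) s n))%R
      with ((1 + x) ^ k * Cmod (coef (F l) s n) + (1 + x) ^ k * (x * Cmod (coef (F l) s n)))%R by ring.
    apply Rplus_le_compat; [exact H1 |].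
    apply Rle_trans with ((1 + x) ^ k * Cmod (coef (F (S l)) s (n + 1)))%R; [nra |].
    apply Rle_trans with (2 ^ k * ((1 + Rabs (IZR (n + 1))) ^ k * Cmod (coef (F (S l)) s (n + 1))))%R; [nra |].
    nra.
Qed.

Lemma rapid_coef (s : R) (e : Z) :
  (r <= s <= 1)%R -> (Z.abs e = 1)%Z ->
  rapid (fun n => coef (F 0) s (e * Z.of_nat n)).
Proof.
  intros Hs He k. destruct (coef_decay s k 0 Hs) as [M HM]. exists M. intros n.
  specialize (HM (e * Z.of_nat n)%Z).
  replace (INR (S n)) with (1 + Rabs (IZR (e * Z.of_nat n)))%R; [exact HM |].
  rewrite <- abs_IZR, Z.abs_mul, He, Z.mul_1_l, S_INR, INR_IZR_INZ.
  rewrite Z.abs_eq by lia. ring.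
Qed.
End Coefficients.

Lemma tcirc_1 (t : R) : tcirc 1 t = expi t.
Proof. unfold circ. ring. Qed.

Lemma tcirc_center (r t : R) : tcirc r t = RtoC (1 - r) + RtoC r * expi t.
Proof. unfold circ. rewrite RtoC_minus. ring. Qed.

(** In [circle_cauchy] for the tangent family, the term with [F z] contributes [2 PI * F z] on the
    outer circle, which encloses [z], and [0] on the inner circle, which does not. *)
Lemma crescent_decomposition (r : R) (F F1 : C -> C) (z : C) :
  (0 < r < 1)%R ->
  C1_up_to (fun z => (Cmod z < 1)%R /\ (r < Cmod (z - RtoC (1 - r)))%R) (swept 1 1 r 1) F F1 ->
  (Cmod z < 1)%R -> (r < Cmod (z - RtoC (1 - r)))%R ->
  RtoC (2 * PI) * F z =
    Cint (fun t => F (expi t) / (1 - expi (- t) * z)) +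
    Cint (fun t => F (tcirc r t) * (1 / (1 - expi t * (RtoC r / (z - RtoC (1 - r)))) - 1)).
Proof.
  intros Hr [Hc [Hd Hc1]] Hz1 Hz2.
  set (w := RtoC r / (z - RtoC (1 - r))).
  assert (Hzc : z - RtoC (1 - r) <> 0) by (apply Cmod_gt_0; lra).
  assert (Hrc : RtoC r <> 0) by (intros E; injection E; lra).
  assert (Hw : (Cmod w < 1)%R).
  { unfold w. rewrite Cmod_div, Cmod_R, Rabs_pos_eq by (auto; lra).
    apply Rmult_lt_reg_r with (Cmod (z - RtoC (1 - r))); [lra |].
    unfold Rdiv. rewrite Rmult_assoc, Rinv_l by lra. lra. }
  assert (HG : forall s, (r <= s <= 1)%R -> rcts (fun t => F (tcirc s t))).
  { intros s Hs. assert (J : rcts (fun t => F (tcirc (clamp r 1 s) t))).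
    { apply (jcts_slice (fun s t => F (tcirc (clamp r 1 s) t))).
      intros t. apply jcts_swept; [lra |]. apply Hc, swept_circ, clamp_range. lra. }
    now rewrite clamp_id in J by exact Hs. }
  assert (HG1 : rcts (fun t => F (expi t))).
  { intros t. generalize (HG 1%R ltac:(lra) t). rewrite tcirc_1.
    apply filterlim_ext. intros u. now rewrite tcirc_1. }
  assert (Hnz1 : forall t, 1 - expi (- t) * z <> 0) by (intros t; now apply expi_neg_neq).
  assert (Hnz2 : forall t, 1 - expi t * w <> 0).
  { intros t. apply one_minus_neq_0; [rewrite Cmod_expi; lra | exact Hw]. }
  assert (Hden1 : rcts (fun t => 1 - expi (- t) * z)).
  { apply cts_minus; [apply cts_const |]. apply cts_mult; [apply cts_expi_opp | apply cts_const]. }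
  assert (Hden2 : rcts (fun t => 1 - expi t * w)).
  { apply cts_minus; [apply cts_const |]. apply cts_mult; [apply cts_expi | apply cts_const]. }
  assert (Hq1 : rcts (fun t => 1 / (1 - expi (- t) * z))) by (apply cts_div; auto using cts_const).
  assert (Hq2 : rcts (fun t => 1 / (1 - expi t * w))) by (apply cts_div; auto using cts_const).
  assert (Hq3 : rcts (fun t => 1 / (1 - expi t * w) - 1)) by (apply cts_minus; auto using cts_const).
  assert (Hr1 : forall t, tcirc r t <> z).
  { intros t E. apply (Rlt_irrefl r).
    replace r with (Cmod (z - RtoC (1 - r))) at 2; [exact Hz2 |].
    rewrite <- E, tcirc_center.
    replace (RtoC (1 - r) + RtoC r * expi t - RtoC (1 - r)) with (RtoC r * expi t) by ring.
    rewrite Cmod_mult, Cmod_expi, Cmod_R, Rabs_pos_eq; lra. }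
  assert (H11 : forall t, tcirc 1 t <> z).
  { intros t E. rewrite <- E, tcirc_1, Cmod_expi in Hz1. lra. }
  (* The exceptional radius is that of the only tangent circle through [z]: dividing [Cmod (z - 1) ^
     2 = 2 * s ^ 2 * (1 - cos t)] by [1 - Re z = s * (1 - cos t)] gives [2 * s]. *)
  assert (HI := circle_cauchy 1 1 r 1 (Cmod (z - 1) ^ 2 / (2 * (1 - Re z))) F F1 z (F1 z)).
  specialize (HI ltac:(lra)).
  specialize (HI (fun s t Hs => Hc _ (swept_circ 1 1 r 1 s t Hs))).
  specialize (HI (fun s t Hs Ht => Hd _ (tcirc_interior r s t (proj1 Hr) Hs Ht))).
  specialize (HI (fun s t Hs => Hc1 _ (swept_circ 1 1 r 1 s t (conj (Rlt_le _ _ (proj1 Hs)) (Rlt_le _ _ (proj2 Hs)))))).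
  specialize (HI (Hd z (conj Hz1 Hz2))).
  assert (Hrad : forall s t, (r < s < 1)%R -> tcirc s t = z -> s = (Cmod (z - 1) ^ 2 / (2 * (1 - Re z)))%R).
  { intros s t Hs E.
    assert (E1 : (Cmod (z - 1) ^ 2 = 2 * s * s * (1 - cos t))%R).
    { rewrite <- E. pose proof (Cmod2_tcirc 0 s t) as A.
      rewrite Rminus_0_r in A. rewrite A. ring. }
    assert (E2 : (1 - Re z = s * (1 - cos t))%R).
    { rewrite <- E. unfold circ, expi, Re; cbn. ring. }
    assert (Hre : (0 < 1 - Re z)%R).
    { pose proof (re_le_Cmod z) as A. pose proof (Rle_abs (Re z)). lra. }
    rewrite E1. apply Rmult_eq_reg_r with (2 * (1 - Re z))%R; [| lra].
    unfold Rdiv. rewrite Rmult_assoc, Rinv_l by lra. rewrite E2. ring. }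
  specialize (HI Hrad Hr1 H11).
  (* With [zeta - c = r * expi t] and [w = r / (z - c)], the inner kernel [r * expi t / (zeta - z)]
     equals [1 - 1 / (1 - expi t * w)]. *)
  rewrite (Cint_ext _ (fun t => F z * (1 / (1 - expi t * w) - 1) - F (tcirc r t) * (1 / (1 - expi t * w) - 1))) in HI.
  2: { intros t. assert (A := Hr1 t). assert (B := Hnz2 t). rewrite tcirc_center in A |- *.
       assert (A' : RtoC (1 - r) + RtoC r * expi t - z <> 0) by now apply minus_neq_0.
       assert (B' : z - RtoC (1 - r) - RtoC r * expi t <> 0).
       { intros E. apply A'. replace (RtoC (1 - r) + RtoC r * expi t - z) with (- (z - RtoC (1 - r) - RtoC r * expi t)) by ring.
         rewrite E. ring. }
       unfold w. field. repeat split; [exact Hzc | | exact A'].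
       now rewrite (Cmult_comm (expi t)). }
  rewrite (Cint_ext (fun t => _ / _ * (RtoC 1 * expi t)) (fun t => F (expi t) / (1 - expi (- t) * z) - F z * (1 / (1 - expi (- t) * z)))) in HI.
  2: { intros t. assert (B := H11 t). rewrite tcirc_1 in B |- *.
       rewrite expi_opp. field. split; [apply expi_neq_0 | now apply minus_neq_0]. }
  assert (R1 : rcts (fun t => F (expi t) / (1 - expi (- t) * z))) by now apply cts_div.
  assert (R2 : rcts (fun t => F (tcirc r t) * (1 / (1 - expi t * w) - 1))).
  { apply cts_mult; [apply HG; lra | exact Hq3]. }
  rewrite !Cint_minus, !Cint_scal in HI; auto; try (apply cts_mult; [apply cts_const | assumption]).
  rewrite Cint_minus, Cint_kernel_opp, Cint_kernel_id, Cint_const in HI; auto using cts_const.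
  set (J2 := Cint (fun t => F (tcirc r t) * (1 / (1 - expi t * w) - 1))) in *.
  replace J2 with (- (F z * (RtoC (2 * PI) - RtoC (2 * PI) * 1) - J2)) by ring.
  rewrite HI. ring.
Qed.

(** * Uniqueness *)

(** [cauchy_disc] leaves out [w = 0], so the value at the centre is obtained by letting a real point
    [x] tend to [0]. Differentiability at the centre is not assumed, as befits a function inverted
    from infinity. *)
Lemma mean_value_disc (G G1 : C -> C) :
  (forall v, (Cmod v <= 1)%R ->
     filterlim G (within (fun v => (Cmod v <= 1)%R) (locally v)) (locally (G v))) ->
  (forall v, (0 < Cmod v < 1)%R -> cderiv G v (G1 v)) ->
  (forall v, (0 < Cmod v < 1)%R -> filterlim G1 (locally v) (locally (G1 v))) ->
  Cint (fun t => G (expi t)) = RtoC (2 * PI) * G 0.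
Proof.
  intros Hc Hd Hc1. pose proof PI_RGT_0 as HPI.
  assert (HG : rcts (fun t => G (expi t))).
  { apply (rcts_on_circle (fun v => (Cmod v <= 1)%R)); [exact cts_expi | |].
    - intros t. rewrite Cmod_expi. lra.
    - intros t. apply Hc. rewrite Cmod_expi. lra. }
  destruct (rcts_bounded _ 0 (2 * PI) HG) as [M HM].
  assert (HM0 : (0 <= M)%R) by (eapply Rle_trans; [apply Cmod_ge_0 | apply (HM 0%R); lra]).
  set (X := Cint (fun t => G (expi t)) - RtoC (2 * PI) * G 0).
  assert (HX : forall eps, (0 < eps)%R -> (Cmod X <= eps)%R).
  { intros eps Heps.
    assert (Hl := filterlim_C_lt _ _ (eps / (4 * PI))%R (Hc 0 ltac:(rewrite Cmod_0; lra))
      ltac:(apply Rdiv_lt_0_compat; lra)).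
    unfold within in Hl. apply locally_Cmod in Hl. destruct Hl as [d [Hd0 Hl]].
    (* With [x <= 1 / 2] the kernel at [x] differs from [1] by at most [2 * x]. The last bound makes
       the resulting error [8 * PI * M * x] at most [eps / 2], and [d / 2] brings [G x] close to
       [G 0]. *)
    set (x := Rmin (1 / 2) (Rmin (d / 2) (eps / (16 * PI * (M + 1))))).
    assert (Hx0 : (0 < x)%R).
    { repeat apply Rmin_glb_lt; try lra. apply Rdiv_lt_0_compat; [lra |].
      apply Rmult_lt_0_compat; lra. }
    assert (Hx1 : (x <= 1 / 2)%R) by apply Rmin_l.
    assert (Hx2 : (x <= d / 2)%R) by (eapply Rle_trans; [apply Rmin_r | apply Rmin_l]).
    assert (Hx3 : (x * (16 * PI * (M + 1)) <= eps)%R).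
    { apply Rle_trans with (eps / (16 * PI * (M + 1)) * (16 * PI * (M + 1)))%R.
      - apply Rmult_le_compat_r; [apply Rmult_le_pos; lra |].
        eapply Rle_trans; [apply Rmin_r | apply Rmin_r].
      - right. field. split; lra. }
    assert (Hxm : Cmod (RtoC x) = x) by (rewrite Cmod_R; apply Rabs_pos_eq; lra).
    assert (Hclose : (Cmod (G (RtoC x) - G 0) < eps / (4 * PI))%R).
    { apply Hl; [replace (RtoC x - 0) with (RtoC x) by ring |]; rewrite Hxm; lra. }
    assert (Hcau := cauchy_disc G G1 (RtoC x) Hc Hd Hc1 ltac:(rewrite Hxm; lra)).
    assert (Hnz : forall t, 1 - expi (- t) * RtoC x <> 0).
    { intros t. apply expi_neg_neq. rewrite Hxm. lra. }
    assert (Hden : rcts (fun t => 1 - expi (- t) * RtoC x)).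
    { apply cts_minus; [apply cts_const | apply cts_mult; [apply cts_expi_opp | apply cts_const]]. }
    assert (Hq : rcts (fun t => G (expi t) / (1 - expi (- t) * RtoC x))) by now apply cts_div.
    assert (Hbd : (Cmod (Cint (fun t => G (expi t)) - Cint (fun t => G (expi t) / (1 - expi (- t) * RtoC x)))%C
       <= 4 * PI * (2 * M * x))%R).
    { rewrite <- Cint_minus by assumption. apply Cint_bound; [now apply cts_minus |].
      intros t Ht.
      replace (G (expi t) - G (expi t) / (1 - expi (- t) * RtoC x)) with
        (- (G (expi t) * (expi (- t) * RtoC x) / (1 - expi (- t) * RtoC x))) by (field; apply Hnz).
      rewrite Cmod_opp, Cmod_div, !Cmod_mult, Cmod_expi, Hxm by apply Hnz.
      assert (Hlow : (1 / 2 <= Cmod (1 - expi (- t) * RtoC x))%R).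
      { pose proof (Cmod_triangle (1 - expi (- t) * RtoC x) (expi (- t) * RtoC x)) as T.
        replace (1 - expi (- t) * RtoC x + expi (- t) * RtoC x) with (RtoC 1) in T by ring.
        rewrite Cmod_1, Cmod_mult, Cmod_expi, Hxm in T. lra. }
      apply Rmult_le_reg_r with (Cmod (1 - expi (- t) * RtoC x)); [lra |].
      unfold Rdiv. rewrite Rmult_assoc, Rinv_l by lra.
      pose proof (HM t Ht). pose proof (Rmult_le_pos _ _ HM0 (Rlt_le _ _ Hx0)). nra. }
    unfold X.
    replace (Cint (fun t => G (expi t)) - RtoC (2 * PI) * G 0) with
      ((Cint (fun t => G (expi t)) - Cint (fun t => G (expi t) / (1 - expi (- t) * RtoC x)))
       + RtoC (2 * PI) * (G (RtoC x) - G 0)) by (rewrite <- Hcau; ring).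
    eapply Rle_trans; [apply Cmod_triangle |].
    rewrite Cmod_mult, Cmod_R, (Rabs_pos_eq (2 * PI)) by lra.
    apply Rle_trans with (eps / 2 + eps / 2)%R; [| lra].
    apply Rplus_le_compat.
    - eapply Rle_trans; [exact Hbd |]. nra.
    - replace (eps / 2)%R with (2 * PI * (eps / (4 * PI)))%R by (field; lra).
      apply Rmult_le_compat_l; lra. }
  assert (E : X = 0).
  { apply Cmod_eq_0, Rle_antisym; [| apply Cmod_ge_0].
    apply Rnot_lt_le. intros Hlt. specialize (HX (Cmod X / 2)%R ltac:(lra)). lra. }
  unfold X in E. replace (Cint (fun t => G (expi t))) with
    ((Cint (fun t => G (expi t)) - RtoC (2 * PI) * G 0) + RtoC (2 * PI) * G 0) by ring.
  rewrite E. ring.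
Qed.

Lemma RInt_reflect (f : R -> R) (b : R) :
  ex_RInt f 0 b -> RInt (fun t => f (b - t)%R) 0 b = RInt f 0 b.
Proof.
  intros H. apply is_RInt_unique.
  assert (HI := RInt_correct (V := R_CompleteNormedModule) f 0 b H).
  apply (is_RInt_swap (V := R_NormedModule)) in HI.
  assert (HL := is_RInt_comp_lin (V := R_NormedModule) f (-1) b 0 b (opp (RInt f 0 b))).
  replace (-1 * 0 + b)%R with b in HL by ring. replace (-1 * b + b)%R with 0%R in HL by ring.
  specialize (HL HI).
  apply (is_RInt_opp (V := R_NormedModule)) in HL. rewrite opp_opp in HL.
  revert HL. apply is_RInt_ext. intros t _. unfold opp, scal; cbn. unfold mult; cbn.
  replace (-1 * t + b)%R with (b - t)%R by ring. ring.
Qed.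

Lemma Cint_reflect (phi : R -> C) :
  rcts phi -> Cint (fun t => phi (2 * PI - t)%R) = Cint phi.
Proof.
  intros H. unfold Cint. f_equal.
  - apply (RInt_reflect (fun t => Re (phi t))). now apply ex_RInt_Re.
  - apply (RInt_reflect (fun t => Im (phi t))). now apply ex_RInt_Im.
Qed.

Lemma crescent_uniqueness (r : R) (G G1 H H1 : C -> C) :
  (0 < r < 1)%R ->
  C1_up_to (fun z => (Cmod z < 1)%R) (fun z => (Cmod z <= 1)%R) G G1 ->
  C1_up_to (fun z => (r < Cmod (z - RtoC (1 - r)))%R) (fun z => (r <= Cmod (z - RtoC (1 - r)))%R) H H1 ->
  filterlim H C_infinity (locally (RtoC 0)) ->
  (forall z, (Cmod z < 1)%R -> (r < Cmod (z - RtoC (1 - r)))%R -> G z = H z) ->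
  (forall z, (Cmod z < 1)%R -> G z = 0) /\
  (forall z, (r < Cmod (z - RtoC (1 - r)))%R -> H z = 0).
Proof.
  intros Hr HG HH Hinf HGH. set (c := RtoC (1 - r)) in *.
  pose proof PI_RGT_0 as HPI.
  assert (HP : RtoC (2 * PI) <> 0) by (intros E; injection E; lra).
  assert (Hrc : RtoC r <> 0) by (intros E; injection E; lra).
  assert (Hrm : Cmod (RtoC r) = r) by (rewrite Cmod_R; apply Rabs_pos_eq; lra).
  pose proof HG as [Gc [Gd Gc1]]. destruct HH as [Hc [Hd Hc1]].
  assert (Gcl : forall v, (0 < Cmod v < 1)%R -> filterlim G1 (locally v) (locally (G1 v))).
  { intros v Hv. apply (filterlim_within_interior (fun z => (Cmod z <= 1)%R)); [| apply Gc1; lra].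
    generalize (open_unit_disc v (proj2 Hv)). apply filter_imp. intros y Hy. lra. }
  assert (Gd' : forall v, (0 < Cmod v < 1)%R -> cderiv G v (G1 v)) by (intros v Hv; apply Gd; lra).
  assert (Hcl : forall z, (r < Cmod (z - c))%R -> filterlim H1 (locally z) (locally (H1 z))).
  { intros z Hz. apply (filterlim_within_interior (fun z => (r <= Cmod (z - c))%R)); [| apply Hc1; lra].
    generalize (open_exterior c r z Hz). apply filter_imp. intros y Hy. lra. }
  (* Inversion in the inner circle turns the exterior into the unit disc. *)
  set (W := fun v : C => if Ceq_dec v 0 then RtoC 0 else H (c + RtoC r / v)).
  set (W1 := fun v : C => H1 (c + RtoC r / v) * (RtoC r * (- (1) / (v * v)))).
  assert (HW : forall v : C, v <> 0 -> W v = H (c + RtoC r / v)).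
  { intros v Hv. unfold W. destruct (Ceq_dec v 0) as [E | _]; [contradiction | reflexivity]. }
  assert (HW0 : W 0 = 0) by (unfold W; destruct (Ceq_dec 0 0) as [_ | n]; [reflexivity | now contradiction n]).
  assert (Hinv : forall v : C, v <> 0 -> Cmod (c + RtoC r / v - c) = (r / Cmod v)%R).
  { intros v Hv. replace (c + RtoC r / v - c) with (RtoC r / v) by ring.
    now rewrite Cmod_div, Hrm. }
  assert (Dinv : forall v : C, v <> 0 -> cderiv (fun v => c + RtoC r / v) v (RtoC r * (- (1) / (v * v)))).
  { intros v Hv. apply (has_deriv_eq _ _ _ (0 + RtoC r * (- (1) / (v * v)))); [ring |].
    apply has_deriv_plus; [apply has_deriv_const |]. apply cderiv_scal.
    apply (has_deriv_inv (fun v : C => v) id_C_cont (fun v => v)); [exact Hv | apply has_deriv_id]. }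
  assert (Hquot : forall v : C, v <> 0 -> (Cmod v <= 1)%R -> (r <= r / Cmod v)%R).
  { intros v Hv Hv1. assert (0 < Cmod v)%R by now apply Cmod_gt_0.
    apply Rmult_le_reg_r with (Cmod v); [lra |].
    unfold Rdiv. rewrite Rmult_assoc, Rinv_l by lra. nra. }
  assert (Hquot' : forall v, (0 < Cmod v < 1)%R -> (r < r / Cmod v)%R).
  { intros v Hv. apply Rmult_lt_reg_r with (Cmod v); [lra |].
    unfold Rdiv. rewrite Rmult_assoc, Rinv_l by lra. nra. }
  assert (Wc : forall v, (Cmod v <= 1)%R ->
    filterlim W (within (fun v => (Cmod v <= 1)%R) (locally v)) (locally (W v))).
  { intros v Hv. destruct (Ceq_dec v 0) as [-> | Hv0].
    - rewrite HW0. apply filterlim_C. intros eps Heps. unfold within.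
      assert (HI : C_infinity (fun z => (Cmod (H z - 0) < eps)%R)).
      { apply (Hinf (fun y => (Cmod (y - 0) < eps)%R)). apply locally_Cmod. now exists eps. }
      destruct HI as [M HM]. apply locally_Cmod.
      (* If [r / Cmod v > B], then [c + r / v] has modulus beyond [M], where [H] is already smaller
         than [eps]. So the decay of [H] at infinity becomes the continuity of [W] at [0]. *)
      set (B := (Cmod c + Rabs M + 1)%R).
      assert (HB : (0 < B)%R) by (unfold B; pose proof (Cmod_ge_0 c); pose proof (Rabs_pos M); lra).
      exists (r / B)%R. split; [apply Rdiv_lt_0_compat; lra |].
      intros v Hv1 _. replace (v - 0) with v in Hv1 by ring.
      destruct (Ceq_dec v 0) as [-> | Hv0].
      + rewrite HW0. replace (0 - 0) with (RtoC 0) by ring. now rewrite Cmod_0.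
      + rewrite HW by exact Hv0. apply HM.
        assert (Hp : (0 < Cmod v)%R) by now apply Cmod_gt_0.
        assert (Hbig : (B < r / Cmod v)%R).
        { apply Rmult_lt_reg_r with (Cmod v); [lra |].
          unfold Rdiv at 1. rewrite Rmult_assoc, Rinv_l, Rmult_1_r by lra.
          apply (Rmult_lt_compat_r B) in Hv1; [| lra].
          unfold Rdiv in Hv1. rewrite Rmult_assoc, Rinv_l, Rmult_1_r in Hv1 by lra. lra. }
        pose proof (Cmod_triangle (c + RtoC r / v) (- c)) as T.
        change (c + RtoC r / v + - c) with (c + RtoC r / v - c) in T.
        rewrite Hinv, Cmod_opp in T by exact Hv0.
        pose proof (Rle_abs M). unfold B in Hbig. lra.
    - rewrite HW by exact Hv0.
      apply filterlim_ext_loc with (fun v => H (c + RtoC r / v)).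
      { apply (filter_le_within (F := locally v)). generalize (locally_neq v 0 Hv0).
        apply filter_imp. intros y Hy. symmetry. now apply HW. }
      apply (filterlim_comp _ _ _ (fun v => c + RtoC r / v) H) with (within (fun z => (r <= Cmod (z - c))%R) (locally (c + RtoC r / v))).
      + intros P HPP. unfold filtermap, within.
        assert (L1 : locally v (fun y : C => (r <= Cmod (c + RtoC r / y - c))%R -> P (c + RtoC r / y)))
          by exact (has_deriv_cont _ id_C_cont _ _ _ (Dinv v Hv0) _ HPP).
        generalize (filter_and _ _ L1 (locally_neq v 0 Hv0)).
        apply filter_imp. intros y [A1 A2] A3. apply A1. rewrite Hinv by exact A2. now apply Hquot.
      + apply Hc. rewrite Hinv by exact Hv0. now apply Hquot. }
  assert (Wd : forall v, (0 < Cmod v < 1)%R -> cderiv W v (W1 v)).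
  { intros v Hv. assert (Hv0 : v <> 0) by (apply Cmod_gt_0; lra).
    apply (has_deriv_ext_loc _ (fun v => H (c + RtoC r / v))).
    { generalize (locally_neq v 0 Hv0). apply filter_imp. intros y Hy. symmetry. now apply HW. }
    apply (has_deriv_comp _ id_C_cont H (fun v => c + RtoC r / v)); [| now apply Dinv].
    apply Hd. rewrite Hinv by exact Hv0. now apply Hquot'. }
  assert (Wc1 : forall v, (0 < Cmod v < 1)%R -> filterlim W1 (locally v) (locally (W1 v))).
  { intros v Hv. assert (Hv0 : v <> 0) by (apply Cmod_gt_0; lra).
    apply filterlim_Cmult.
    - apply (filterlim_comp _ _ _ (fun v => c + RtoC r / v) H1) with (locally (c + RtoC r / v)).
      + exact (has_deriv_cont _ id_C_cont _ _ _ (Dinv v Hv0)).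
      + apply Hcl. rewrite Hinv by exact Hv0. now apply Hquot'.
    - apply filterlim_Cmult; [apply filterlim_const |].
      apply filterlim_Cdiv; [now apply Cmult_neq_0 | apply filterlim_const |].
      apply filterlim_Cmult; apply filterlim_id. }
  set (K := fun z => (Cmod z <= 1)%R /\ (r <= Cmod (z - c))%R).
  (* Vanishing off the origin in the open crescent spreads by density to the swept region, hence to
     both boundary circles and to the origin if it lies there. *)
  assert (Hdense : forall D : C -> C,
    (forall z, K z -> filterlim D (within K (locally z)) (locally (D z))) ->
    (forall z, (Cmod z < 1)%R -> (r < Cmod (z - c))%R -> z <> 0 -> D z = 0) ->
    forall z, swept 1 1 r 1 z -> D z = 0).
  { intros D HD HD0 z Hz.
    destruct (Ceq_dec (D z) 0) as [E | E]; [exact E | exfalso].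
    assert (L := filterlim_C_lt _ _ _ (HD z (swept_bounds r z Hr Hz)) (proj1 (Cmod_gt_0 _) E)).
    destruct (swept_dense r z _ Hr Hz L) as [y [Y1 [Y2 [Y3 Y4]]]].
    assert (Y5 : K y) by (split; [lra | fold c in Y3; lra]).
    specialize (Y1 Y5). rewrite (HD0 y Y2 Y3 Y4), Cmod_minus_sym in Y1.
    replace (D z - 0) with (D z) in Y1 by ring. lra. }
  assert (GcK : forall z, K z -> filterlim G (within K (locally z)) (locally (G z))).
  { intros z [Hz _]. apply (filterlim_within_subset (fun z => (Cmod z <= 1)%R)); [| now apply Gc].
    now intros y [Hy _]. }
  assert (HcK : forall z, K z -> filterlim H (within K (locally z)) (locally (H z))).
  { intros z [_ Hz]. apply (filterlim_within_subset (fun z => (r <= Cmod (z - c))%R)); [| now apply Hc].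
    now intros y [_ Hy]. }
  assert (Esw : forall z, swept 1 1 r 1 z -> G z = H z).
  { intros z Hz. assert (E : G z - H z = 0).
    { apply (Hdense (fun z => G z - H z)); [| | exact Hz].
      - intros y Hy. apply filterlim_Cminus; auto.
      - intros y Y1 Y2 _. rewrite HGH by assumption. ring. }
    replace (G z) with ((G z - H z) + H z) by ring. rewrite E. ring. }
  assert (Ecr : forall z, (Cmod z < 1)%R -> (r < Cmod (z - c))%R -> z <> 0 -> G z = 0).
  { intros z Hz1 Hz2 Hz0.
    assert (Hdec := crescent_decomposition r G G1 z Hr).
    fold c in Hdec. specialize (Hdec (C1_up_to_subset _ _ _ _ G G1 (fun y Hy => proj1 Hy)
      (fun y Hy => proj1 (swept_bounds r y Hr Hy)) HG) Hz1 Hz2).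
    assert (Hcau := cauchy_disc G G1 z Gc Gd' Gcl (conj (proj1 (Cmod_gt_0 z) Hz0) Hz1)).
    set (w := RtoC r / (z - c)) in *.
    assert (Hzc : z - c <> 0) by (apply Cmod_gt_0; lra).
    assert (Hw : (0 < Cmod w < 1)%R).
    { unfold w. rewrite Cmod_div, Hrm by exact Hzc. split.
      - apply Rdiv_lt_0_compat; lra.
      - apply Rmult_lt_reg_r with (Cmod (z - c)); [lra |].
        unfold Rdiv. rewrite Rmult_assoc, Rinv_l by lra. lra. }
    assert (HcW := cauchy_disc W W1 w Wc Wd Wc1 Hw).
    assert (HmW := mean_value_disc W W1 Wc Wd Wc1).
    rewrite HW0 in HmW.
    assert (HWE : rcts (fun t => W (expi t))).
    { apply (rcts_on_circle (fun v => (Cmod v <= 1)%R)); [exact cts_expi | |].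
      - intros t. rewrite Cmod_expi. lra.
      - intros t. apply Wc. rewrite Cmod_expi. lra. }
    assert (Hnz : forall t, 1 - expi (- t) * w <> 0) by (intros t; apply expi_neg_neq; lra).
    assert (Hden : rcts (fun t => 1 - expi (- t) * w)).
    { apply cts_minus; [apply cts_const | apply cts_mult; [apply cts_expi_opp | apply cts_const]]. }
    assert (Hq : rcts (fun t => W (expi t) / (1 - expi (- t) * w))) by now apply cts_div.
    (* After inversion the inner term is Cauchy's integral of [W] at [w], less the integral of [W]
       over the unit circle; the latter is [2 PI * W 0 = 0]. *)
    assert (EJ : Cint (fun t => G (tcirc r t) * (1 / (1 - expi t * w) - 1)) = RtoC (2 * PI) * H z).
    { transitivity (Cint (fun t => W (expi t) / (1 - expi (- t) * w) - W (expi t))).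
      (* The inversion sends [tcirc r t] to [expi (- t)], so the circle is traversed in the opposite
         direction. *)
      - rewrite <- (Cint_reflect (fun t => W (expi t) / (1 - expi (- t) * w) - W (expi t)))
          by now apply cts_minus.
        apply Cint_ext. intros t.
        assert (E1 : expi (2 * PI - t) = expi (- t)).
        { unfold Rminus. rewrite expi_plus, expi_2PI. ring. }
        rewrite expi_opp, E1.
        replace (/ expi (- t)) with (expi t)
          by (rewrite expi_opp; field; apply expi_neq_0).
        rewrite HW by apply expi_neq_0.
        replace (c + RtoC r / expi (- t)) with (tcirc r t).
        + rewrite Esw by (apply swept_circ; lra). unfold Cdiv. ring.
        + rewrite tcirc_center. fold c. rewrite expi_opp. field. apply expi_neq_0.
      - rewrite Cint_minus, HmW, <- HcW by assumption.
        rewrite HW by (apply Cmod_gt_0; lra).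
        replace (c + RtoC r / w) with z by (unfold w; field; auto). ring. }
    rewrite EJ, <- Hcau, (HGH z Hz1 Hz2) in Hdec.
    assert (E : RtoC (2 * PI) * H z = 0).
    { replace (RtoC (2 * PI) * H z) with ((RtoC (2 * PI) * H z + RtoC (2 * PI) * H z) - RtoC (2 * PI) * H z) by ring.
      rewrite <- Hdec. ring. }
    rewrite (HGH z Hz1 Hz2).
    replace (H z) with (/ RtoC (2 * PI) * (RtoC (2 * PI) * H z)) by (field; exact HP).
    rewrite E. ring. }
  (* The crescent is only part of the disc and of the exterior. Vanishing is therefore first taken
     to the two boundary circles, from which the Cauchy formulas for [G] and [W] recover all
     values. *)
  assert (Gsw := Hdense G GcK Ecr).
  assert (GE : forall t, G (expi t) = 0).
  { intros t. rewrite <- tcirc_1. apply Gsw, swept_circ. lra. }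
  assert (WE : forall t, W (expi t) = 0).
  { intros t. rewrite HW by apply expi_neq_0.
    replace (c + RtoC r / expi t) with (tcirc r (- t)).
    - rewrite <- Esw by (apply swept_circ; lra). apply Gsw, swept_circ. lra.
    - rewrite tcirc_center, expi_opp. reflexivity. }
  assert (Hzero : forall (phi : C -> C) (w : C), RtoC (2 * PI) * phi w = 0 -> phi w = 0).
  { intros phi w E. replace (phi w) with (/ RtoC (2 * PI) * (RtoC (2 * PI) * phi w)) by (field; exact HP).
    rewrite E. ring. }
  split.
  - intros z Hz. apply Hzero. destruct (Ceq_dec z 0) as [-> | Hz0].
    + rewrite <- (mean_value_disc G G1 Gc Gd' Gcl), (Cint_ext _ (fun _ => 0)) by exact GE.
      rewrite Cint_const. ring.
    + rewrite (cauchy_disc G G1 z Gc Gd' Gcl (conj (proj1 (Cmod_gt_0 z) Hz0) Hz)).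
      rewrite (Cint_ext _ (fun _ => 0)); [rewrite Cint_const; ring |].
      intros t. rewrite GE. unfold Cdiv. ring.
  - intros z Hz. set (w := RtoC r / (z - c)).
    assert (Hzc : z - c <> 0) by (apply Cmod_gt_0; lra).
    assert (Hw : (0 < Cmod w < 1)%R).
    { unfold w. rewrite Cmod_div, Hrm by exact Hzc. split.
      - apply Rdiv_lt_0_compat; lra.
      - apply Rmult_lt_reg_r with (Cmod (z - c)); [lra |].
        unfold Rdiv. rewrite Rmult_assoc, Rinv_l by lra. lra. }
    replace (H z) with (W w).
    + apply Hzero. rewrite (cauchy_disc W W1 w Wc Wd Wc1 Hw).
      rewrite (Cint_ext _ (fun _ => 0)); [rewrite Cint_const; ring |].
      intros t. rewrite WE. unfold Cdiv. ring.
    + rewrite HW by (apply Cmod_gt_0; lra). f_equal. unfold w. field. auto.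
Qed.

(** * Existence *)

Lemma rapid_scal (k : C) (a : nat -> C) : rapid a -> rapid (fun n => k * a n).
Proof.
  intros Ha. apply (rapid_le a _ 0 (Cmod k) Ha). intros n.
  rewrite Cmod_mult, pow_O. lra.
Qed.

Lemma PS_scal (k : C) (a : nat -> C) (z : C) :
  rapid a -> (Cmod z <= 1)%R -> PS (fun n => k * a n) z = k * PS a z.
Proof.
  intros Ha Hz. apply Cseries_unique.
  apply (is_Cseries_ext (fun n => k * (a n * z ^ n))); [intros n; ring |].
  apply is_Cseries_scal. now apply is_Cseries_PS.
Qed.

(** Coefficients of [- w ^ 2 / r * PS a ' w], which is the [z]-derivative of
    [PS a w] for [w = r / (z - c)]. *)
Definition inverted_deriv (r : R) (a : nat -> C) (n : nat) : C :=
  match n with O => RtoC 0 | S m => RtoC (- / r) * (RtoC (INR m) * a m) end.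

Lemma rapid_inverted_deriv (r : R) (a : nat -> C) : rapid a -> rapid (inverted_deriv r a).
Proof.
  intros Ha. apply rapid_unshift. cbn [inverted_deriv].
  apply rapid_scal. apply (rapid_le a _ 1 1 Ha). intros n.
  rewrite Cmod_mult, Cmod_R, Rabs_pos_eq by apply pos_INR.
  apply Rmult_le_compat_r; [apply Cmod_ge_0 |]. rewrite S_INR. lra.
Qed.

Lemma PS_inverted_deriv (r : R) (a : nat -> C) (w : C) :
  rapid a -> (Cmod w <= 1)%R ->
  PS (inverted_deriv r a) w = RtoC (- / r) * (w * w) * PS (dPS a) w.
Proof.
  intros Ha Hw. apply Cseries_unique.
  (* The terms of degree [0] and [1] vanish, the second through the factor [INR 0]; what remains
     carries the factor [w * w]. *)
  apply (is_series_decr_1 (K := C_AbsRing) (V := C_NormedModule)).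
  apply (is_series_decr_1 (K := C_AbsRing) (V := C_NormedModule)).
  apply (is_Cseries_eq _ (RtoC (- / r) * (w * w) * PS (dPS a) w)).
  { change (RtoC (- / r) * (w * w) * PS (dPS a) w =
      RtoC (- / r) * (w * w) * PS (dPS a) w + - (RtoC 0 * w ^ 0) +
      - (RtoC (- / r) * (RtoC (INR 0) * a O) * w ^ 1)). cbn [INR]. ring. }
  apply (is_Cseries_ext (fun n => RtoC (- / r) * (w * w) * (dPS a n * w ^ n))).
  { intros n. unfold inverted_deriv, dPS. rewrite !Cpow_S. ring. }
  apply is_Cseries_scal, is_Cseries_PS; [now apply rapid_dPS | exact Hw].
Qed.

(** All derivatives are power series with rapidly decreasing coefficients, hence continuous on the
    closed disc. *)
Lemma Ainf_disc_PS (a : nat -> C) : rapid a -> Ainf unit_disc (PS a).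
Proof.
  intros Ha.
  assert (Hr : forall l, rapid (Nat.iter l dPS a)).
  { intros l. induction l as [| l IH]; [exact Ha | now apply rapid_dPS]. }
  apply (smooth_extension_intro unit_disc (closure unit_disc) _ (fun l => PS (Nat.iter l dPS a))).
  - intros z Hz. apply (proj1 (unit_disc_iff _)) in Hz.
    generalize (open_unit_disc z Hz). apply filter_imp. intros y Hy. now apply (proj2 (unit_disc_iff y)).
  - assert (Hcl : forall z, closure unit_disc z -> (Cmod z <= 1)%R).
    { intros z Hz. apply (proj1 (closure_disc 0 1 z Rlt_0_1)) in Hz. now replace (z - 0) with z in Hz by ring. }
    intros l z Hz. apply (filterlim_within_subset (fun w => (Cmod w <= 1)%R)); [exact Hcl |].
    apply PS_cont; auto.
  - intros l z Hz. apply (proj1 (unit_disc_iff _)) in Hz. now apply PS_deriv.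
  - reflexivity.
Qed.

(** The map [z -> r / (z - c)] carries the closed exterior into the closed unit disc and infinity to
    [0], so [d O] is the value at infinity. Differentiation in [z] acts on coefficients by
    [inverted_deriv], which preserves rapid decay. *)
Lemma Ainf0_inverted_PS (c : C) (r : R) (d : nat -> C) :
  (0 < r)%R -> rapid d -> d O = 0 -> Ainf0 c r (fun z => PS d (RtoC r / (z - c))).
Proof.
  intros Hr Hd Hd0.
  assert (HrC : RtoC r <> 0) by (intros E; injection E; lra).
  assert (Hrm : Cmod (RtoC r) = r) by (rewrite Cmod_R; apply Rabs_pos_eq; lra).
  assert (Hrap : forall l, rapid (Nat.iter l (inverted_deriv r) d)).
  { intros l. induction l as [| l IH]; [exact Hd | now apply rapid_inverted_deriv]. }
  assert (Hnz : forall z, (r <= Cmod (z - c))%R -> z - c <> 0).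
  { intros z Hz. apply Cmod_gt_0. lra. }
  assert (Hmod : forall z, z - c <> 0 -> Cmod (RtoC r / (z - c)) = (r / Cmod (z - c))%R).
  { intros z Hz. now rewrite Cmod_div, Hrm. }
  assert (Hw : forall z, (r <= Cmod (z - c))%R -> (Cmod (RtoC r / (z - c)) <= 1)%R).
  { intros z Hz. rewrite Hmod by now apply Hnz.
    apply Rmult_le_reg_r with (Cmod (z - c)); [lra |].
    unfold Rdiv. rewrite Rmult_assoc, Rinv_l by lra. lra. }
  assert (Hw' : forall z, (r < Cmod (z - c))%R -> (Cmod (RtoC r / (z - c)) < 1)%R).
  { intros z Hz. rewrite Hmod by (apply Hnz; lra).
    apply Rmult_lt_reg_r with (Cmod (z - c)); [lra |].
    unfold Rdiv. rewrite Rmult_assoc, Rinv_l by lra. lra. }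
  assert (Dinv : forall z, z - c <> 0 ->
    cderiv (fun z => RtoC r / (z - c)) z (RtoC r * (- (1 + - 0) / ((z - c) * (z - c))))).
  { intros z Hz. apply cderiv_scal.
    apply (has_deriv_inv (fun v : C => v) id_C_cont (fun v => v - c)); [exact Hz |].
    apply has_deriv_plus; [apply has_deriv_id |].
    apply (has_deriv_eq _ _ _ 0); [ring | apply has_deriv_const]. }
  assert (Hmain := smooth_extension_intro (disc_exterior c r) (fun z => ~ disc c r z)
    (fun z => PS d (RtoC r / (z - c)))
    (fun l z => PS (Nat.iter l (inverted_deriv r) d) (RtoC r / (z - c)))).
  assert (HK : forall z, ~ disc c r z -> (r <= Cmod (z - c))%R).
  { intros z Hz. apply Rnot_lt_le. exact Hz. }
  destruct Hmain as [A B].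
  - intros z Hz. apply (proj1 (disc_exterior_iff c r z Hr)) in Hz.
    generalize (open_exterior c r z Hz). apply filter_imp. intros y Hy. now apply (proj2 (disc_exterior_iff c r y Hr)).
  - intros l z Hz.
    apply (filterlim_comp _ _ _ (fun z => RtoC r / (z - c)) (PS (Nat.iter l (inverted_deriv r) d)))
      with (within (fun w => (Cmod w <= 1)%R) (locally (RtoC r / (z - c)))).
    + intros P HPP. unfold filtermap, within.
      assert (L1 : locally z (fun y : C => (Cmod (RtoC r / (y - c)) <= 1)%R -> P (RtoC r / (y - c))))
        by exact (has_deriv_cont _ id_C_cont _ _ _ (Dinv z (Hnz z (HK z Hz))) _ HPP).
      revert L1. apply filter_imp. intros y Hy Hy2. apply Hy, Hw, HK, Hy2.
    + apply PS_cont; auto.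
  - intros l z Hz. apply (proj1 (disc_exterior_iff c r z Hr)) in Hz.
    assert (Hz0 : z - c <> 0) by (apply Hnz; lra).
    assert (Hz1 := Hw' z Hz).
    change (Nat.iter (S l) (inverted_deriv r) d)
      with (inverted_deriv r (Nat.iter l (inverted_deriv r) d)).
    rewrite PS_inverted_deriv by (auto; lra).
    apply (has_deriv_eq _ _ _ (PS (dPS (Nat.iter l (inverted_deriv r) d)) (RtoC r / (z - c)) *
      (RtoC r * (- (1 + - 0) / ((z - c) * (z - c)))))).
    { rewrite RtoC_opp, RtoC_inv by lra. field. auto. }
    apply (has_deriv_comp _ id_C_cont (PS (Nat.iter l (inverted_deriv r) d)) (fun z => RtoC r / (z - c)));
      [| now apply Dinv].
    now apply PS_deriv.
  - reflexivity.
  - split; [exact A |]. split; [exact B |].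
    intros P HP. apply locally_Cmod in HP. destruct HP as [e [He HP]].
    destruct (PS_Lipschitz d Hd) as [L HL].
    assert (HL0 := Rabs_pos L). assert (Hc0 := Cmod_ge_0 c).
    assert (Hq : (0 <= r * (Rabs L + 1) / e)%R).
    { apply Rmult_le_pos; [apply Rmult_le_pos; lra | apply Rlt_le, Rinv_0_lt_compat; lra]. }
    (* [Cmod c] passes from [z] to [z - c], [r] keeps [z] outside the disc, and the last summand
       makes the Lipschitz bound [L * r / Cmod (z - c)] smaller than [e]. *)
    exists (Cmod c + r + r * (Rabs L + 1) / e)%R. intros z Hz. apply HP.
    assert (Hzc : (r + r * (Rabs L + 1) / e < Cmod (z - c))%R).
    { pose proof (Cmod_triangle (z - c) c) as T. replace (z - c + c) with z in T by ring. lra. }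
    assert (Hz0 : z - c <> 0) by (apply Hnz; lra).
    assert (H0 : PS d 0 = 0) by (rewrite PS_0; exact Hd0).
    specialize (HL (RtoC r / (z - c)) 0 ltac:(apply Hw; lra) ltac:(rewrite Cmod_0; lra)).
    rewrite H0 in HL. eapply Rle_lt_trans; [exact HL |].
    replace (RtoC r / (z - c) - 0) with (RtoC r / (z - c)) by ring.
    rewrite Hmod by exact Hz0.
    apply Rmult_lt_reg_r with (Cmod (z - c)); [lra |].
    replace (L * (r / Cmod (z - c)) * Cmod (z - c))%R with (L * r)%R by (field; lra).
    apply Rle_lt_trans with (r * (Rabs L + 1))%R; [pose proof (Rle_abs L); nra |].
    replace (r * (Rabs L + 1))%R with (e * (r * (Rabs L + 1) / e))%R by (field; lra).
    apply Rmult_lt_compat_l; lra.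
Qed.

Lemma crescent_existence (r : R) (F : nat -> C -> C) :
  (0 < r < 1)%R ->
  (forall l, C1_up_to (fun z => (Cmod z < 1)%R /\ (r < Cmod (z - RtoC (1 - r)))%R)
     (swept 1 1 r 1) (F l) (F (S l))) ->
  exists a d, rapid a /\ rapid d /\ d O = 0 /\
    forall z, (Cmod z < 1)%R -> (r < Cmod (z - RtoC (1 - r)))%R ->
      F O z = PS a z + PS d (RtoC r / (z - RtoC (1 - r))).
Proof.
  intros Hr HF. pose proof PI_RGT_0 as HPI.
  assert (HP : RtoC (2 * PI) <> 0) by (intros E; injection E; lra).
  assert (Hrm : Cmod (RtoC r) = r) by (rewrite Cmod_R; apply Rabs_pos_eq; lra).
  set (k := / RtoC (2 * PI)).
  set (al := fun n => coef (F O) 1 (-1 * Z.of_nat n)).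
  set (de := fun n => coef (F O) r (1 * Z.of_nat n)).
  assert (Hal : rapid al) by (apply (rapid_coef r F Hr HF 1 (-1)); [lra | reflexivity]).
  assert (Hde : rapid de) by (apply (rapid_coef r F Hr HF r 1); [lra | reflexivity]).
  (* The term of degree [0] is dropped: it is the integral of [F O] over the inner circle, which the
     [- 1] in the inner kernel subtracts. *)
  set (d := fun n => match n with O => RtoC 0 | S m => k * de (S m) end).
  assert (HG : forall s, (r <= s <= 1)%R -> rcts (fun t => F O (tcirc s t))).
  { intros s Hs. assert (J : rcts (fun t => F O (tcirc (clamp r 1 s) t))).
    { apply (jcts_slice (fun s t => F O (tcirc (clamp r 1 s) t))).
      intros t. apply jcts_swept; [lra |]. apply (proj1 (HF O)), swept_circ, clamp_range. lra. }
    now rewrite clamp_id in J by exact Hs. }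
  exists (fun n => k * al n), d. split; [now apply rapid_scal |]. split.
  { apply rapid_unshift. cbn [d]. apply (rapid_scal k (fun n => de (S n))). now apply rapid_shift. }
  split; [reflexivity |].
  intros z Hz1 Hz2. set (c := RtoC (1 - r)) in *. set (w := RtoC r / (z - c)).
  assert (Hzc : z - c <> 0) by (apply Cmod_gt_0; lra).
  assert (Hw : (Cmod w < 1)%R).
  { unfold w. rewrite Cmod_div, Hrm by exact Hzc.
    apply Rmult_lt_reg_r with (Cmod (z - c)); [lra |].
    unfold Rdiv. rewrite Rmult_assoc, Rinv_l by lra. lra. }
  assert (Hdec := crescent_decomposition r (F O) (F 1%nat) z Hr (HF O) Hz1 Hz2).
  fold c w in Hdec.
  assert (S1 : Cint (fun t => F O (expi t) / (1 - expi (- t) * z)) = PS al z).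
  { symmetry. apply Cseries_unique.
    assert (HS := Cint_geometric (fun t => F O (tcirc 1 t)) (fun t => expi (- t)) z (HG 1%R ltac:(lra))
      cts_expi_opp (fun t => Req_le _ _ (Cmod_expi _)) Hz1).
    apply (is_Cseries_eq _ _ (Cint (fun t => F O (expi t) / (1 - expi (- t) * z)))) in HS.
    2: { apply Cint_ext. intros t. now rewrite tcirc_1. }
    revert HS. apply is_Cseries_ext. intros n. f_equal. unfold al, coef.
    apply Cint_ext. intros t. rewrite expi_pow, mult_IZR, <- INR_IZR_INZ. do 2 f_equal. ring. }
  assert (S2 : Cint (fun t => F O (tcirc r t) / (1 - expi t * w)) = PS de w).
  { symmetry. apply Cseries_unique.
    assert (HS := Cint_geometric (fun t => F O (tcirc r t)) expi w (HG r ltac:(lra))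
      cts_expi (fun t => Req_le _ _ (Cmod_expi _)) Hw).
    revert HS. apply is_Cseries_ext. intros n. f_equal. unfold de, coef.
    apply Cint_ext. intros t. rewrite expi_pow, mult_IZR, <- INR_IZR_INZ. do 2 f_equal. ring. }
  assert (S3 : Cint (fun t => F O (tcirc r t)) = de O).
  { apply Cint_ext. intros t. cbn [Z.of_nat Z.mul]. rewrite Rmult_0_l, expi_0. ring. }
  assert (Hnz : forall t, 1 - expi t * w <> 0).
  { intros t. apply one_minus_neq_0; [rewrite Cmod_expi; lra | exact Hw]. }
  rewrite S1 in Hdec.
  rewrite (Cint_ext (fun t => F O (tcirc r t) * _) (fun t => F O (tcirc r t) / (1 - expi t * w) - F O (tcirc r t))) in Hdec
    by (intros t; field; apply Hnz).
  rewrite Cint_minus, S2, S3 in Hdec.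
  2: { apply cts_div; [exact Hnz | apply HG; lra |].
       apply cts_minus; [apply cts_const | apply cts_mult; [apply cts_expi | apply cts_const]]. }
  2: { apply HG. lra. }
  rewrite PS_scal by (auto; lra).
  assert (Ed : PS d w = k * (PS de w - de O)).
  { apply Cseries_unique.
    apply (is_series_decr_1 (K := C_AbsRing) (V := C_NormedModule)).
    apply (is_Cseries_eq _ (k * (PS de w - de O))).
    { change (k * (PS de w - de O) = k * (PS de w - de O) + - (RtoC 0 * w ^ 0)). ring. }
    apply (is_Cseries_ext (fun n => k * (de (S n) * w ^ S n))); [intros n; cbn [d]; ring |].
    apply is_Cseries_scal.
    apply (is_series_incr_1 (K := C_AbsRing) (V := C_NormedModule) (fun n => de n * w ^ n)).
    apply (is_Cseries_eq _ (PS de w)).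
    { change (PS de w = PS de w - de O + de O * w ^ 0). cbn [Cpow]. ring. }
    apply is_Cseries_PS; [exact Hde | lra]. }
  rewrite Ed. unfold k.
  replace (F O z) with (/ RtoC (2 * PI) * (RtoC (2 * PI) * F O z)) by (field; exact HP).
  rewrite Hdec. field. exact HP.
Qed.

(** Makes limit algebra available at infinity, for the difference of two exterior parts. *)
#[local] Instance C_infinity_filter : Filter C_infinity.
Proof.
  split.
  - now exists 0%R.
  - intros P Q [M HM] [N HN]. exists (Rmax M N). intros z Hz.
    pose proof (Rmax_l M N). pose proof (Rmax_r M N). split; [apply HM | apply HN]; lra.
  - intros P Q HPQ [M HM]. exists M. auto.
Qed.

Lemma Ainf_disc_extension (g : C -> C) :
  Ainf unit_disc g ->
  exists G G1, C1_up_to (fun z => (Cmod z < 1)%R) (fun z => (Cmod z <= 1)%R) G G1 /\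
    forall z, (Cmod z < 1)%R -> G z = g z.
Proof.
  intros [Hh He].
  destruct (smooth_extension unit_disc (closure unit_disc) g) as [F [HF HF0]]; auto.
  - intros z Hz. apply (proj1 (unit_disc_iff _)) in Hz.
    generalize (open_unit_disc z Hz). apply filter_imp. intros y Hy. now apply (proj2 (unit_disc_iff y)).
  - intros z Hz U HU. exists z. split; [exact (locally_singleton z U HU) | exact Hz].
  - exists (F 0%nat), (F 1%nat). split.
    + refine (C1_up_to_subset _ _ _ _ _ _ _ _ (HF 0%nat)).
      * intros z. apply unit_disc_iff.
      * intros z Hz. apply (proj2 (closure_disc 0 1 z Rlt_0_1)). now replace (z - 0) with z by ring.
    + intros z Hz. apply HF0. now apply (proj2 (unit_disc_iff z)).
Qed.

Lemma Ainf0_extension (c : C) (r : R) (h : C -> C) :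
  (0 < r)%R -> Ainf0 c r h ->
  exists H H1,
    C1_up_to (fun z => (r < Cmod (z - c))%R) (fun z => (r <= Cmod (z - c))%R) H H1 /\
    (forall z, (r < Cmod (z - c))%R -> H z = h z) /\
    filterlim H C_infinity (locally (RtoC 0)).
Proof.
  intros Hr [Hh [He Hi]].
  destruct (smooth_extension (disc_exterior c r) (fun z => ~ disc c r z) h) as [F [HF HF0]]; auto.
  - intros z Hz. apply (proj1 (disc_exterior_iff c r z Hr)) in Hz.
    generalize (open_exterior c r z Hz). apply filter_imp. intros y Hy.
    now apply (proj2 (disc_exterior_iff c r y Hr)).
  - intros z Hz. apply (proj1 (disc_exterior_iff c r z Hr)) in Hz. unfold disc. lra.
  - assert (E : forall z, (r < Cmod (z - c))%R -> F 0%nat z = h z).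
    { intros z Hz. apply HF0. now apply (proj2 (disc_exterior_iff c r z Hr)). }
    exists (F 0%nat), (F 1%nat). split; [| split; [exact E |]].
    + refine (C1_up_to_subset _ _ _ _ _ _ _ _ (HF 0%nat)).
      * intros z. apply (disc_exterior_iff c r z Hr).
      * intros z Hz. unfold disc. lra.
    + apply filterlim_ext_loc with h; [| exact Hi].
      exists (r + Cmod c)%R. intros z Hz. symmetry. apply E.
      pose proof (Cmod_triangle (z - c) c) as T. replace (z - c + c) with z in T by ring. lra.
Qed.

Theorem theorem32 (c : C) (r : R) (hr : (0 < r)%R)
    (htan : internally_tangent_unit c r (RtoC 1))
    (f : C -> C) (hf : Ainf (crescent c r) f) :
  exists g h : C -> C,
    Ainf unit_disc g /\ Ainf0 c r h /\
    (forall z, crescent c r z -> f z = (g z + h z)%C) /\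
    (forall g' h' : C -> C,
       Ainf unit_disc g' -> Ainf0 c r h' ->
       (forall z, crescent c r z -> f z = (g' z + h' z)%C) ->
       (forall z, unit_disc z -> g' z = g z) /\
       (forall z, disc_exterior c r z -> h' z = h z)).
Proof.
  destruct (tangent_center c r hr htan) as [-> Hr1]. clear htan.
  assert (Hr : (0 < r < 1)%R) by lra.
  set (c := RtoC (1 - r)) in *.
  assert (Hcr : forall z, crescent c r z <-> (Cmod z < 1)%R /\ (r < Cmod (z - c))%R).
  { intros z. unfold crescent. now rewrite unit_disc_iff, disc_exterior_iff by exact hr. }
  destruct hf as [Hhol Hext].
  destruct (smooth_extension (crescent c r) (closure (crescent c r)) f) as [F [HF HF0]]; auto.
  { intros z Hz. apply (proj1 (Hcr z)) in Hz. destruct Hz as [Hz1 Hz2].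
    generalize (filter_and _ _ (open_unit_disc z Hz1) (open_exterior c r z Hz2)).
    apply filter_imp. intros y Hy. now apply (proj2 (Hcr y)). }
  { intros z Hz U HU. exists z. split; [exact (locally_singleton z U HU) | exact Hz]. }
  destruct (crescent_existence r F Hr) as [a [d [Ha [Hd [Hd0 Hdec]]]]].
  (* The extensions are continuous on the closure of the crescent, which contains the swept region
     by density. *)
  { intros l. refine (C1_up_to_subset _ _ _ _ _ _ _ _ (HF l)).
    - intros z Hz. now apply (proj2 (Hcr z)).
    - intros z Hz U HU. destruct (swept_dense r z U Hr Hz HU) as [w [W1 [W2 [W3 _]]]].
      exists w. split; [exact W1 |]. now apply (proj2 (Hcr w)). }
  set (g := PS a). set (h := fun z => PS d (RtoC r / (z - c))).
  assert (Hg : Ainf unit_disc g) by now apply Ainf_disc_PS.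
  assert (Hh : Ainf0 c r h) by exact (Ainf0_inverted_PS c r d hr Hd Hd0).
  assert (Hsum : forall z, crescent c r z -> f z = g z + h z).
  { intros z Hz. rewrite <- HF0 by exact Hz. apply (proj1 (Hcr z)) in Hz. now apply Hdec. }
  exists g, h. split; [exact Hg |]. split; [exact Hh |]. split; [exact Hsum |].
  intros g' h' Hg' Hh' Hsum'.
  destruct (Ainf_disc_extension g Hg) as [G [G1 [CG EG]]].
  destruct (Ainf_disc_extension g' Hg') as [G' [G1' [CG' EG']]].
  destruct (Ainf0_extension c r h hr Hh) as [H [H1 [CH [EH LH]]]].
  destruct (Ainf0_extension c r h' hr Hh') as [H' [H1' [CH' [EH' LH']]]].
  (* Applied to [g' - g] and [h - h'], which agree on the crescent because both sums equal [f]; both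
     differences then vanish on their full domains. *)
  destruct (crescent_uniqueness r _ _ _ _ Hr (C1_up_to_minus _ _ _ _ _ _ CG' CG)
    (C1_up_to_minus _ _ _ _ _ _ CH CH')) as [U1 U2].
  - apply (filterlim_C_eq (0 - 0)); [ring |]. now apply filterlim_Cminus.
  - intros z Hz1 Hz2. fold c in Hz2. rewrite EG, EG', EH, EH' by assumption.
    assert (Hz : crescent c r z) by now apply (proj2 (Hcr z)).
    assert (E : g z + h z = g' z + h' z) by now rewrite <- Hsum, <- Hsum'.
    replace (h z) with ((g z + h z) - g z) by ring. rewrite E. ring.
  - split.
    + intros z Hz. apply (proj1 (unit_disc_iff _)) in Hz.
      rewrite <- EG, <- EG' by exact Hz.
      replace (G' z) with ((G' z - G z) + G z) by ring. rewrite (U1 z Hz). ring.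
    + intros z Hz. apply (proj1 (disc_exterior_iff c r z hr)) in Hz.
      rewrite <- EH, <- EH' by exact Hz.
      replace (H z) with ((H z - H' z) + H' z) by ring. rewrite (U2 z Hz). ring.
Qed.
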